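(* Let $\Gamma$ be the fundamental group of a closed surface of genus $\geq e^{1000000}$. Suppose $x$ and $y\neq 0$ are elements in $\mathbb Q\Gamma$ satisfying a nontrivial relation $ax+by=0$ (that is, $a,b\in\mathbb Q\Gamma$ are not both zero). Then there are $q,r\in\mathbb Q\Gamma$ such that $$x=qy+r \quad\text{and}\quad |r|<|y| \text{ or } r=0.$$
   Context: The surface group $\Gamma$ acts by a covering space action on the hyperbolic plane $\mathbb H^2$. Pick an orbit of $\Gamma$ in $\mathbb H^2$ and identify group elements with points of that orbit. A group ring element $x\in\mathbb Q\Gamma$ is a finite formal linear combination $x=\sum x_\gamma\cdot\gamma$ with $x_\gamma\in\mathbb Q$. The support $X$ of $x$ consists of all group elements $\gamma$ with $x_\gamma\neq 0$, thought of as points in $\mathbb H^2$. The diameter $|x|$ is the maximal distance in $\mathbb H^2$ between a pair of points in $X$. *)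

(* Defs.v *)
From HB Require Import structures.
From mathcomp Require Import all_boot all_order all_algebra.
From mathcomp Require Import finmap.
From mathcomp Require Import all_classical all_reals all_analysis.
From mathcomp Require Import -(notations) monalg.
From Stdlib Require Import Relation_Operators.

Set Implicit Arguments.
Unset Strict Implicit.
Unset Printing Implicit Defensive.

Import Order.TTheory GRing.Theory Num.Theory.
Import numFieldNormedType.Exports.

Local Open Scope classical_set_scope.
Local Open Scope ring_scope.

(* [monalg.malg K R] is the module of finitely supported functions from K to R.
   Its ring structure in [monalg] is restricted to monoids in which x * y = 1
   forces x = y = 1, hence the convolution product below.  The file [monalg] is
   not imported because its notations conflict with those of the analysis
   library. *)
Definition group_ring (G : groupType) : Type := monalg.malg G rat.

HB.instance Definition _ (G : groupType) :=
  GRing.Lmodule.copy (group_ring G) (monalg.malg G rat).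

Section GroupRing.
Variable G : groupType.
Implicit Types (x y z : group_ring G) (g h : G).

Definition gr_coeff x g : rat := monalg.mcoeff g x.
Definition gr_supp x : {fset G} := monalg.msupp x.
Definition gr_mono g (c : rat) : group_ring G := monalg.mkmalgU g c.

Definition gr_one : group_ring G := gr_mono 1%g 1.
Definition gr_mul x y : group_ring G :=
  \sum_(g <- gr_supp x) \sum_(h <- gr_supp y)
    gr_mono (g * h)%g (gr_coeff x g * gr_coeff y h).

Lemma gr_mono0 g : gr_mono g 0 = 0.
Proof. exact: monalg.monalgU0. Qed.

Lemma gr_monoD g : {morph gr_mono g : c d / c + d}.
Proof. exact: monalg.monalgUD. Qed.

Lemma gr_coeff_out x g : g \notin gr_supp x -> gr_coeff x g = 0.
Proof. exact: monalg.mcoeff_outdom. Qed.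

Lemma gr_monoE x : x = \sum_(g <- gr_supp x) gr_mono g (gr_coeff x g).
Proof. exact: monalg.monalgE. Qed.

Lemma gr_coeff_mono g c : gr_coeff (gr_mono g c) g = c.
Proof. exact: monalg.mcoeffUU. Qed.

Lemma gr_supp_mono g c : (gr_supp (gr_mono g c) `<=` [fset g])%fset.
Proof. exact: monalg.msuppU_le. Qed.

Lemma gr_suppD x y : (gr_supp (x + y)%R `<=` gr_supp x `|` gr_supp y)%fset.
Proof. exact: monalg.msuppD_le. Qed.

Lemma gr_coeffD x y g : gr_coeff (x + y) g = gr_coeff x g + gr_coeff y g.
Proof. exact: monalg.mcoeffD. Qed.

Lemma gr_mulw (d1 d2 : {fset G}) x y :
  (gr_supp x `<=` d1)%fset -> (gr_supp y `<=` d2)%fset ->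
  gr_mul x y = \sum_(g <- d1) \sum_(h <- d2)
    gr_mono (g * h)%g (gr_coeff x g * gr_coeff y h).
Proof.
move=> le1 le2; rewrite /gr_mul (big_fset_incl _ le1) /=.
  apply/eq_bigr => g _; apply/big_fset_incl => // h _ /gr_coeff_out ->.
  by rewrite mulr0 gr_mono0.
move=> g _ /gr_coeff_out gx.
by rewrite big1 => // h _; rewrite gx mul0r gr_mono0.
Qed.

Lemma gr_mul_mono g h c d :
  gr_mul (gr_mono g c) (gr_mono h d) = gr_mono (g * h)%g (c * d).
Proof.
rewrite (gr_mulw (gr_supp_mono _ _) (gr_supp_mono _ _)).
by rewrite !big_seq_fset1 !gr_coeff_mono.
Qed.

Lemma gr_mulDl : left_distributive gr_mul +%R.
Proof.
move=> x y z.
rewrite (gr_mulw (gr_suppD x y) (fsubset_refl (gr_supp z))).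
rewrite (gr_mulw (fsubsetUl _ (gr_supp y)) (fsubset_refl (gr_supp z))).
rewrite (gr_mulw (fsubsetUr (gr_supp x) _) (fsubset_refl (gr_supp z))).
rewrite -big_split /=; apply/eq_bigr => g _.
rewrite -big_split /=; apply/eq_bigr => h _.
by rewrite gr_coeffD mulrDl gr_monoD.
Qed.

Lemma gr_mulDr : right_distributive gr_mul +%R.
Proof.
move=> z x y.
rewrite (gr_mulw (fsubset_refl (gr_supp z)) (gr_suppD x y)).
rewrite (gr_mulw (fsubset_refl (gr_supp z)) (fsubsetUl _ (gr_supp y))).
rewrite (gr_mulw (fsubset_refl (gr_supp z)) (fsubsetUr (gr_supp x) _)).
rewrite -big_split /=; apply/eq_bigr => g _.
rewrite -big_split /=; apply/eq_bigr => h _.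
by rewrite gr_coeffD mulrDr gr_monoD.
Qed.

Lemma gr_mul0r : left_zero 0 gr_mul.
Proof. by move=> x; apply: (addrI (gr_mul 0 x)); rewrite -gr_mulDl !addr0. Qed.

Lemma gr_mulr0 : right_zero 0 gr_mul.
Proof. by move=> x; apply: (addrI (gr_mul x 0)); rewrite -gr_mulDr !addr0. Qed.

Lemma gr_mul_suml (I : Type) (r : seq I) (F : I -> group_ring G) y :
  gr_mul (\sum_(i <- r) F i) y = \sum_(i <- r) gr_mul (F i) y.
Proof.
exact: (big_morph (gr_mul^~ y) (fun _ _ => gr_mulDl _ _ _) (gr_mul0r _)).
Qed.

Lemma gr_mul_sumr (I : Type) (r : seq I) (F : I -> group_ring G) x :
  gr_mul x (\sum_(i <- r) F i) = \sum_(i <- r) gr_mul x (F i).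
Proof.
exact: (big_morph (gr_mul x) (fun _ _ => gr_mulDr _ _ _) (gr_mulr0 _)).
Qed.

Lemma gr_mulA : associative gr_mul.
Proof.
move=> x y z; rewrite (gr_monoE x) !gr_mul_suml; apply: eq_bigr => g _.
rewrite (gr_monoE y) gr_mul_suml !gr_mul_sumr gr_mul_suml.
apply: eq_bigr => h _; rewrite (gr_monoE z) !gr_mul_sumr.
by apply: eq_bigr => k _; rewrite !gr_mul_mono mulrA mulgA.
Qed.

Lemma gr_mul1r : left_id gr_one gr_mul.
Proof.
move=> x; rewrite {1}(gr_monoE x) [RHS]gr_monoE gr_mul_sumr.
by apply: eq_bigr => g _; rewrite gr_mul_mono mul1r mul1g.
Qed.

Lemma gr_mulr1 : right_id gr_one gr_mul.
Proof.
move=> x; rewrite {1}(gr_monoE x) [RHS]gr_monoE gr_mul_suml.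
by apply: eq_bigr => g _; rewrite gr_mul_mono mulr1 mulg1.
Qed.

Lemma gr_one_neq0 : gr_one != 0.
Proof.
apply/eqP => /(congr1 (gr_coeff^~ 1%g)); rewrite gr_coeff_mono.
by rewrite [RHS]monalg.mcoeff0 => /eqP; rewrite oner_eq0.
Qed.

HB.instance Definition _ := GRing.Zmodule_isNzRing.Build (group_ring G)
  gr_mulA gr_mul1r gr_mulr1 gr_mulDl gr_mulDr gr_one_neq0.

End GroupRing.

Section FundamentalGroup.
Variables (R : realType) (S : topologicalType) (s0 : S).

(* Paths are functions on R of which only the restriction to [0, 1] matters. *)
Definition is_loop (f : R -> S) : Prop :=
  [/\ {within `[0, 1], continuous f}, f 0 = s0 & f 1 = s0].

Definition loop_cat (f h : R -> S) (t : R) : S :=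
  if t <= 2^-1 then f (2 * t) else h (2 * t - 1).

Definition loop_homotopic (f h : R -> S) : Prop :=
  exists H : R * R -> S,
    [/\ {within `[0, 1] `*` `[0, 1], continuous H},
        forall t, t \in `[0, 1] -> H (0, t) = f t /\ H (1, t) = h t
      & forall s, s \in `[0, 1] -> H (s, 0) = s0 /\ H (s, 1) = s0].

(* [cls] induces a group isomorphism from pi_1(S, s0) onto G. *)
Definition is_fundamental_group (G : groupType) : Prop :=
  exists cls : (R -> S) -> G,
    [/\ forall g, exists2 f, is_loop f & cls f = g,
        forall f h, is_loop f -> is_loop h ->
          (cls f = cls h <-> loop_homotopic f h)
      & forall f h, is_loop f -> is_loop h ->
          cls (loop_cat f h) = (cls f * cls h)%g].

End FundamentalGroup.

Section ClosedSurface.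
Variable R : realType.

Definition unit_disk : set (R * R) := [set z | z.1 ^+ 2 + z.2 ^+ 2 <= 1].

(* The unit circle as the boundary of a polygon with 4g sides, side number k
   being parametrized by t in [k, k + 1]. *)
Definition polygon_boundary (g : nat) (t : R) : R * R :=
  (cos (2 * pi * t / (4 * g)%:R), sin (2 * pi * t / (4 * g)%:R)).

(* Side identifications along the word
   a_1 b_1 a_1^-1 b_1^-1 ... a_g b_g a_g^-1 b_g^-1. *)
Inductive side_pairing (g : nat) : R * R -> R * R -> Prop :=
| side_pairing_a (i : nat) (s : R) : (i < g)%N -> 0 <= s <= 1 ->
    side_pairing g (polygon_boundary g ((4 * i)%:R + s))
                   (polygon_boundary g ((4 * i + 3)%:R - s))
| side_pairing_b (i : nat) (s : R) : (i < g)%N -> 0 <= s <= 1 ->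
    side_pairing g (polygon_boundary g ((4 * i + 1)%:R + s))
                   (polygon_boundary g ((4 * i + 4)%:R - s)).

(* S is homeomorphic to the polygon with its sides identified: as the disk is
   compact and S is Hausdorff, f below is automatically a quotient map. *)
Definition closed_surface (g : nat) (S : topologicalType) : Prop :=
  hausdorff_space S /\
  exists f : R * R -> S,
    [/\ {within unit_disk, continuous f},
        forall s, exists2 z, z \in unit_disk & f z = s
      & forall z w, z \in unit_disk -> w \in unit_disk ->
          (f z = f w <-> clos_refl_sym_trans _ (side_pairing g) z w)].

End ClosedSurface.

Section HyperbolicPlane.
Variable R : realType.

(* Upper half-plane model. *)
Record hplane : Type :=
  HPlane { hre : R; him : R; him_gt0 : 0 < him }.

Definition arcosh (t : R) : R := ln (t + Num.sqrt (t ^+ 2 - 1)).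

Definition hdist (p q : hplane) : R :=
  arcosh (1 + ((hre p - hre q) ^+ 2 + (him p - him q) ^+ 2)
              / (2 * him p * him q)).

Variable G : groupType.

(* An isometric left action in which every point has a ball disjoint from its
   translates by the nontrivial elements. *)
Definition covering_action (act : G -> hplane -> hplane) : Prop :=
  [/\ forall p, act 1%g p = p,
      forall g h p, act (g * h)%g p = act g (act h p),
      forall g p q, hdist (act g p) (act g q) = hdist p q
    & forall p, exists2 e : R, 0 < e &
        forall g q r, g != 1%g -> hdist p q < e -> hdist p r < e ->
          act g q <> r].

(* The diameter of the support of x, the element g of G being identified with
   the point g . p of the orbit of p; the empty support has diameter 0. *)
Definition diameter (act : G -> hplane -> hplane) (p : hplane)
    (x : group_ring G) : R :=
  \big[Num.max/0]_(g <- gr_supp x) \big[Num.max/0]_(h <- gr_supp x)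
    hdist (act g p) (act h p).

End HyperbolicPlane.

(* Main.v *)
Require Import Defs.
From HB Require Import structures.
From mathcomp Require Import all_boot all_order all_algebra.
From mathcomp Require Import finmap.
From mathcomp Require Import all_classical all_reals all_analysis.
From mathcomp Require Import ring lra zify.
From Stdlib Require Import Relation_Operators.
Import Order.TTheory GRing.Theory Num.Theory.
Import numFieldNormedType.Exports.
Set Implicit Arguments.
Unset Strict Implicit.
Unset Printing Implicit Defensive.

(* Division.  If every nontrivial element of Gamma displaces every point by at
   least 30, then, for o the base point and M the maximal distance from o to the
   translates of the supports of x and y occurring in the relation, every point at
   distance almost M lies in at most one translate of each support, as the far
   points of a translate determine its coarse centre.  These points therefore
   cancel in pairs, and a combination of translates of y removes from x the points
   that are extremal in a translate: the diameter decreases by 1.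

   The action.  Let W be the group generated by the reflections in the sides of
   a right-angled hexagon, with three sides ("cuffs") on pairwise close lines
   and three sides ("seams") on lines at pairwise distance at least 15.  A
   cubic graph on 2g - 2 vertices describes a surface of genus g glued from
   pairs of pants, hence an action of W on the vertices with a choice of front
   or back: seams exchange front and back, cuffs follow the edges.  A
   nontrivial word of W with a fixed point is, up to conjugation, either a
   reduced closed walk of the graph, whose length is at least the girth, or
   crosses two seams: in both cases it displaces every point by at least 30 if
   the girth is large, which a greedy construction achieves for so many
   vertices.  The relation of the surface group, written with the sides of the
   4g-gon, is matched with the relation of the pants decomposition by moving
   paired letters together.  Developing the polygon along loops then gives a
   homomorphism from Gamma to W, and labelling the permutation action of W by
   elements of Gamma shows that it is injective. *)

(** * Hyperbolic distance *)

Local Open Scope ring_scope.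

(** The number 30 comes from the division: centres of translates are compared through the four-point
    inequality with constant K = 2 ln 2, and the worst comparison bounds a distance by 18 K + 2 <=
    29. Two mechanisms must then each displace by 30. Crossing two seam walls suffices if such walls
    are 15 apart. A word in cuffs alone gains only the short seam length per letter, so its closed
    walk must be long. In the symmetric right-angled hexagon (cosh s - 1)(cosh c - 1) = 1 links seam
    length s and cuff length c: s = 2^-12 makes c at least 15, and the girth required is 30 * 2^12.
    Gamma is known only through loops, with neither a presentation nor a universal cover at hand.
    Hence a relation [C k a] between isometries and elements of Gamma, closed under the group
    operations: it can be checked on the sides of the polygon, and it turns k = 1 into a = 1. The
    displacement 30 is used a second time here: at most one related isometry nearly matches two
    given points, so transports between points of the surface are defined without following
    lifts. *)

Section HyperbolicMetric.
Variable R : realType.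
Implicit Types (p q r : hplane R).

Definition hcosh p q : R :=
  1 + ((hre p - hre q) ^+ 2 + (him p - him q) ^+ 2) / (2 * him p * him q).

Lemma hplane_eq p q : hre p = hre q -> him p = him q -> p = q.
Proof.
case: p q => [x y hy] [x' y' hy'] /= e1 e2; move: hy hy'; rewrite e1 e2.
by move=> a b; rewrite (bool_irrelevance a b).
Qed.

Lemma hcosh_ge1 p q : 1 <= hcosh p q.
Proof.
rewrite /hcosh lerDl divr_ge0 //; first by rewrite addr_ge0 // sqr_ge0.
by rewrite !mulr_ge0 // ltW // him_gt0.
Qed.

Lemma hcoshC p q : hcosh p q = hcosh q p.
Proof.
rewrite /hcosh -(sqrrN (hre p - hre q)) -(sqrrN (him p - him q)) !opprB.
by congr (1 + _ / _); rewrite -!mulrA (mulrC (him p)).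
Qed.

Lemma hcoshxx p : hcosh p p = 1.
Proof. by rewrite /hcosh !subrr expr0n /= addr0 mul0r addr0. Qed.

Definition hexp p q : R := expR (hdist p q / 2).

Lemma expR_hdist p q :
  expR (hdist p q) = hcosh p q + Num.sqrt (hcosh p q ^+ 2 - 1).
Proof.
rewrite /hdist -/(hcosh p q) /arcosh lnK // posrE.
by rewrite ltr_pwDl ?sqrtr_ge0 // (lt_le_trans ltr01) // hcosh_ge1.
Qed.

Lemma hdist_coshE p q : expR (hdist p q) + expR (- hdist p q) = 2 * hcosh p q.
Proof.
have h1 := hcosh_ge1 p q.
have hs : 0 <= hcosh p q ^+ 2 - 1 by rewrite subr_ge0 expr_ge1 // (le_trans ler01).
rewrite expRN expR_hdist; set s := Num.sqrt _.
have s2 : s ^+ 2 = hcosh p q ^+ 2 - 1 by rewrite sqr_sqrtr.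
have s0 : 0 <= s by exact: sqrtr_ge0.
have h : hcosh p q + s != 0 by rewrite gt_eqF //; lra.
apply: (mulIf h); rewrite mulrDl mulVf //; nra.
Qed.

Lemma hdist_ge0 p q : 0 <= hdist p q.
Proof.
rewrite /hdist -/(hcosh p q) /arcosh ln_ge0 //.
have := hcosh_ge1 p q; have := sqrtr_ge0 (hcosh p q ^+ 2 - 1); lra.
Qed.

Lemma hdistC p q : hdist p q = hdist q p.
Proof. by rewrite /hdist -/(hcosh p q) -/(hcosh q p) hcoshC. Qed.

Lemma hdistxx p : hdist p p = 0.
Proof. by rewrite /hdist -/(hcosh p p) hcoshxx /arcosh expr1n subrr sqrtr0 addr0 ln1. Qed.

Lemma hcosh_inj p q p' q' : hcosh p q = hcosh p' q' -> hdist p q = hdist p' q'.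
Proof. by rewrite /hdist -/(hcosh p q) -/(hcosh p' q') => ->. Qed.

Lemma hcosh_le_exp p q : hcosh p q <= expR (hdist p q).
Proof. by rewrite expR_hdist lerDl sqrtr_ge0. Qed.

Lemma hexp_gt0 p q : 0 < hexp p q. Proof. exact: expR_gt0. Qed.

Lemma hexp_ge1 p q : 1 <= hexp p q.
Proof. by rewrite /hexp -[1]expR0 ler_expR divr_ge0 // hdist_ge0. Qed.

(* Twice the hyperbolic cosine and sine of half the distance. *)
Definition hc p q : R := hexp p q + (hexp p q)^-1.
Definition hs p q : R := hexp p q - (hexp p q)^-1.

Lemma hc_ge0 p q : 0 <= hc p q.
Proof. by rewrite addr_ge0 // ?invr_ge0 ltW // hexp_gt0. Qed.
Lemma hs_ge0 p q : 0 <= hs p q.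
Proof. by rewrite subr_ge0; have h := hexp_ge1 p q; rewrite (le_trans _ h) // invf_le1 // hexp_gt0. Qed.

Lemma hexp2 p q : hexp p q ^+ 2 = expR (hdist p q).
Proof. by rewrite /hexp -expRM_natl mulrC -mulr_natr mulrA; congr expR; field. Qed.

Lemma hc2 p q : hc p q ^+ 2 = 2 * (hcosh p q + 1).
Proof.
rewrite /hc sqrrD mulfV ?gt_eqF ?hexp_gt0 // exprVn hexp2 -expRN.
by have := hdist_coshE p q; lra.
Qed.

Lemma hs2 p q : hs p q ^+ 2 = 2 * (hcosh p q - 1).
Proof.
rewrite /hs sqrrB mulfV ?gt_eqF ?hexp_gt0 // exprVn hexp2 -expRN.
by have := hdist_coshE p q; lra.
Qed.

#[local] Opaque hdist.

(** The triangle inequality of the Euclidean plane, with lengths given by their squares; [hptolemy]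
    applies it to products of complex differences. *)
Lemma norm2_le (u v w : R) : 0 <= u -> 0 <= v -> 0 <= w ->
  forall (v1 v2 w1 w2 : R), v1 ^+ 2 + v2 ^+ 2 = v ^+ 2 ->
  w1 ^+ 2 + w2 ^+ 2 = w ^+ 2 ->
  (v1 + w1) ^+ 2 + (v2 + w2) ^+ 2 = u ^+ 2 -> u <= v + w.
Proof.
move=> u0 v0 w0 v1 v2 w1 w2 ev ew eu.
rewrite -(ler_pXn2r (n := 2)) ?nnegrE ?addr_ge0 //.
suff : v1 * w1 + v2 * w2 <= v * w by nra.
apply: le_trans (ler_norm _) _.
rewrite -(ler_pXn2r (n := 2)) ?nnegrE ?mulr_ge0 // real_normK ?num_real //.
rewrite exprMn -ev -ew.
have := sqr_ge0 (v1 * w2 - v2 * w1); nra.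
Qed.

Lemma hc2E p q :
  hc p q ^+ 2 * (him p * him q) = (hre p - hre q) ^+ 2 + (him p + him q) ^+ 2.
Proof.
have hp := him_gt0 p; have hq := him_gt0 q.
by rewrite hc2 /hcosh; field; rewrite !gt_eqF.
Qed.

Lemma hs2E p q :
  hs p q ^+ 2 * (him p * him q) = (hre p - hre q) ^+ 2 + (him p - him q) ^+ 2.
Proof.
have hp := him_gt0 p; have hq := him_gt0 q.
by rewrite hs2 /hcosh; field; rewrite !gt_eqF.
Qed.

(* Ptolemy's inequality for the points p, q^*, r, t^* of the complex plane. *)
Lemma hptolemy p q r t :
  hc p q * hc r t <= hc p t * hc q r + hs p r * hs q t.
Proof.
have hp := him_gt0 p; have hq := him_gt0 q.
have hr := him_gt0 r; have ht := him_gt0 t.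
pose Y := him p * him q * (him r * him t).
have Y0 : 0 < Y by rewrite !mulr_gt0.
pose W := Num.sqrt Y.
have W0 : W != 0 by rewrite gt_eqF // sqrtr_gt0.
have W2 : W ^+ 2 = Y by rewrite sqr_sqrtr // ltW.
pose ab1 := hre p - hre q; pose ab2 := him p + him q.
pose cd1 := hre r - hre t; pose cd2 := him r + him t.
pose ad1 := hre p - hre t; pose ad2 := him p + him t.
pose cb1 := hre r - hre q; pose cb2 := him r + him q.
pose ac1 := hre p - hre r; pose ac2 := him p - him r.
pose bd1 := hre q - hre t; pose bd2 := him t - him q.
(* The norm of complex numbers is multiplicative; dividing by W, the root of the product of the four
   heights, turns norms into [hc] and [hs]. *)
have nrm (f g c1 c2 d1 d2 : R) : f ^+ 2 * g ^+ 2 * Y =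
    (c1 ^+ 2 + c2 ^+ 2) * (d1 ^+ 2 + d2 ^+ 2) ->
    ((c1 * d1 - c2 * d2) / W) ^+ 2 + ((c1 * d2 + c2 * d1) / W) ^+ 2
     = (f * g) ^+ 2.
  move=> e; rewrite !expr_div_n W2 -mulrDl.
  have Yn : Y != 0 by rewrite gt_eqF.
  by apply: (mulIf Yn); rewrite divfK // exprMn e; ring.
have := @norm2_le (hc p q * hc r t) (hc p t * hc q r) (hs p r * hs q t).
apply; rewrite ?mulr_ge0 ?hc_ge0 ?hs_ge0 //.
- apply: (nrm _ _ ad1 ad2 cb1 cb2).
  have re (f g a b c d : R) : f * g * (a * b * (c * d)) = f * (a * d) * (g * (b * c)).
    by ring.
  by rewrite /Y re !hc2E -[hre q - _]opprB sqrrN (addrC (him q)).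
- apply: (nrm _ _ ac1 ac2 bd1 bd2).
  have re (f g a b c d : R) : f * g * (a * b * (c * d)) = f * (a * c) * (g * (b * d)).
    by ring.
  by rewrite /Y re !hs2E -[him q - _]opprB sqrrN.
rewrite -(nrm _ _ ab1 ab2 cd1 cd2); last first.
  have re (f g a b c d : R) : f * g * (a * b * (c * d)) = f * (a * b) * (g * (c * d)).
    by ring.
  by rewrite /Y re !hc2E.
by congr (_ ^+ 2 + _ ^+ 2); rewrite -mulrDl; congr (_ / W);
  rewrite /ad1 /ad2 /cb1 /cb2 /ac1 /ac2 /bd1 /bd2 /ab1 /ab2 /cd1 /cd2; ring.
Qed.

Lemma hc_sym p q : hc p q = hc q p. Proof. by rewrite /hc /hexp hdistC. Qed.
Lemma hcxx p : hc p p = 2. Proof. by rewrite /hc /hexp hdistxx mul0r expR0 invr1. Qed.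
(** Monotonicity of t + 1/t on [1, oo) passes from hyperbolic cosines to exponentials. *)
Lemma addV_le (a m : R) : 1 <= a -> 1 <= m -> a + a^-1 <= m + m^-1 -> a <= m.
Proof.
move=> a1 m1 h; rewrite leNgt; apply/negP => lt.
have a0 : 0 < a by lra.
have m0 : 0 < m by lra.
have : 0 < (a - m) * (1 - (a * m)^-1).
  rewrite mulr_gt0 ?subr_gt0 // invf_lt1 ?mulr_gt0 //.
  by apply: lt_le_trans (ler_peMr _ m1); lra.
rewrite (_ : _ * _ = a + a^-1 - (m + m^-1)); first lra.
by field; rewrite !gt_eqF.
Qed.

(** Ptolemy's inequality with t = r: its right-hand side becomes the addition formula for cosh. *)
Lemma hdist_triangle r p q : hdist p q <= hdist p r + hdist r q.
Proof.
have := hptolemy p q r r; rewrite hcxx => h.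
have e1 := hexp_gt0 p r; have e2 := hexp_gt0 q r.
have : hexp p q <= hexp p r * hexp q r.
  apply: addV_le; rewrite ?hexp_ge1 ?mulr_ege1 ?hexp_ge1 //.
  move: h; rewrite /hc /hs invfM.
  by move: (hexp p q) (hexp p r) (hexp q r) => a b c; lra.
rewrite /hexp -expRD ler_expR (hdistC q r).
move: (hdist p q) (hdist p r) (hdist r q) {h e1 e2} => a b c; lra.
Qed.

(** Adding two instances of Ptolemy's inequality turns the right-hand side into two addition
    formulas for cosh. The inverse terms there are at most 1 each, and the mixed terms on the left,
    a number plus its inverse, are at least 2, so both drop out. *)
Lemma hexp_four p q r t :
  hexp p q * hexp r t <= hexp p r * hexp q t + hexp p t * hexp q r.
Proof.
have := hptolemy p q r t; have := hptolemy p q t r.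
rewrite (hc_sym t r) /hc /hs.
have e1 := hexp_ge1 p q; have e2 := hexp_ge1 r t.
have f1 := hexp_ge1 p r; have f2 := hexp_ge1 q t.
have g1 := hexp_ge1 p t; have g2 := hexp_ge1 q r.
move: (hexp p q) (hexp r t) (hexp p r) (hexp q t) (hexp p t) (hexp q r)
  e1 e2 f1 f2 g1 g2 => a b c d e f e1 e2 f1 f2 g1 g2.
have inv1 (x y : R) : 1 <= x -> 1 <= y -> x^-1 * y^-1 <= 1.
  move=> x1 y1; rewrite -invfM invf_le1; first by rewrite mulr_ege1.
  by rewrite mulr_gt0 // (lt_le_trans ltr01).
have cd := inv1 _ _ f1 f2; have ef := inv1 _ _ g1 g2.
have ab0 : 0 <= a^-1 * b^-1 by rewrite mulr_ge0 // invr_ge0 (le_trans ler01).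
have ab : 2 <= a * b^-1 + a^-1 * b.
  have a0 : 0 < a by lra.
  have b0 : 0 < b by lra.
  rewrite -subr_ge0 (_ : _ - 2 = (a - b) ^+ 2 * (a^-1 * b^-1)).
    by rewrite mulr_ge0 // sqr_ge0.
  by field; rewrite !gt_eqF.
lra.
Qed.

(** A sum of two exponentials is at most twice the larger one; the factor 2 appears as an additive 2
    ln 2 because [hexp] uses half distances. *)
Definition kappa : R := 2 * ln 2.

Lemma kappa_le : kappa <= 3 / 2.
Proof.
rewrite /kappa.
suff : ln 2 <= 3 / 4 :> R by move: (ln 2 : R) => x; lra.
rewrite -[X in _ <= X]expRK ler_ln ?posrE ?expR_gt0 //.
have h := expR_ge1Dx (1 / 16 : R).
have -> : 3 / 4 = 12%:R * (1 / 16) :> R by field.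
rewrite expRM_natl.
have : (1 + 1 / 16) ^+ 12 <= expR (1 / 16) ^+ 12 :> R.
  by rewrite ler_pXn2r ?nnegrE ?expR_ge0 //; lra.
apply: le_trans; lra.
Qed.

Lemma four_point p q r t :
  hdist p q + hdist r t <=
  Num.max (hdist p r + hdist q t) (hdist p t + hdist q r) + kappa.
Proof.
have := hexp_four p q r t; rewrite /hexp -!expRD -!mulrDl.
set A := hdist p q + _; set B := hdist p r + _; set C := hdist p t + _ => h.
suff : expR (A / 2) <= expR ((Num.max B C + kappa) / 2).
  by rewrite ler_expR ler_pM2r // invr_gt0.
have -> : expR ((Num.max B C + kappa) / 2) = expR (Num.max B C / 2) * 2.
  by rewrite mulrDl expRD mulrAC mulfV ?pnatr_eq0 // mul1r lnK ?posrE.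
apply: le_trans h _; rewrite mulr_natr mulr2n.
by apply: lerD; rewrite ler_expR ler_pM2r ?invr_gt0 // le_max lexx ?orbT.
Qed.

Lemma hdist_half p q m : 2 * hcosh p m = hc p q -> hdist p m = hdist p q / 2.
Proof.
rewrite -hdist_coshE /hc expRN => h.
have e1 : expR (hdist p m) = hexp p q.
  have l1 : 1 <= expR (hdist p m) by rewrite -[1]expR0 ler_expR hdist_ge0.
  have l2 := hexp_ge1 p q.
  apply/eqP; rewrite eq_le; apply/andP; split; apply: addV_le => //.
    by rewrite h.
  by rewrite -h.
by apply/(@expR_inj R); rewrite e1.
Qed.

(* The midpoint is the normalized sum of the Minkowski vectors of p and q. *)
Lemma midpoint_exists p q :
  exists m, hdist p m = hdist p q / 2 /\ hdist q m = hdist p q / 2.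
Proof.
have hp := him_gt0 p; have hq := him_gt0 q.
have h0 : 0 < hc p q by rewrite addr_gt0 ?invr_gt0 ?hexp_gt0.
have y0 : 0 < hc p q * (him p * him q) / (him p + him q).
  by rewrite divr_gt0 ?addr_gt0 // !mulr_gt0.
pose m := HPlane ((hre p * him q + hre q * him p) / (him p + him q)) y0.
exists m; have hpq := hc2E p q.
have key (x y x' y' h : R) : 0 < x' -> 0 < y' -> 0 < h ->
  h ^+ 2 * (x' * y') = (x - y) ^+ 2 + (x' + y') ^+ 2 ->
  2 * (1 + ((x - (x * y' + y * x') / (x' + y')) ^+ 2 +
      (x' - h * (x' * y') / (x' + y')) ^+ 2) /
      (2 * x' * (h * (x' * y') / (x' + y')))) = h.
  move=> x0 y'0 hh0 e.
  have s0 : x' + y' != 0 by rewrite gt_eqF // addr_gt0.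
  apply: (mulIf (x := x' ^+ 2 * y' * h * (x' + y'))).
    by rewrite !mulf_neq0 ?expf_neq0 // gt_eqF.
  have -> : h * (x' ^+ 2 * y' * h * (x' + y')) =
            x' * (x' + y') * (h ^+ 2 * (x' * y')) by ring.
  rewrite [LHS](_ : _ = 
    x' ^+ 2 * ((x - y) ^+ 2 + (x' + y') ^+ 2 + (h * y') ^+ 2)); last first.
    by field; rewrite !gt_eqF // ?addr_gt0.
  have -> : (h * y') ^+ 2 = h ^+ 2 * (x' * y') * y' / x'.
    by field; rewrite gt_eqF.
  by rewrite -e; field; rewrite gt_eqF.
have e1 : 2 * hcosh p m = hc p q by rewrite /hcosh /=; exact: key.
split; first exact: hdist_half e1.
rewrite (hdistC p q); apply: hdist_half; rewrite hc_sym.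
have hqp : hc p q ^+ 2 * (him q * him p) = (hre q - hre p) ^+ 2 + (him q + him p) ^+ 2.
  by rewrite (mulrC (him q)) hpq -opprB sqrrN (addrC (him p)).
have := key _ _ _ _ _ hq hp h0 hqp; rewrite /hcosh /=.
by rewrite (addrC (him q)) (addrC (hre q * _)) (mulrC (him q) (him p)).
Qed.

End HyperbolicMetric.

(** * Division with remainder *)

Section GroupRingCoefficients.
Variable G : groupType.
Implicit Types (x y : group_ring G) (g h : G).

Lemma gr_coeff_neq0 x g : (gr_coeff x g != 0) = (g \in gr_supp x).
Proof. exact: monalg.mcoeff_neq0. Qed.

Lemma gr_coeff0 g : gr_coeff (0 : group_ring G) g = 0.
Proof. exact: monalg.mcoeff0. Qed.

Lemma gr_coeff_monoE g (c : rat) h : gr_coeff (gr_mono g c) h = if h == g then c else 0.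
Proof.
case: eqVneq => [->|ne]; first exact: gr_coeff_mono.
apply: gr_coeff_out; apply: contraNN ne => /(fsubsetP (gr_supp_mono g c)).
by rewrite in_fset1.
Qed.

Lemma gr_coeff_sum (I : Type) (r : seq I) (F : I -> group_ring G) g :
  gr_coeff (\sum_(i <- r) F i) g = \sum_(i <- r) gr_coeff (F i) g.
Proof.
elim: r => [|i r IH]; first by rewrite !big_nil gr_coeff0.
by rewrite !big_cons gr_coeffD IH.
Qed.

Lemma gr_eqP x y : (forall g, gr_coeff x g = gr_coeff y g) -> x = y.
Proof. by move=> h; apply/monalg.malgP => g; exact: h. Qed.

Lemma gr_coeff_mono_mul g (c : rat) y w :
  gr_coeff (gr_mono g c * y) w = c * gr_coeff y (g^-1 * w)%g.
Proof.
rewrite {1}(gr_monoE y) mulr_sumr gr_coeff_sum.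
under eq_bigr => h _ do rewrite [_ * _]gr_mul_mono gr_coeff_monoE.
have [hin|hout] := boolP ((g^-1 * w)%g \in gr_supp y).
  rewrite (bigD1_seq _ hin) ?fset_uniq //= mulVKg eqxx big1 ?addr0 // => h ne.
  case: eqVneq => // e; case/eqP: ne; by rewrite e mulKg.
rewrite (gr_coeff_out hout) mulr0 big1_seq // => h /= hin.
case: eqVneq => // e; move: hout; by rewrite e mulKg hin.
Qed.

Lemma gr_coeff_mul x y w :
  gr_coeff (x * y) w =
  \sum_(g <- gr_supp x) gr_coeff x g * gr_coeff y (g^-1 * w)%g.
Proof.
rewrite {1}(gr_monoE x) mulr_suml gr_coeff_sum.
by apply: eq_bigr => g _; rewrite gr_coeff_mono_mul.
Qed.

Lemma gr_suppP x : x <> 0 -> exists g, g \in gr_supp x.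
Proof.
move=> x0; apply: contrapT => /forallNP h; apply: x0; apply: gr_eqP => g.
by rewrite gr_coeff0; apply: gr_coeff_out; apply/negP; exact: h.
Qed.

End GroupRingCoefficients.

Lemma seq_argmax (T : eqType) (R : realType) (f : T -> R) (s : seq T) :
  s != [::] -> exists2 w, w \in s & forall w', w' \in s -> f w' <= f w.
Proof.
elim: s => // a [|b s] IH _.
  by exists a; rewrite ?mem_head // => w; rewrite inE => /eqP ->.
have [//|w ws hw] := IH _.
have [le|lt] := leP (f w) (f a).
  exists a; rewrite ?mem_head // => w'; rewrite inE => /predU1P [->//|/hw].
  by move=> h; exact: le_trans h le.
exists w; first by rewrite inE ws orbT.
by move=> w'; rewrite inE => /predU1P [->|/hw //]; exact: ltW.
Qed.

Lemma le_bigmax0_seq (T : eqType) (R : realType) (f : T -> R) (s : seq T) w :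
  w \in s -> f w <= \big[Num.max/0]_(i <- s) f i.
Proof.
elim: s => // a s IH; rewrite inE big_cons le_max.
by case/predU1P => [->|/IH ->]; rewrite ?lexx ?orbT.
Qed.

Lemma bigmax0_le (T : eqType) (R : realType) (f : T -> R) (s : seq T) (B : R) :
  0 <= B -> (forall w, w \in s -> f w <= B) ->
  \big[Num.max/0]_(i <- s) f i <= B.
Proof.
move=> B0; elim: s => [|a s IH] h; first by rewrite big_nil.
rewrite big_cons ge_max h ?mem_head //=; apply: IH => w ws.
by apply: h; rewrite inE ws orbT.
Qed.

Section Division.
Variables (R : realType) (G : groupType) (act : G -> hplane R -> hplane R).
Hypothesis act1 : forall p, act 1%g p = p.
Hypothesis actM : forall g h p, act (g * h)%g p = act g (act h p).
Hypothesis actI : forall g p q, hdist (act g p) (act g q) = hdist p q.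
Hypothesis act_disp : forall g p, g != 1%g -> 30 <= hdist p (act g p).
Variable p0 : hplane R.
Implicit Types (x y a b : group_ring G) (g h w : G).

Local Notation K := (kappa R).
Local Notation D := (diameter act p0).
Local Notation P w := (act w p0).

Lemma le_diameter x g h : g \in gr_supp x -> h \in gr_supp x ->
  hdist (P g) (P h) <= D x.
Proof.
move=> gx hx.
have := le_bigmax0_seq (fun h => hdist (P g) (P h)) hx => /le_trans; apply.
exact: (le_bigmax0_seq (fun g => \big[Num.max/0]_(h <- gr_supp x) hdist (P g) (P h))).
Qed.

Lemma diameter_le x (B : R) : 0 <= B ->
  (forall g h, g \in gr_supp x -> h \in gr_supp x -> hdist (P g) (P h) <= B) ->
  D x <= B.
Proof.
move=> B0 h; apply: bigmax0_le => // g gx; apply: bigmax0_le => // k kx.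
exact: h.
Qed.

Lemma diameter_ge0 x : 0 <= D x.
Proof.
rewrite /diameter; elim/big_ind: _ => // [u v u0 _|g _]; first by rewrite le_max u0.
by elim/big_ind: _ => // [u v u0 _|h _]; rewrite ?le_max ?u0 // hdist_ge0.
Qed.

Lemma diameter_attained x : x <> 0 -> exists g h,
  [/\ g \in gr_supp x, h \in gr_supp x & hdist (P g) (P h) = D x].
Proof.
move=> /gr_suppP[g0 g0x].
pose s := [seq (g, h) | g <- gr_supp x, h <- gr_supp x].
have s0 : s != [::].
  have : (g0, g0) \in s by apply/allpairsP; exists (g0, g0).
  by case: s.
have [[g h]] := seq_argmax (fun u => hdist (P u.1) (P u.2)) s0.
case/allpairsP => -[g' h'] /= [gx hx [-> ->]] mx; exists g', h'; split=> //.
apply/eqP; rewrite eq_le le_diameter //= diameter_le ?hdist_ge0 // => k l kx lx.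
by apply: (mx (k, l)); apply/allpairsP; exists (k, l).
Qed.

Lemma four U p q r t : hdist p r + hdist q t <= U -> hdist p t + hdist q r <= U ->
  hdist p q + hdist r t <= U + K.
Proof.
move=> h1 h2; apply: le_trans (four_point p q r t) _.
by rewrite lerD2r ge_max h1 h2.
Qed.

(* The midpoint of a diametral pair is a coarse circumcenter of the support. *)
Lemma center_exists x : x <> 0 -> exists c : hplane R,
  (forall g, g \in gr_supp x -> hdist c (P g) <= D x / 2 + K) /\
  (forall o, exists2 g, g \in gr_supp x &
     hdist o c + D x / 2 - K <= hdist o (P g)).
Proof.
move=> /diameter_attained[g [h [gx hx e]]].
have [m []] := midpoint_exists (P g) (P h); rewrite e => m1 m2.
exists m; split=> [k kx|o].
  have := @four (D x + D x / 2) m (P k) (P g) (P h).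
  rewrite (hdistC m (P g)) (hdistC m (P h)) m1 m2 e.
  have := le_diameter kx gx; have := le_diameter kx hx.
  move: (hdist m _) (hdist (P k) (P h)) (hdist (P k) (P g)) (D x) K.
  by move=> u v w d k' h1 h2 h3; lra.
have [le|/ltW le] := leP (hdist o (P g)) (hdist o (P h)); [exists h|exists g] => //.
  have := @four (hdist o (P h) + D x / 2) o m (P g) (P h).
  rewrite (hdistC m (P g)) (hdistC m (P h)) m1 m2 e.
  move: (hdist o _) (hdist o (P h)) (hdist o (P g)) (D x) K le.
  by move=> u v w d k' h1 h2; lra.
have := @four (hdist o (P g) + D x / 2) o m (P g) (P h).
rewrite (hdistC m (P g)) (hdistC m (P h)) m1 m2 e.
move: (hdist o _) (hdist o (P h)) (hdist o (P g)) (D x) K le.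
by move=> u v w d k' h1 h2; lra.
Qed.

(** By [act_disp] the translates of any point are 30 apart, so an approximate centre identifies its
    translate. *)
Lemma translate_inj g h c : hdist (act g c) (act h c) < 30 -> g = h.
Proof.
move=> lt; apply/eqP; rewrite eq_sym; apply: contraLR lt => ne; rewrite -leNgt.
have -> : hdist (act g c) (act h c) = hdist c (act (g^-1 * h)%g c).
  by rewrite -(actI g^-1%g) -!actM mulVg act1.
apply: act_disp; apply: contraNneq ne => e.
by rewrite -[h](mulVKg g) e mulg1.
Qed.

Lemma hdist_actV g p q : hdist (act g^-1%g p) q = hdist p (act g q).
Proof. by rewrite -(actI g) -actM mulgV act1. Qed.

(* [covers a x g w]: the translate by [g] of the support of [x], with [g] in the
   support of [a], contains [w]. *)
Definition covers a x g w := (g \in gr_supp a) && ((g^-1 * w)%g \in gr_supp x).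

Lemma coeff_single a x g w : covers a x g w ->
  (forall g', covers a x g' w -> g' = g) ->
  gr_coeff (a * x) w = gr_coeff a g * gr_coeff x (g^-1 * w)%g.
Proof.
case/andP => ga gx un; rewrite gr_coeff_mul (bigD1_seq _ ga) ?fset_uniq //=.
rewrite big1_seq ?addr0 // => g' /andP[ne g'a].
rewrite [X in _ * X]gr_coeff_out ?mulr0 //; apply: contraNN ne => g'x.
by rewrite (un g') // /covers g'a.
Qed.

Lemma coeff_none a x w : (forall g, ~ covers a x g w) -> gr_coeff (a * x) w = 0.
Proof.
move=> no; rewrite gr_coeff_mul big1_seq // => g /= ga.
rewrite [X in _ * X]gr_coeff_out ?mulr0 //; apply/negP => gx.
by apply: (no g); rewrite /covers ga.
Qed.

Section Reduction.
Variables (a b x y : group_ring G) (cx cy : hplane R).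
Hypothesis rel : a * x + b * y = 0.
Hypothesis Dyx : D y <= D x.
Hypothesis nearx : forall g, g \in gr_supp x -> hdist cx (P g) <= D x / 2 + K.
Hypothesis neary : forall g, g \in gr_supp y -> hdist cy (P g) <= D y / 2 + K.
Hypothesis farx : forall o, exists2 g, g \in gr_supp x &
  hdist o cx + D x / 2 - K <= hdist o (P g).
Hypothesis fary : forall o, exists2 g, g \in gr_supp y &
  hdist o cy + D y / 2 - K <= hdist o (P g).
Variable z : G.
Local Notation f w := (hdist p0 (P w)).
Hypothesis zmaxx : forall g w, covers a x g w -> f w <= f z.
Hypothesis zmaxy : forall g w, covers b y g w -> f w <= f z.

(** In [reduction] the diameter drops by t - 6 K, that is by 1, while [good_covers] needs 6 K + 2 t
    < 30. *)
Let t := 6 * K + 1.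
Let shell w := f z - t <= f w.

Let K0 : 0 <= K. Proof. by rewrite mulr_ge0 // ln_ge0 // ler1n. Qed.
Let K1 : K <= 3 / 2. Proof. exact: kappa_le. Qed.

(** Seen from the base point, some point of the translate lies almost D/2 beyond the centre, yet its
    height is at most M. *)
Lemma center_height u v c g B (M : R) : (forall o, exists2 g, g \in gr_supp v &
     hdist o c + D v / 2 - K <= hdist o (P g)) ->
  g \in gr_supp u -> (forall w, covers u v g w -> f w <= M) -> B = M - D v / 2 + K ->
  hdist p0 (act g c) <= B.
Proof.
move=> far gu mx ->; have [h hv] := far (act g^-1%g p0).
rewrite !hdist_actV -actM => le.
have := mx (g * h)%g; rewrite /covers gu mulKg hv => /(_ isT).
by move: le; move: (hdist _ _) (hdist _ _) (D v) => u1 u2 d; lra.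
Qed.

Lemma center_near v c g w (B : R) : (forall g, g \in gr_supp v -> hdist c (P g) <= B) ->
  (g^-1 * w)%g \in gr_supp v -> hdist (act g c) (P w) <= B.
Proof. by move=> nr /nr; rewrite actM -{1}(actI g) -[act g (act _ _)]actM mulgV act1. Qed.

Lemma heightx g : g \in gr_supp a -> hdist p0 (act g cx) <= f z - D x / 2 + K.
Proof. by move=> ga; apply: (center_height farx ga) => // w; exact: zmaxx. Qed.

Lemma heighty g : g \in gr_supp b -> hdist p0 (act g cy) <= f z - D y / 2 + K.
Proof. by move=> gb; apply: (center_height fary gb) => // w; exact: zmaxy. Qed.

(** Four-point inequality for the base point, w and the two centres: both centres are about D/2 from
    w and about D/2 lower, so they are within 3 K + t of each other. *)
Lemma covers_inj u v c g h w : (forall g, g \in gr_supp v -> hdist c (P g) <= D v / 2 + K) ->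
  (forall g, g \in gr_supp u -> hdist p0 (act g c) <= f z - D v / 2 + K) ->
  shell w -> covers u v g w -> covers u v h w -> g = h.
Proof.
move=> nr ht sw /andP[gu gw] /andP[hu hw]; apply: (@translate_inj _ _ c).
have := center_near nr gw; have := center_near nr hw.
have := ht _ gu; have := ht _ hu; move: sw; rewrite /shell /t.
have := @four (f z + 2 * K) p0 (P w) (act g c) (act h c).
rewrite !(hdistC (P w)).
move: (f w) (f z) (D v) K K0 K1 (hdist p0 (act g c)) (hdist p0 (act h c)).
move: (hdist (act g c) (P w)) (hdist (act h c) (P w)) (hdist (act g c) (act h c)).
move=> a1 a2 a3 a4 a5 a6 k k0 k1 a7 a8 fr s1 s2 s3 s4 s5.
by have := fr ltac:(lra) ltac:(lra); lra.
Qed.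

Lemma coversx_inj g h w : shell w -> covers a x g w -> covers a x h w -> g = h.
Proof. exact: covers_inj nearx heightx. Qed.

Lemma coversy_inj g h w : shell w -> covers b y g w -> covers b y h w -> g = h.
Proof. exact: covers_inj neary heighty. Qed.

Lemma coeff_rel w : gr_coeff (a * x) w + gr_coeff (b * y) w = 0.
Proof. by rewrite -gr_coeffD rel gr_coeff0. Qed.

(** On the shell each of the two products has at most one nonzero contribution, so a contribution of
    x must be cancelled by a single one of y. *)
Lemma coversx_y g w : shell w -> covers a x g w -> exists2 h, covers b y h w &
  gr_coeff a g * gr_coeff x (g^-1 * w)%g + gr_coeff b h * gr_coeff y (h^-1 * w)%g = 0.
Proof.
move=> sw cg; have := coeff_rel w.
rewrite (coeff_single cg) => [e|g' c']; last exact: coversx_inj c' cg.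
have [[h ch]|no] := pselect (exists h, covers b y h w).
  exists h => //; rewrite -e (coeff_single ch) // => h' c'.
  exact: coversy_inj c' ch.
move: e; rewrite (coeff_none (x := y)); last by move=> h c; apply: no; exists h.
move/eqP; rewrite addr0 mulf_eq0; case/andP: cg.
by rewrite -!gr_coeff_neq0 => /negbTE -> /negbTE ->.
Qed.

Lemma coversy_x h w : shell w -> covers b y h w -> exists g, covers a x g w.
Proof.
move=> sw ch; have := coeff_rel w; apply: contraPP => no.
rewrite (coeff_none (x := x)); last by move=> g c; apply: no; exists g.
rewrite (coeff_single ch) => [/eqP|h' c']; last exact: coversy_inj c' ch.
rewrite add0r mulf_eq0; case/andP: ch.
by rewrite -!gr_coeff_neq0 => /negbTE -> /negbTE ->.
Qed.

Variable g : G.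
Hypothesis zg : covers a x g z.

(** The translates of y that meet the translate g of x inside the shell; these are the ones used to
    reduce x. *)
Let good h := exists w, [/\ shell w, covers a x g w & covers b y h w].

Let shell_z : shell z.
Proof. by rewrite /shell /t; move: K K0 (f z) => k k0 u; lra. Qed.

Lemma good_center_dist w h : shell w -> covers a x g w -> covers b y h w ->
  hdist (act g cx) (act h cy) <= (D x - D y) / 2 + 3 * K + t.
Proof.
move=> sw /andP[ga gw] /andP[hb hw].
have := center_near nearx gw; have := center_near neary hw.
have := heightx ga; have := heighty hb; move: sw; rewrite /shell.
have := @four (f z + (D x - D y) / 2 + 2 * K) p0 (P w) (act g cx) (act h cy).
rewrite !(hdistC (P w)).
move: (f w) (f z) (D x) (D y) Dyx K K0 K1 t
  (hdist p0 (act g cx)) (hdist p0 (act h cy)).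
move: (hdist (act g cx) (P w)) (hdist (act h cy) (P w)) (hdist (act g cx) (act h cy)).
move=> a1 a2 a3 a4 a5 d1 d2 dd k k0 k1 t' a7 a8 fr s1 s2 s3 s4 s5.
by have := fr ltac:(lra) ltac:(lra); lra.
Qed.

(** By cancellation some translate g' of x covers w. Its centre and that of g are both close to the
    centre of h, which is not much lower than they may be; the four-point inequality puts them
    within 6 K + 2 t < 30. *)
Lemma good_covers h w : good h -> shell w -> covers b y h w -> covers a x g w.
Proof.
case=> v [sv gv hv] sw hw; have [g' g'w] := coversy_x sw hw.
suff <- : g' = g by [].
apply: (@translate_inj _ _ cx).
have := good_center_dist sv gv hv.
have : hdist (act g' cx) (act h cy) <= (D x - D y) / 2 + 3 * K + t.
  move: g'w hw => /andP[ga gw] /andP[hb hw'].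
  have := center_near nearx gw; have := center_near neary hw'.
  have := heightx ga; have := heighty hb; move: sw; rewrite /shell.
  have := @four (f z + (D x - D y) / 2 + 2 * K) p0 (P w) (act g' cx) (act h cy).
  rewrite !(hdistC (P w)).
  move: (f w) (f z) (D x) (D y) Dyx K K0 K1 t
    (hdist p0 (act g' cx)) (hdist p0 (act h cy)).
  move: (hdist (act g' cx) (P w)) (hdist (act h cy) (P w)) (hdist (act g' cx) (act h cy)).
  move=> a1 a2 a3 a4 a5 d1 d2 dd k k0 k1 t' a7 a8 fr s1 s2 s3 s4 s5.
  by have := fr ltac:(lra) ltac:(lra); lra.
case/andP: hw => _ hw; have := center_near neary hw.
case/andP: g'w => g'a _; have := heightx g'a.
case/andP: zg => ga _; have := heightx ga.
have := hdist_triangle (act h cy) p0 (P w); move: sw; rewrite /shell /t.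
have := @four (f z - D x / 2 + K + (D x - D y) / 2 + 3 * K + t)
  p0 (act h cy) (act g' cx) (act g cx).
rewrite !(hdistC (act h cy) (act _ cx)) /t.
move: (f w) (f z) (D x) (D y) Dyx K K0 K1.
move: (hdist p0 (act g' cx)) (hdist p0 (act h cy)) (hdist p0 (act g cx)).
move: (hdist (act g' cx) (act h cy)) (hdist (act g cx) (act h cy)).
move: (hdist (act h cy) (P w)) (hdist (act g' cx) (act g cx)).
move=> e1 e2 e3 e4 e5 e6 e7 a4 a5 d1 d2 dd k k0 k1 fr s1 s2 s3 s4 s5 s6 s7.
by have := fr ltac:(lra) ltac:(lra); lra.
Qed.

(** Using the highest point v of the translate of y sharpens the height of its centre; this is how t
    disappears from the bound of [good_center_dist]. *)
Lemma top_center_dist h v : covers a x g v -> covers b y h v ->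
  (forall w, covers b y h w -> f w <= f v) ->
  hdist (act g cx) (act h cy) <=
    Num.max (f z - f v - (D x - D y) / 2) ((D x - D y) / 2) + 3 * K.
Proof.
move=> /andP[ga gw] /andP[hb hw] top.
have := center_near nearx gw; have := center_near neary hw.
have := heightx ga; have := center_height fary hb top erefl.
set m := Num.max _ _.
have := @four (f v + m + 2 * K) p0 (P v) (act g cx) (act h cy).
have m1 : f z - f v - (D x - D y) / 2 <= m by rewrite le_max lexx.
have m2 : (D x - D y) / 2 <= m by rewrite le_max lexx orbT.
rewrite !(hdistC (P v)); move: m m1 m2.
move: (f v) (f z) (D x) (D y) K K0 (hdist p0 (act g cx)) (hdist p0 (act h cy)).
move: (hdist (act g cx) (P v)) (hdist (act h cy) (P v)) (hdist (act g cx) (act h cy)).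
move=> a1 a2 a3 a4 a5 d1 d2 k k0 a7 a8 m m1 m2 fr s1 s2 s3 s4.
by have := fr ltac:(lra) ltac:(lra); lra.
Qed.

Lemma good_top h : good h -> exists v, [/\ shell v, covers a x g v, covers b y h v
  & forall w, covers b y h w -> f w <= f v].
Proof.
move=> gh; have [w [sw gw hw]] := gh; case/andP: (hw) => hb hy.
pose s := [seq (h * k)%g | k <- gr_supp y].
have ws : w \in s by apply/mapP; exists (h^-1 * w)%g; rewrite ?mulVKg.
have [|v vs hv] := seq_argmax (fun w => f w) (s := s); first by case: s ws.
have cv : covers b y h v.
  by rewrite /covers hb; case/mapP: vs => k ky ->; rewrite mulKg.
have sv : shell v by apply: le_trans sw _; exact: hv.
exists v; split=> //; first exact: good_covers gh sv cv.
move=> w' /andP[_ h']; apply: hv; apply/mapP; exists (h^-1 * w')%g => //.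
by rewrite mulVKg.
Qed.

Lemma good_center_dist_top h : good h ->
  hdist (act g cx) (act h cy) <= (D x - D y) / 2 + 3 * K.
Proof.
move=> gh; have [v [sv gv hv top]] := good_top gh.
have := top_center_dist gv hv top.
have [le|lt] := leP t (D x - D y).
  rewrite (max_idPr _) //; move: sv le; rewrite /shell.
  by move: (f v) (f z) (D x) (D y) t => a1 a2 a3 a4 a5; lra.
(* For nearly equal diameters h must be the translate h' through z: both centres are within t + 3 K
   of the centre of g. *)
have [h' h'z _] := coversx_y shell_z zg.
have topz w : covers b y h' w -> f w <= f z by exact: zmaxy.
have top2 := top_center_dist zg h'z topz; rewrite subrr in top2.
suff -> : h = h'.
  move=> _; apply: le_trans top2 _; rewrite lerD2r ge_max lexx andbT.
  by move: Dyx; move: (D x) (D y) => u1 u2; lra.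
have top1 := top_center_dist gv hv top.
apply: (@translate_inj _ _ cy); move: top2 top1.
have := hdist_triangle (act g cx) (act h cy) (act h' cy).
rewrite (hdistC _ (act g cx)).
set m1 := Num.max _ _; set m2 := Num.max _ _.
have : m1 <= t.
  rewrite ge_max; move: Dyx lt; rewrite /t.
  by move: (D x) (D y) K K0 => u1 u2 k k0 l1 l2; apply/andP; split; lra.
have : m2 <= t.
  rewrite ge_max; move: Dyx lt sv; rewrite /shell /t.
  move: (f z) (f v) (D x) (D y) K K0 => u3 u4 u1 u2 k k0 l1 l2 l3.
  by apply/andP; split; lra.
rewrite /t; move: m1 m2 K K0 K1.
move: (hdist (act h cy) (act h' cy)) (hdist (act g cx) (act h cy)).
move: (hdist (act g cx) (act h' cy)) => *; lra.
Qed.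

Let T := [seq h <- gr_supp b | `[< good h >]].

Lemma reduction : exists q : group_ring G,
  x + q * y = 0 \/ D (x + q * y) <= D x - 1.
Proof.
have [ga gz] := andP zg.
have ag0 : gr_coeff a g != 0 by rewrite gr_coeff_neq0.
(* The coefficients cancel the shell points of the translate g of x; the factor g^-1 moves this
   translate back to x. *)
pose q := \sum_(h <- T) gr_mono (g^-1 * h)%g (gr_coeff b h / gr_coeff a g).
have qE k : gr_coeff (x + q * y) k = gr_coeff x k +
    \sum_(h <- T) gr_coeff b h / gr_coeff a g * gr_coeff y (h^-1 * (g * k))%g.
  rewrite gr_coeffD /q mulr_suml gr_coeff_sum; congr (_ + _).
  by apply: eq_bigr => h _; rewrite gr_coeff_mono_mul invgM invgK mulgA.
have TP h : h \in T -> h \in gr_supp b /\ good h.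
  by rewrite mem_filter => /andP[/asboolP].
have cov k : k \in gr_supp (x + q * y) ->
    covers a x g (g * k)%g \/ exists2 h, h \in T & covers b y h (g * k)%g.
  rewrite -gr_coeff_neq0 qE => nz.
  have [kx|kx] := boolP (k \in gr_supp x); first by left; rewrite /covers ga mulKg.
  right; apply: contrapT => no; move: nz.
  rewrite (gr_coeff_out kx) add0r big1_seq ?eqxx // => h /= hT.
  rewrite [X in _ * X]gr_coeff_out ?mulr0 //; apply/negP => hy; apply: no.
  by exists h => //; rewrite /covers hy andbT; case: (TP _ hT).
have low k : k \in gr_supp (x + q * y) -> ~ shell (g * k)%g.
  move=> kx sk; have cg : covers a x g (g * k)%g.
    case: (cov k kx) => // -[h hT ch]; have [_ gh] := TP _ hT.
    exact: good_covers gh sk ch.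
  have [h ch e] := coversx_y sk cg.
  have hT : h \in T.
    rewrite mem_filter (andP ch).1 andbT; apply/asboolP.
    by exists (g * k)%g.
  move: kx; rewrite -gr_coeff_neq0 qE (bigD1_seq _ hT) ?filter_uniq ?fset_uniq //=.
  rewrite big1_seq => [|h' /andP[ne h'T]]; last first.
    rewrite [X in _ * X]gr_coeff_out ?mulr0 //; apply: contraNN ne => h'y.
    apply/eqP/(coversy_inj sk _ ch); rewrite /covers h'y andbT.
    by case: (TP _ h'T).
  rewrite addr0 -(inj_eq (mulfI ag0)) mulr0 mulrDr mulrA (mulrC _ (_ / _)) divfK //.
  by move: e; rewrite mulKg => ->; rewrite eqxx.
have nearc k : k \in gr_supp (x + q * y) ->
    hdist (act g cx) (P (g * k)%g) <= D x / 2 + 4 * K.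
  case/cov => [/andP[_ h]|[h hT /andP[_ hy]]].
    by have := center_near nearx h; move: (hdist _ _) (D x) K K0 => *; lra.
  have [_ gh] := TP _ hT; have := good_center_dist_top gh.
  have := center_near neary hy.
  have := hdist_triangle (act h cy) (act g cx) (P (g * k)%g).
  move: (hdist (act h cy) (P _)) (hdist (act g cx) (P _)) => e1 e2.
  by move: (hdist (act g cx) (act h cy)) (D x) (D y) K => *; lra.
(* Both points are below the shell and within D/2 + 4 K of the centre, whose height is at least f z
   - D/2 - K because z is near it; the four-point inequality leaves D - t + 6 K. *)
have bound k l : k \in gr_supp (x + q * y) -> l \in gr_supp (x + q * y) ->
    hdist (P k) (P l) <= D x - 1.
  move=> hk hl; have := nearc _ hk; have := nearc _ hl.
  have := center_near nearx gz.
  have /negP := low _ hk; have /negP := low _ hl; rewrite /shell -!ltNge.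
  have := hdist_triangle (act g cx) p0 (P z).
  rewrite -(actI g (P k)) -!actM.
  have := @four (f z - t + D x / 2 + 4 * K) (P (g * k)%g) (P (g * l)%g) p0 (act g cx).
  rewrite !(hdistC _ p0) !(hdistC _ (act g cx)) (hdistC (act g cx) p0) /t.
  move: (f z) (f (g * k)%g) (f (g * l)%g) (D x) K => f1 f2 f3 d k'.
  move: (hdist (P (g * k)%g) (P (g * l)%g)) (hdist p0 (act g cx)).
  move: (hdist (act g cx) (P z)) (hdist (act g cx) (P (g * k)%g)).
  move: (hdist (act g cx) (P (g * l)%g)).
  move=> e1 e2 e3 e4 e5 fr s1 s2 s3 s4 s5 s6.
  by have := fr ltac:(lra) ltac:(lra); lra.
exists q; have [->|/eqP nz] := eqVneq (x + q * y) 0; [by left|right].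
have [k hk] := gr_suppP nz.
apply: diameter_le => //; have := bound _ _ hk hk.
by rewrite hdistxx.
Qed.

End Reduction.

(** The conclusion [a <> 0] keeps the relation a (x + q y) + (b - a q) y = 0 nontrivial for the
    induction. It holds because a highest point covered by y is also covered by x. *)
Lemma division_step a b x y : y <> 0 -> ~ (a = 0 /\ b = 0) ->
  a * x + b * y = 0 -> x <> 0 -> D y <= D x ->
  a <> 0 /\ exists q, x + q * y = 0 \/ D (x + q * y) <= D x - 1.
Proof.
move=> y0 ab rel x0 Dyx.
have [cx [nearx farx]] := center_exists x0.
have [cy [neary fary]] := center_exists y0.
pose sx := [seq (g * h)%g | g <- gr_supp a, h <- gr_supp x].
pose sy := [seq (g * h)%g | g <- gr_supp b, h <- gr_supp y].
have insx w : w \in sx <-> exists g, covers a x g w.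
  split=> [/allpairsP[[g h] /= [ga hx ->]]|[g /andP[ga gw]]].
    by exists g; rewrite /covers ga mulKg.
  by apply/allpairsP; exists (g, g^-1 * w)%g; rewrite /= mulVKg.
have insy w : w \in sy <-> exists g, covers b y g w.
  split=> [/allpairsP[[g h] /= [ga hx ->]]|[g /andP[ga gw]]].
    by exists g; rewrite /covers ga mulKg.
  by apply/allpairsP; exists (g, g^-1 * w)%g; rewrite /= mulVKg.
have s0 : sx ++ sy != [::].
  have [w] : exists w, w \in sx ++ sy; last by case: (sx ++ sy).
  have [gx gxx] := gr_suppP x0; have [gy gyy] := gr_suppP y0.
  have [a0|/eqP /gr_suppP[g ga]] := eqVneq a 0; last first.
    exists (g * gx)%g; rewrite mem_cat; apply/orP; left; apply/insx.
    by exists g; rewrite /covers ga mulKg.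
  have /gr_suppP[g gb] : b <> 0 by move=> b0; apply: ab.
  exists (g * gy)%g; rewrite mem_cat; apply/orP; right; apply/insy.
  by exists g; rewrite /covers gb mulKg.
have [z zs zmax] := seq_argmax (fun w => hdist p0 (P w)) s0.
have zmaxx g w : covers a x g w -> hdist p0 (P w) <= hdist p0 (P z).
  by move=> c; apply: zmax; rewrite mem_cat; apply/orP; left; apply/insx; exists g.
have zmaxy g w : covers b y g w -> hdist p0 (P w) <= hdist p0 (P z).
  by move=> c; apply: zmax; rewrite mem_cat; apply/orP; right; apply/insy; exists g.
have [g zg] : exists g, covers a x g z.
  move: zs; rewrite mem_cat => /orP[/insx //|/insy[h hz]].
  apply: (coversy_x rel neary fary zmaxy _ hz).
  have : 0 <= K by rewrite mulr_ge0 // ln_ge0 // ler1n.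
  by move: K (hdist _ _) => k u k0; lra.
split; last exact: (reduction rel Dyx nearx neary farx fary zmaxx zmaxy zg).
by case/andP: zg => ga _ a0; move: ga; rewrite -gr_coeff_neq0 a0 gr_coeff0 eqxx.
Qed.

Lemma division a b x y : y <> 0 -> ~ (a = 0 /\ b = 0) -> a * x + b * y = 0 ->
  exists q r : group_ring G, x = q * y + r /\ (D r < D y \/ r = 0).
Proof.
move=> y0.
have [n] : exists n, D x < n%:R by exists (Num.truncn (D x)).+1; exact: truncnS_gt.
elim: n => [|n IH] in a b x *; first by rewrite ltNge diameter_ge0.
move=> Dx ab rel.
have [->|/eqP x0] := eqVneq x 0; first by exists 0, 0; rewrite mul0r addr0; split; [|right].
have [lt|le] := ltP (D x) (D y); first by exists 0, x; rewrite mul0r add0r; split; [|left].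
have [a0 [q [e|le1]]] := division_step y0 ab rel x0 le.
  by exists (- q), 0; rewrite addr0 mulNr; split; [apply/eqP; rewrite -addr_eq0 e|right].
have [||| q' [r [e h]]] := IH a (b - a * q) (x + q * y).
- by move: Dx; rewrite -natr1; move: (D x) (D _) le1 => u v; lra.
- by case.
- by rewrite -[RHS]rel mulrDr mulrBl mulrA -addrA (addrCA (a * q * y)) addrN addr0.
exists (q' - q), r; split=> //.
by rewrite mulrBl addrAC -e addrK.
Qed.

End Division.

(** * Reflections of a right-angled hexagon *)

Section Minkowski.
Variable R : realType.
Implicit Types (u v e : 'rV[R]_3) (p q : hplane R).

Let i0 : 'I_3 := @Ordinal 3 0 isT.
Let i1 : 'I_3 := @Ordinal 3 1 isT.
Let i2 : 'I_3 := @Ordinal 3 2 isT.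

(* The vector (a, b, c) stands for the quadratic form [[a, b], [b, c]]; minus
   its determinant is a form of signature (2, 1). *)
Definition mink u v : R :=
  u 0 i1 * v 0 i1 - (u 0 i0 * v 0 i2 + u 0 i2 * v 0 i0) / 2.

Lemma minkC u v : mink u v = mink v u.
Proof. by rewrite /mink (mulrC (u 0 i1)) (mulrC (u 0 i0)) (mulrC (u 0 i2)) (addrC (_ * u 0 i0)). Qed.

Lemma minkDl u u' v : mink (u + u') v = mink u v + mink u' v.
Proof. by rewrite /mink !mxE; ring. Qed.

Lemma minkZl (k : R) u v : mink (k *: u) v = k * mink u v.
Proof. by rewrite /mink !mxE; ring. Qed.

Lemma minkDr u v v' : mink u (v + v') = mink u v + mink u v'.
Proof. by rewrite !(minkC u) minkDl. Qed.

Lemma minkZr (k : R) u v : mink u (k *: v) = k * mink u v.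
Proof. by rewrite !(minkC u) minkZl. Qed.

Lemma mink0r u : mink u 0 = 0.
Proof. by rewrite -(scale0r 0) minkZr mul0r. Qed.

Lemma mink_sumr u (I : Type) (r : seq I) (F : I -> 'rV[R]_3) :
  mink u (\sum_(i <- r) F i) = \sum_(i <- r) mink u (F i).
Proof.
by apply: (big_morph (mink u)) => [v w|]; [exact: minkDr|exact: mink0r].
Qed.

Definition refl e v := v + (- 2 * mink v e) *: e.

Lemma mink_refl e u v : mink e e = 1 -> mink (refl e u) (refl e v) = mink u v.
Proof.
move=> e1; rewrite /refl !minkDl !minkDr !minkZl !minkZr e1 (minkC e v).
by ring.
Qed.

Lemma reflK e : mink e e = 1 -> involutive (refl e).
Proof.
move=> e1 v; rewrite /refl minkDl minkZl e1 mulr1 -addrA -scalerDl -mulrDr.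
have -> : mink v e + (mink v e + -2 * mink v e) = 0 by ring.
by rewrite mulr0 scale0r addr0.
Qed.

Lemma refl_swap e u v : mink e e = 1 -> mink (refl e u) v = mink u (refl e v).
Proof. by move=> e1; rewrite -{2}(reflK e1 u) mink_refl. Qed.

Lemma refl_id e v : mink v e = 0 -> refl e v = v.
Proof. by rewrite /refl => ->; rewrite mulr0 scale0r addr0. Qed.

Lemma reflC e f v : mink e f = 0 -> refl e (refl f v) = refl f (refl e v).
Proof.
move=> ef; rewrite /refl !minkDl !minkZl ef (minkC f) ef !mulr0 !addr0.
by rewrite addrAC.
Qed.

(** The quadratic form |X + z Y|^2 / y of determinant 1 for z = x + i y: this is the hyperboloid
    model. *)
Definition hvec p : 'rV[R]_3 :=
  \row_(i < 3) [:: (him p)^-1; hre p / him p; (hre p ^+ 2 + him p ^+ 2) / him p]`_i.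

Lemma mink_hvec p q : mink (hvec p) (hvec q) = - hcosh p q.
Proof.
have hp := him_gt0 p; have hq := him_gt0 q.
by rewrite /mink !mxE /= /hcosh; field; rewrite !gt_eqF.
Qed.

(** The default 1 makes [hpoint] total; on the sheet of [hvec] the first entry is positive. *)
Definition hpoint_im u : R := if 0 < u 0 i0 then (u 0 i0)^-1 else 1.

Lemma hpoint_im_gt0 u : 0 < hpoint_im u.
Proof. by rewrite /hpoint_im; case: ifP; rewrite ?invr_gt0. Qed.

Definition hpoint u : hplane R := HPlane (u 0 i1 / u 0 i0) (hpoint_im_gt0 u).

Lemma hpointK u : mink u u = -1 -> 0 < u 0 i0 -> hvec (hpoint u) = u.
Proof.
move=> uu u0; have h := gt_eqF u0.
have im : him (hpoint u) = (u 0 i0)^-1 by rewrite /= /hpoint_im u0.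
apply/rowP => -[[|[|[|//]]] hi]; rewrite !mxE im /= ?invrK.
- by congr (u 0 _); apply: val_inj.
- by rewrite mulfVK ?h //; congr (u 0 _); apply: val_inj.
rewrite [in RHS](_ : Ordinal hi = i2); last exact: val_inj.
apply: (mulfI (negbT h)); move: uu; rewrite /mink => uu.
rewrite [LHS](_ : _ = u 0 i1 ^+ 2 + 1); last by field; rewrite h.
by lra.
Qed.

Lemma hvecK p : hpoint (hvec p) = p.
Proof.
have hp := him_gt0 p.
apply: hplane_eq; rewrite /= /hpoint_im !mxE /= ?invr_gt0 ?hp ?invrK //.
by rewrite divfK ?gt_eqF.
Qed.

Lemma hvec_inj : injective hvec. Proof. exact: can_inj hvecK. Qed.

(** Unit timelike vectors of opposite sheets pair positively. Applied to a reflected point, this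
    shows that reflections preserve the sheet. *)
Lemma hvec_sheet u p : mink u u = -1 -> mink u (hvec p) < 0 -> 0 < u 0 i0.
Proof.
have hp := him_gt0 p.
rewrite /mink !mxE /=; set a := u 0 i0; set b := u 0 i1; set c := u 0 i2.
have : (him p)^-1 * ((hre p ^+ 2 + him p ^+ 2) / him p) = 1 + (hre p / him p) ^+ 2.
  by field; rewrite gt_eqF.
have : 0 < (him p)^-1 by rewrite invr_gt0.
move: (him p)^-1 (hre p / him p) (_ / him p) => a' b' c' a'0 e uu neg.
rewrite ltNge; apply/negP => a0.
have ac : a * c = 1 + b ^+ 2 by lra.
have an : a < 0 by rewrite lt_neqAle a0 andbT; apply/eqP => z; move: ac; rewrite z; nra.
have cn : c < 0 by nra.
have c'0 : 0 < c' by nra.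
have h : (a * c' + c * a') ^+ 2 >= 4 * (a * c) * (a' * c').
  by have := sqr_ge0 (a * c' - c * a'); lra.
rewrite ac e in h.
have s : a * c' + c * a' < 0 by nra.
have : (2 * b * b') ^+ 2 < (a * c' + c * a') ^+ 2 by nra.
have : 2 * b * b' < a * c' + c * a' by lra.
nra.
Qed.

Definition hrefl e p := hpoint (refl e (hvec p)).

Lemma hvec_hrefl e p : mink e e = 1 -> hvec (hrefl e p) = refl e (hvec p).
Proof.
move=> e1; have pp : mink (hvec p) (hvec p) = -1 by rewrite mink_hvec hcoshxx.
have uu : mink (refl e (hvec p)) (refl e (hvec p)) = -1 by rewrite mink_refl.
apply: hpointK => //; apply: (hvec_sheet (p := p) uu).
rewrite /refl minkDl minkZl pp (minkC e).
by have := sqr_ge0 (mink (hvec p) e); lra.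
Qed.

Lemma hreflK e : mink e e = 1 -> involutive (hrefl e).
Proof. by move=> e1 p; apply: hvec_inj; rewrite !hvec_hrefl // reflK. Qed.

Lemma hdist_hrefl e p q : mink e e = 1 -> hdist (hrefl e p) (hrefl e q) = hdist p q.
Proof.
move=> e1; apply: hcosh_inj; apply: oppr_inj; rewrite -!mink_hvec !hvec_hrefl //.
exact: mink_refl.
Qed.

Lemma hreflC e f p : mink e e = 1 -> mink f f = 1 -> mink e f = 0 ->
  hrefl e (hrefl f p) = hrefl f (hrefl e p).
Proof. by move=> e1 f1 ef; apply: hvec_inj; rewrite !hvec_hrefl // reflC. Qed.

Definition hi : hplane R := HPlane 0 ltr01.

Lemma mink_hi u : mink (hvec hi) u = - (u 0 i0 + u 0 i2) / 2.
Proof. by rewrite /mink !mxE /=; field. Qed.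

(* A causal vector pairing positively with one point pairs so with all points. *)
Lemma causal_ge0 n p : mink n n <= 0 -> 0 < mink (hvec hi) n -> 0 <= mink (hvec p) n.
Proof.
have hp := him_gt0 p.
rewrite mink_hi /mink !mxE /=; set A := n 0 i0; set B := n 0 i1; set C := n 0 i2.
have : (him p)^-1 * ((hre p ^+ 2 + him p ^+ 2) / him p) = 1 + (hre p / him p) ^+ 2.
  by field; rewrite gt_eqF.
have : 0 < (him p)^-1 by rewrite invr_gt0.
move: (him p)^-1 (hre p / him p) (_ / him p) => a b c a0 e nn neg.
have BAC : B ^+ 2 <= A * C by lra.
have A0 : A <= 0 by nra.
have C0 : C <= 0 by nra.
have c0 : 0 < c by nra.
have h : (a * C + c * A) ^+ 2 >= 4 * (a * c) * (A * C).
  by have := sqr_ge0 (a * C - c * A); lra.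
have s : a * C + c * A <= 0 by nra.
rewrite leNgt; apply/negP => lt.
have l1 : 0 <= - (a * C + c * A) by lra.
have l2 : - (a * C + c * A) < - (2 * (b * B)) by lra.
have l3 : (a * C + c * A) ^+ 2 < (2 * (b * B)) ^+ 2.
  by rewrite -sqrrN -[X in _ < X]sqrrN ltr_pXn2r ?nnegrE //; apply: le_trans (ltW l2).
have l4 : (1 + b ^+ 2) * B ^+ 2 <= (a * c) * (A * C).
  by rewrite e ler_wpM2l // addr_ge0 // sqr_ge0.
have := sqr_ge0 B; lra.
Qed.

(** Pairing with a fixed vector grows no faster than the cosh of the distance, so that growth of a
    pairing forces displacement. *)
Lemma mink_hvec_le e : exists2 C : R, 0 < C & forall p,
  `|mink (hvec p) e| <= C * hcosh hi p.
Proof.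
exists (1 + `|e 0 i0| + `|e 0 i1| + `|e 0 i2|).
  by have := normr_ge0 (e 0 i0); have := normr_ge0 (e 0 i1);
     have := normr_ge0 (e 0 i2); lra.
move=> p; have hp := him_gt0 p.
have -> : hcosh hi p = ((him p)^-1 + (hre p ^+ 2 + him p ^+ 2) / him p) / 2.
  by rewrite /hcosh /=; field; rewrite gt_eqF.
rewrite /mink !mxE /=; set A := e 0 i0; set B := e 0 i1; set C := e 0 i2.
have : (him p)^-1 * ((hre p ^+ 2 + him p ^+ 2) / him p) = 1 + (hre p / him p) ^+ 2.
  by field; rewrite gt_eqF.
have : 0 < (him p)^-1 by rewrite invr_gt0.
move: (him p)^-1 (hre p / him p) (_ / him p) => a b c a0 ee.
have c0 : 0 < c by nra.
have bl : `|b| <= (a + c) / 2.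
  have h2 : `|b| ^+ 2 <= ((a + c) / 2) ^+ 2.
    by rewrite real_normK ?num_real //; have := sqr_ge0 (a - c); lra.
  by rewrite -(ler_pXn2r (n := 2)) ?nnegrE //; lra.
apply: le_trans (ler_normB _ _) _; rewrite normrM normrM.
have l1 : `|a * C + c * A| <= a * `|C| + c * `|A|.
  by apply: le_trans (ler_normD _ _) _; rewrite !normrM (gtr0_norm a0) (gtr0_norm c0).
have -> : `|2^-1 : R| = 2^-1 by rewrite gtr0_norm ?invr_gt0.
have A0 := normr_ge0 A; have B0 := normr_ge0 B; have C0 := normr_ge0 C.
have l2 : `|b| * `|B| <= (a + c) / 2 * `|B| by rewrite ler_wpM2r.
have l3 : 0 <= a * `|A| by rewrite mulr_ge0 // ltW.
have l4 : 0 <= c * `|C| by rewrite mulr_ge0 // ltW.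
lra.
Qed.

End Minkowski.

(** * Groups of bijections *)

Section Bijections.
Variable T : Type.

(** The inverse is stored to make inversion explicit; the same group structure serves for isometries
    and for permutations of labelled chambers. *)
Record bijection : Type := Bijection
  { bfun :> T -> T; binv : T -> T; bfunK : cancel bfun binv; binvK : cancel binv bfun }.

Lemma bijection_eq (f g : bijection) : bfun f =1 bfun g -> f = g.
Proof.
case: f g => [f f' h1 h2] [g g' h3 h4] /= /funext e; subst g.
have e' : f' = g' by apply/funext => x; rewrite -{1}(h4 x) h1.
by subst g'; rewrite (Prop_irrelevance h1 h3) (Prop_irrelevance h2 h4).
Qed.

HB.instance Definition _ := gen_eqMixin bijection.
HB.instance Definition _ := gen_choiceMixin bijection.

Definition bij1 : bijection := @Bijection id id (fun=> erefl) (fun=> erefl).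

Definition bijM (f g : bijection) : bijection :=
  @Bijection (bfun f \o bfun g) (binv g \o binv f)
    (can_comp (bfunK f) (bfunK g)) (can_comp (binvK g) (binvK f)).

Definition bijV (f : bijection) : bijection :=
  @Bijection (binv f) (bfun f) (binvK f) (bfunK f).

Lemma bijMA : associative bijM. Proof. by move=> f g h; apply: bijection_eq. Qed.
Lemma bij1M : left_id bij1 bijM. Proof. by move=> f; apply: bijection_eq. Qed.
Lemma bijM1 : right_id bij1 bijM. Proof. by move=> f; apply: bijection_eq. Qed.
Lemma bijVM : left_inverse bij1 bijV bijM.
Proof. by move=> f; apply: bijection_eq => x /=; rewrite bfunK. Qed.
Lemma bijMV : right_inverse bij1 bijV bijM.
Proof. by move=> f; apply: bijection_eq => x /=; rewrite binvK. Qed.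

HB.instance Definition _ := isGroup.Build bijection bijMA bij1M bijM1 bijVM bijMV.

Lemma bijME (f g : bijection) x : (f * g)%g x = f (g x). Proof. by []. Qed.
Lemma bijVK (f : bijection) x : (f^-1)%g (f x) = x. Proof. exact: bfunK. Qed.
Lemma bijKV (f : bijection) x : f ((f^-1)%g x) = x. Proof. exact: binvK. Qed.

Definition involution_bij (f : T -> T) (fK : involutive f) : bijection :=
  @Bijection f f fK fK.

End Bijections.

(* The six sides of the hexagon: [(true, i)] is a seam, [(false, i)] the cuff
   opposite to it.  A seam and a cuff are adjacent unless they are opposite. *)
Definition letter : Type := (bool * 'I_3)%type.
HB.instance Definition _ := Finite.on letter.

Definition adj (g h : letter) : bool := (g.1 != h.1) && (g.2 != h.2).

(** * Words in the right-angled Coxeter group *)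

Section Words.

Definition racg_rep (K : groupType) (rho : letter -> K) : Prop :=
  (forall g, (rho g * rho g = 1)%g) /\
  (forall g h, adj g h -> (rho g * rho h = rho h * rho g)%g).

Definition evw (K : groupType) (rho : letter -> K) (u : seq letter) : K :=
  foldr (fun g k => rho g * k)%g 1%g u.

Lemma evw_cat (K : groupType) (rho : letter -> K) u v :
  evw rho (u ++ v) = (evw rho u * evw rho v)%g.
Proof. by elim: u => [|g u IH] /=; rewrite ?mul1g // IH mulgA. Qed.

Lemma evw_rev (K : groupType) (rho : letter -> K) u : racg_rep rho ->
  evw rho (rev u) = (evw rho u)^-1%g.
Proof.
case=> r2 _; elim: u => [|g u IH] /=; first by rewrite invg1.
rewrite rev_cons -cats1 evw_cat IH /= mulg1 invgM; congr (_ * _)%g.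
by apply: (mulgI (rho g)); rewrite r2 mulgV.
Qed.

(* Equality in the right-angled Coxeter group, as equality in all groups
   satisfying its relations. *)
Definition weq (u v : seq letter) : Prop :=
  forall (K : groupType) (rho : letter -> K), racg_rep rho -> evw rho u = evw rho v.

Lemma weq_trans v u w : weq u v -> weq v w -> weq u w.
Proof. by move=> h1 h2 K rho r; rewrite (h1 _ _ r) (h2 _ _ r). Qed.
Lemma weq_cat u u' v v' : weq u u' -> weq v v' -> weq (u ++ v) (u' ++ v').
Proof. by move=> h1 h2 K rho r; rewrite !evw_cat (h1 _ _ r) (h2 _ _ r). Qed.
Lemma weq_cons g u v : weq u v -> weq (g :: u) (g :: v).
Proof. by move=> h K rho r /=; rewrite (h _ _ r). Qed.
Lemma weq_cancel g u : weq [:: g, g & u] u.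
Proof. by move=> K rho [r _] /=; rewrite mulgA r mul1g. Qed.
Lemma weq_swap g h u : adj g h -> weq [:: g, h & u] [:: h, g & u].
Proof. by move=> gh K rho [_ r] /=; rewrite !mulgA r. Qed.

Definition wreduced (u : seq letter) : Prop :=
  forall v, weq u v -> (size u <= size v)%N.

Lemma wreduced_exists u : exists2 v, weq u v & wreduced v.
Proof.
have [n] := ubnP (size u); elim: n => // n IH in u *; rewrite ltnS => un.
have [//|/existsNP[v /not_implyP[uv /negP]]] := pselect (wreduced u).
  by exists u.
rewrite -ltnNge => lt; have [w vw wr] := IH v (leq_trans lt un).
by exists w => //; exact: weq_trans uv vw.
Qed.

Lemma wreduced_behead g u : wreduced (g :: u) -> wreduced u.
Proof. by move=> r v uv; have := r (g :: v) (weq_cons g uv). Qed.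

(** The left descents of Coxeter theory, stated for words. *)
Definition starts g u : Prop := exists2 u', size u = (size u').+1 & weq u (g :: u').

Lemma wreduced_nstart g u : wreduced (g :: u) -> ~ starts g u.
Proof.
move=> r [u' su uu']; have := r u'.
have /[swap]/[apply] : weq (g :: u) u'.
  by apply: weq_trans (weq_cons g uu') _; exact: weq_cancel.
by rewrite /= su; lia.
Qed.

End Words.

(** * Faithfulness of the reflection representation *)

Section Hexagon.
Variables (R : realType) (e : letter -> 'rV[R]_3).
Hypothesis e1 : forall g, mink (e g) (e g) = 1.
Hypothesis e_adj : forall g h, adj g h -> mink (e g) (e h) = 0.
Hypothesis e_far : forall g h, g != h -> ~~ adj g h -> mink (e g) (e h) <= -1.
Hypothesis e_base : forall g, 0 < mink (hvec (hi R)) (e g).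

Local Notation o := (hi R).

Definition hgen g : bijection (hplane R) := involution_bij (hreflK (e1 g)).

Lemma hgen_rep : racg_rep hgen.
Proof.
split=> [g|g h gh]; apply: bijection_eq => p; rewrite bijME /=; first exact: hreflK.
by apply: hreflC => //; exact: e_adj.
Qed.

Local Notation hw := (evw hgen).

Lemma hw_cons g u p : hvec (hw (g :: u) p) = refl (e g) (hvec (hw u p)).
Proof. exact: hvec_hrefl. Qed.

Lemma hdist_hw u p q : hdist (hw u p) (hw u q) = hdist p q.
Proof. by elim: u => [//|g u IH]; rewrite /= [LHS]hdist_hrefl. Qed.

(* Tits' argument: the chamber of a reduced word lies on the positive side of
   every wall whose reflection does not shorten the word. *)
Lemma tits u g : wreduced u -> starts g u \/ 0 < mink (hvec (hw u o)) (e g).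
Proof.
have [n] := ubnP (size u); elim: n => // n IH in u g *; rewrite ltnS.
case: u => [|h u] un ru; first by right.
have [->|hg] := eqVneq h g; first by left; exists u.
have ru' := wreduced_behead ru.
have posh : 0 < mink (hvec (hw u o)) (e h).
  by case: (IH u h un ru') => // /(wreduced_nstart ru).
rewrite hw_cons refl_swap //.
(* For orthogonal walls the reflection in h fixes the vector of g, and a descent g of u moves to the
   front past h. *)
have [ad|nad] := boolP (adj h g).
  have -> : refl (e h) (e g) = e g by rewrite refl_id // minkC e_adj.
  case: (IH u g un ru') => [[u' su uu']|]; last by right.
  left; exists (h :: u'); first by rewrite /= su.
  by apply: weq_trans (weq_cons h uu') _; exact: weq_swap.
right; rewrite -refl_swap // -hw_cons.
have neg : mink (hvec (hw (h :: u) o)) (e h) < 0.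
  rewrite hw_cons refl_swap // /refl e1 minkDr minkZr.
  by move: (mink _ _) posh => x; lra.
have := e_far hg nad => far.
(* The sum is causal since the two vectors pair to at most -1, so no point is on the negative side
   of both walls. *)
have : 0 <= mink (hvec (hw (h :: u) o)) (e h + e g).
  apply: causal_ge0; first by rewrite minkDl !minkDr !e1 (minkC (e g)); lra.
  by rewrite minkDr addr_gt0.
rewrite minkDr; move: (mink _ (e h)) (mink _ (e g)) neg => x y; lra.
Qed.

(** A nonempty reduced word would place the base point on the negative side of the wall of its first
    letter. *)
Lemma hw_faithful u : hw u o = o -> weq u [::].
Proof.
move=> uo; have [v uv rv] := wreduced_exists u.
have vo : hw v o = o by rewrite -(uv _ _ hgen_rep).
suff e0 : v = [::] by rewrite e0 in uv.
case: v => [//|g v] in uv rv vo *.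
have [/(wreduced_nstart rv) //|pos] := tits g (wreduced_behead rv).
have := e_base g; rewrite -vo hw_cons refl_swap // /refl e1 minkDr minkZr.
by move: (mink _ _) pos => x h1 h2; exfalso; clear uo vo uv rv; lra.
Qed.

End Hexagon.

(** The distance from o to phi^N o is at most 2 d(o, p) + N d(p, phi p), and the pairing is at most
    a constant times its exponential; comparing growth rates in N gives L. *)
Lemma displacement_of_growth (R : realType) (phi : bijection (hplane R))
    (v : 'rV[R]_3) (sigma B L : R) :
  (forall p q, hdist (phi p) (phi q) = hdist p q) -> 0 < sigma ->
  (forall N : nat, sigma * expR (L * N%:R - B) <=
     `|mink (hvec ((phi ^+ N)%g (hi R))) v|) ->
  forall p, L <= hdist p (phi p).
Proof.
move=> iso s0 gr p; rewrite leNgt; apply/negP => lt.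
have [C C0 hC] := mink_hvec_le v.
have isoN N q r : hdist ((phi ^+ N)%g q) ((phi ^+ N)%g r) = hdist q r.
  by elim: N => [//|N IH]; rewrite !expgS !bijME iso.
have stepN N : hdist p ((phi ^+ N)%g p) <= N%:R * hdist p (phi p).
  elim: N => [|N IH]; first by rewrite mul0r hdistxx.
  apply: le_trans (hdist_triangle ((phi ^+ N)%g p) _ _) _.
  by rewrite -natr1 mulrDl mul1r lerD // expgSr bijME isoN.
pose d0 := hdist (hi R) p; pose dl := L - hdist p (phi p).
have dl0 : 0 < dl by rewrite subr_gt0.
pose E := C / sigma * expR (2 * d0 + B).
have bd N : expR (dl * N%:R) <= E.
  have := gr N => /le_trans /(_ (hC _)).
  have : hdist (hi R) ((phi ^+ N)%g (hi R)) <= 2 * d0 + N%:R * hdist p (phi p).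
    apply: le_trans (hdist_triangle p _ _) _.
    have := hdist_triangle ((phi ^+ N)%g p) p ((phi ^+ N)%g (hi R)).
    rewrite isoN (hdistC p (hi R)) -/d0; have := stepN N.
    move: (hdist p ((phi ^+ N)%g p)) (hdist p ((phi ^+ N)%g (hi R))).
    by move: (N%:R * hdist p (phi p)) => x y z; rewrite /d0; lra.
  rewrite -ler_expR => h1 h2.
  have {}h2 := le_trans h2 (ler_wpM2l (ltW C0) (le_trans (hcosh_le_exp _ _) h1)).
  rewrite /E mulrAC ler_pdivlMr // (mulrC _ sigma).
  have -> : dl * N%:R = (L * N%:R - B) + (B - N%:R * hdist p (phi p)).
    by rewrite /dl; ring.
  rewrite expRD mulrA.
  have := ler_wpM2r (expR_ge0 (B - N%:R * hdist p (phi p))) h2.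
  move=> /le_trans; apply; rewrite -mulrA -expRD ler_wpM2l ?(ltW C0) // ler_expR.
  by move: (_ * hdist _ _) => x; lra.
have := bd (Num.truncn (E / dl)).+1; apply/negP; rewrite -ltNge.
apply: lt_le_trans (expR_ge1Dx _).
have := truncnS_gt (E / dl); rewrite ltr_pdivrMr // => h.
by rewrite (mulrC dl); apply: lt_trans h _; rewrite ltrDr ltr01.
Qed.

(** * Displacement of words with a fixed chamber *)

Section Displacement.
(** Cuff walls are at distance at least ln ls from each other (the seam length), seam walls at least
    ln lc (the cuff length), and opposite sides at least arcosh ch. In [ch_lc], 2 ch^2 - 1 is the
    cosh of twice the last distance. *)
Variables (R : realType) (e : letter -> 'rV[R]_3) (ls lc ch : R).
Hypothesis e1 : forall g, mink (e g) (e g) = 1.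
Hypothesis e_adj : forall g h, adj g h -> mink (e g) (e h) = 0.
Hypothesis e_base : forall g, 0 < mink (hvec (hi R)) (e g).
Hypothesis ls1 : 1 <= ls.
Hypothesis lc1 : 1 <= lc.
Hypothesis ch1 : 1 <= ch.
Hypothesis cuff_gap : forall l k, l != k ->
  mink (e (false, l)) (e (false, k)) <= - (ls + ls^-1) / 2.
Hypothesis seam_gap : forall l k, l != k ->
  mink (e (true, l)) (e (true, k)) <= - (lc + lc^-1) / 2.
Hypothesis opp_gap : forall l, mink (e (true, l)) (e (false, l)) <= - ch.
Hypothesis ch_lc : (lc + lc^-1) / 2 <= 2 * ch ^+ 2 - 1.

Local Notation o := (hi R).
Local Notation hg := (hgen e1).
Local Notation hw := (evw hg).

Lemma addV_ge2 (x : R) : 1 <= x -> 2 <= x + x^-1.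
Proof.
move=> x1; have x0 : 0 < x by lra.
rewrite -subr_ge0 (_ : _ - 2 = (x - 1) ^+ 2 / x); last by field; rewrite gt_eqF.
by rewrite divr_ge0 ?sqr_ge0 // ltW.
Qed.

Lemma e_far g h : g != h -> ~~ adj g h -> mink (e g) (e h) <= -1.
Proof.
have l1 := addV_ge2 ls1; have l2 := addV_ge2 lc1.
case: g h => [b i] [c j]; rewrite /adj /= negb_and !negbK.
have [->|ij] := eqVneq i j => ne.
  have {}ne : b != c by apply: contraNneq ne => ->.
  have og : mink (e (true, j)) (e (false, j)) <= -1.
    by apply: le_trans (opp_gap j) _; rewrite lerN2.
  by move=> _; case: b c ne => [] [] // _; rewrite minkC.
rewrite orbF => /eqP <-; case: b ne => _.
  by have := seam_gap ij; move: (mink _ _) => x; lra.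
by have := cuff_gap ij; move: (mink _ _) => x; lra.
Qed.

Definition cw (t : seq 'I_3) : seq letter := [seq (false, l) | l <- t].

Definition vt (t : seq 'I_3) (v : 'rV[R]_3) : 'rV[R]_3 :=
  foldr (fun l v => refl (e (false, l)) v) v t.

Lemma mink_vt t u v : mink (vt t u) (vt t v) = mink u v.
Proof. by elim: t => //= l t IH; rewrite mink_refl. Qed.

Lemma hvec_cw t p : hvec (hw (cw t) p) = vt t (hvec p).
Proof. by elim: t => //= l t IH; rewrite hw_cons IH. Qed.

Lemma vt_cat s t v : vt (s ++ t) v = vt s (vt t v).
Proof. exact: foldr_cat. Qed.

Lemma vt_cons l t v : vt (l :: t) v = refl (e (false, l)) (vt t v).
Proof. by []. Qed.

Lemma vt_revK t v : vt (rev t) (vt t v) = v.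
Proof.
elim: t => //= l t IH; rewrite rev_cons -cats1 vt_cat /= reflK //.
Qed.

Lemma vt_notin t j : j \notin t -> vt t (e (true, j)) = e (true, j).
Proof.
elim: t => //= l t IH; rewrite inE negb_or => /andP[jl /IH ->].
by apply: refl_id; rewrite e_adj // /adj /= jl.
Qed.

Definition creduced (t : seq 'I_3) := sorted (fun l k => l != k) t.

Lemma cuff_le l k : l != k -> mink (e (false, l)) (e (false, k)) <= -1.
Proof. by move=> lk; apply: e_far; rewrite // xpair_eqE. Qed.

Lemma seam_cuff_le0 j l : mink (e (true, j)) (e (false, l)) <= 0.
Proof.
have [->|jl] := eqVneq j l; last by rewrite e_adj // /adj /= jl.
by apply: le_trans (opp_gap l) _; rewrite oppr_le0 (le_trans ler01).
Qed.

Lemma refl_root l j (al : 'I_3 -> R) :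
  refl (e (false, l)) (e (true, j) + \sum_(k < 3) al k *: e (false, k)) =
  e (true, j) + \sum_(k < 3) (if k == l then
     - al l - 2 * mink (e (true, j)) (e (false, l)) -
        2 * \sum_(i < 3 | i != l) al i * mink (e (false, i)) (e (false, l))
     else al k) *: e (false, k).
Proof.
rewrite /refl -addrA; congr (_ + _); set m := mink (_ + _) _.
have -> : m = mink (e (true, j)) (e (false, l)) + (al l +
    \sum_(i < 3 | i != l) al i * mink (e (false, i)) (e (false, l))).
  rewrite /m minkDl minkC [X in _ + X]minkC mink_sumr (bigD1 l) //= minkZr e1 mulr1.
  rewrite minkC; congr (_ + (_ + _)).
  by apply: eq_bigr => i _; rewrite minkZr minkC.
rewrite (bigD1 l) //= [RHS](bigD1 l) //= eqxx addrAC -scalerDl; congr (_ + _).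
  by congr (_ *: _); ring.
by apply: eq_bigr => k /negbTE ->.
Qed.

(* The coefficients of a positive root grow along a reduced word. *)
Lemma cuff_root l t j : creduced (l :: t) -> j \in l :: t ->
  exists al : 'I_3 -> R,
  [/\ vt (l :: t) (e (true, j)) = e (true, j) + \sum_(k < 3) al k *: e (false, k),
      forall k, 0 <= al k, forall k, al k <= al l & 2 * ch <= al j].
Proof.
elim: t => [|l' t IH] in l *.
  rewrite inE => _ /eqP ->.
  exists (fun k => if k == l then - 2 * mink (e (true, l)) (e (false, l)) else 0).
  have := opp_gap l => og; split=> [|k|k|]; rewrite ?eqxx //.
  - rewrite /= /refl (bigD1 l) //= eqxx big1 ?addr0 // => k /negbTE ->.
    by rewrite scale0r.
  - by case: ifP => _ //; move: (mink _ _) og ch1 => x; lra.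
  - by case: ifP => _ //; move: (mink _ _) og ch1 => x; lra.
  - by move: (mink _ _) og ch1 => x; lra.
rewrite [creduced _]/= => /andP[ll' red].
have [jt _|jt jl] := boolP (j \in l' :: t); last first.
  have {jl} <- : j = l by move: jl; rewrite inE (negbTE jt) orbF => /eqP.
  exists (fun k => if k == j then - 2 * mink (e (true, j)) (e (false, j)) else 0).
  have := opp_gap j => og; split=> [|k|k|]; rewrite ?eqxx //.
  - rewrite vt_cons vt_notin //.
    rewrite /refl (bigD1 j) //= eqxx big1 ?addr0 // => k /negbTE ->.
    by rewrite scale0r.
  - by case: ifP => _ //; move: (mink _ _) og ch1 => x; lra.
  - by case: ifP => _ //; move: (mink _ _) og ch1 => x; lra.
  - by move: (mink _ _) og ch1 => x; lra.
have [al [ve al0 almax alj]] := IH l' red jt.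
have sc := seam_cuff_le0 j l.
pose S := \sum_(i < 3 | i != l) al i * mink (e (false, i)) (e (false, l)).
have Sle : S <= - al l'.
  rewrite /S (bigD1 l') 1?eq_sym //=.
  have h1 : al l' * mink (e (false, l')) (e (false, l)) <= - al l'.
    by rewrite -mulrN1 ler_wpM2l // cuff_le // eq_sym.
  have h2 : \sum_(i < 3 | (i != l) && (i != l')) al i * mink (e (false, i)) (e (false, l)) <= 0.
    apply: sumr_le0 => i /andP[il _]; rewrite mulr_ge0_le0 //.
    by apply: le_trans (cuff_le il) _; rewrite lerN10.
  by rewrite -[leRHS]addr0 lerD.
have new : al l' <= - al l - 2 * mink (e (true, j)) (e (false, l)) - 2 * S.
  by have := almax l; move: (mink _ _) sc => x; lra.
eexists; split; first by rewrite vt_cons ve refl_root.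
- by move=> k /=; case: ifP => _ //; apply: le_trans (al0 l') new.
- by move=> k /=; rewrite eqxx; case: ifP => // _; apply: le_trans (almax k) new.
- rewrite /=; case: ifP => // /eqP jl; apply: le_trans alj (le_trans _ new).
  exact: almax.
Qed.

(** If j occurs in t, the translated root is a seam vector plus nonnegative multiples of cuff
    vectors, which pair nonpositively with seams. For i = j the coefficient 2 ch of the opposite
    cuff brings the pairing down to 1 - 2 ch^2. *)
Lemma seam_translate_gap t i j : creduced t -> ~~ ((i == j) && (i \notin t)) ->
  mink (e (true, i)) (vt t (e (true, j))) <= - (lc + lc^-1) / 2.
Proof.
move=> rt nij; have [jt|jt] := boolP (j \in t); last first.
  rewrite vt_notin // seam_gap //; apply: contraNneq nij => ij.
  by rewrite ij eqxx.
case: t => [//|l t] in rt nij jt *.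
have [al [-> al0 _ alj]] := cuff_root rt jt.
rewrite minkDr mink_sumr (bigD1 i) //= minkZr.
have h0 : \sum_(k < 3 | k != i) mink (e (true, i)) (al k *: e (false, k)) <= 0.
  by apply: sumr_le0 => k _; rewrite minkZr mulr_ge0_le0 // seam_cuff_le0.
have [ij|ij] := eqVneq i j; last first.
  have h1 : al i * mink (e (true, i)) (e (false, i)) <= 0.
    by rewrite mulr_ge0_le0 // seam_cuff_le0.
  by rewrite -[leRHS]addr0 lerD // ?seam_gap // -[leRHS]addr0 lerD.
subst j; rewrite e1; have := opp_gap i => og.
have h1 : al i * mink (e (true, i)) (e (false, i)) <= - (2 * ch ^+ 2).
  have ch0 : 0 <= ch by exact: le_trans ler01 ch1.
  rewrite -lerN2 opprK -mulrN expr2 mulrA; apply: ler_pM => //.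
    by rewrite mulr_ge0.
  by rewrite lerNr.
have := lerD (lerD (lexx 1) h1) h0; rewrite -addrA => /le_trans; apply.
by move: ch_lc; move: (lc + lc^-1) (ch ^+ 2) => x y; lra.
Qed.

Lemma base_translate t j : creduced t ->
  mink (hvec o) (e (true, j)) <= mink (hvec o) (vt t (e (true, j))).
Proof.
move=> rt; have [jt|jt] := boolP (j \in t); last by rewrite vt_notin.
case: t => [//|l t] in rt jt *.
have [al [-> al0 _ _]] := cuff_root rt jt.
rewrite minkDr mink_sumr lerDl sumr_ge0 // => k _.
by rewrite minkZr mulr_ge0 // ltW.
Qed.

(* Crossing two walls at distance ln la multiplies the sinh of the distance by
   at least la: e + la f is a causal vector. *)
Lemma wall_growth (la : R) (u v : 'rV[R]_3) p : 1 <= la -> mink u u = 1 ->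
  mink v v = 1 -> mink u v <= - (la + la^-1) / 2 ->
  0 < mink (hvec o) u -> 0 < mink (hvec o) v ->
  - (la * mink (hvec p) v) <= mink (hvec p) u.
Proof.
move=> la1 uu vv uv ou ov; have la0 : 0 < la by lra.
have : 0 <= mink (hvec p) (u + la *: v).
  apply: causal_ge0; last by rewrite minkDr minkZr addr_gt0 // mulr_gt0.
  rewrite minkDl !minkDr !minkZl !minkZr uu vv (minkC v u).
  have := ler_wpM2l (ltW la0) uv.
  rewrite (_ : la * (- (la + la^-1) / 2) = - (la ^+ 2 + 1) / 2); last first.
    by field; rewrite gt_eqF.
  by move: (mink u v) => x; lra.
by rewrite minkDr minkZr; move: (mink _ _) (_ * _) => x y; lra.
Qed.

Lemma sigma_exists : exists2 sigma, 0 < sigma & forall g, sigma <= mink (hvec o) (e g).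
Proof.
exists (\big[Num.min/1]_(g : letter) mink (hvec o) (e g)).
  by elim/big_ind: _ => // x y x0 y0; rewrite lt_min x0.
by move=> g; rewrite (bigD1 g) //= ge_min lexx.
Qed.

Definition blk (b : 'I_3 * seq 'I_3) : seq letter := (true, b.1) :: cw b.2.
Definition bw bs : seq letter := flatten (map blk bs).
(** The excluded pairs are those where the first seam commutes with the cuffs after it and then
    cancels against the next seam, see [cw_cancel]. *)
Definition noncancel (b b' : 'I_3 * seq 'I_3) := ~~ ((b.1 == b'.1) && (b.1 \notin b.2)).

Lemma bw_cons b bs : bw (b :: bs) = blk b ++ bw bs. Proof. by []. Qed.
Lemma bw_cat bs bs' : bw (bs ++ bs') = bw bs ++ bw bs'.
Proof. by rewrite /bw map_cat flatten_cat. Qed.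

Lemma mink_refl_self g p : mink (refl (e g) (hvec p)) (e g) = - mink (hvec p) (e g).
Proof. by rewrite refl_swap // /refl e1 minkDr minkZr; ring. Qed.

(** Walls of successive blocks are nested with gaps ln lc, so the sinh of the depth behind the first
    wall is multiplied by at least lc with each further block. *)
Lemma depth_blocks sigma b bs : (forall g, sigma <= mink (hvec o) (e g)) ->
  path noncancel b bs -> all (fun b => creduced b.2) (b :: bs) ->
  mink (hvec (hw (bw (b :: bs)) o)) (e (true, b.1)) <= - (sigma * lc ^+ size bs).
Proof.
move=> hs; elim: bs b => [|b' bs IH] [s t].
  rewrite /= !andbT => _ rt; rewrite /bw /= cats0 mulr1 hw_cons mink_refl_self lerN2.
  rewrite hvec_cw -(vt_revK (rev t) (e _)) revK mink_vt.
  apply: le_trans (hs (true, s)) (base_translate _ _).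
  rewrite /creduced rev_sorted; apply: sub_sorted rt => x y.
  by rewrite eq_sym.
case/andP => nc pt /andP[rt rts]; have {IH} h := IH b' pt rts.
rewrite bw_cons evw_cat bijME; set X := hw (bw _) o in h *.
have -> : hw (blk (s, t)) X = hrefl (e (true, s)) (hw (cw t) X) by [].
rewrite hvec_hrefl // mink_refl_self lerN2.
have gap := seam_translate_gap rt nc.
have := @wall_growth lc (e (true, s)) (vt t (e (true, b'.1))) (hw (cw t) X) lc1.
rewrite mink_vt hvec_cw mink_vt => /(_ (e1 _) (e1 _) gap (e_base _)).
move/(_ (lt_le_trans (e_base _) (base_translate _ rt))).
apply: le_trans; rewrite exprS mulrCA -mulrN.
by apply: ler_wpM2l; [exact: le_trans ler01 lc1|rewrite lerNr].
Qed.

Lemma depth_cuffs sigma l t : (forall g, sigma <= mink (hvec o) (e g)) ->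
  creduced (l :: t) ->
  mink (hvec (hw (cw (l :: t)) o)) (e (false, l)) <= - (sigma * ls ^+ size t).
Proof.
move=> hs; elim: t l => [|k t IH] l.
  by move=> _; rewrite [cw _]/= hw_cons mink_refl_self lerN2 mulr1.
case/andP => lk rt; have {IH} h := IH k rt.
rewrite [cw _]/= -/(cw (k :: t)) hw_cons mink_refl_self lerN2.
set X := hw (cw _) o in h *.
have := @wall_growth ls _ _ X ls1 (e1 _) (e1 _) (cuff_gap lk) (e_base _) (e_base _).
apply: le_trans; rewrite exprS mulrCA -mulrN.
by apply: ler_wpM2l; [exact: le_trans ler01 ls1|rewrite lerNr].
Qed.

Lemma cycle_path_repeat (T : eqType) (r : rel T) x p N :
  cycle r (x :: p) -> path r x (p ++ flatten (nseq N (x :: p))).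
Proof.
rewrite /= rcons_path => /andP[pp rl]; elim: N => [|N IH]; first by rewrite cats0.
by rewrite cat_path pp /= rl IH.
Qed.

Lemma hw_exp u N : (hw u ^+ N)%g = hw (flatten (nseq N u)).
Proof. by elim: N => [//|N IH]; rewrite expgS IH evw_cat. Qed.

Lemma displacement_chain (c la sigma : R) m u v : 0 <= c -> la = expR c -> 0 < sigma ->
  sigma <= mink (hvec o) v ->
  (forall N, (0 < N)%N -> exists2 k, (k.+1 = N * m)%N &
     mink (hvec (hw (flatten (nseq N u)) o)) v <= - (sigma * la ^+ k)) ->
  forall p, c * m%:R <= hdist p (hw u p).
Proof.
(* The shift B = c accounts for the off-by-one: N m nested walls have only N m - 1 gaps. *)
move=> c0 lac s0 sv h; apply: (@displacement_of_growth R _ v sigma c) => //.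
  by move=> p q; exact: hdist_hw.
case=> [|N].
  rewrite mulr0 sub0r; apply: le_trans (le_trans sv (ler_norm _)).
  by rewrite -[leRHS]mulr1 ler_wpM2l ?(ltW s0) // -expR0 ler_expR oppr_le0.
have [k kN hk] := h N.+1 isT; rewrite hw_exp.
rewrite -normrN.
apply: le_trans (ler_norm _); rewrite lerNr; apply: le_trans hk _.
rewrite lerN2 ler_wpM2l ?(ltW s0) // lac -expRM_natl ler_expR.
rewrite -mulrA -natrM (mulnC m) -kN -natr1 mulrDr mulr1 addrK.
by rewrite mulrC.
Qed.

Lemma map_flatten_nseq (T T' : Type) (f : T -> seq T') (s : seq T) N :
  flatten (map f (flatten (nseq N s))) = flatten (nseq N (flatten (map f s))).
Proof. by elim: N => //= N IH; rewrite map_cat flatten_cat IH. Qed.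

Lemma size_flatten_nseq (T : Type) (s : seq T) N : size (flatten (nseq N s)) = (N * size s)%N.
Proof. by elim: N => //= N IH; rewrite size_cat IH mulSn. Qed.

Lemma all_flatten_nseq (T : Type) (a : pred T) (s : seq T) N :
  all a s -> all a (flatten (nseq N s)).
Proof. by move=> h; elim: N => //= N IH; rewrite all_cat h. Qed.

Lemma displacement_blocks c bs : 0 <= c -> lc = expR c -> bs != [::] ->
  cycle noncancel bs -> all (fun b => creduced b.2) bs ->
  forall p, c * (size bs)%:R <= hdist p (hw (bw bs) p).
Proof.
move=> c0 lcc; case: bs => [//|b bs] _ cyc red.
have [sigma s0 hs] := sigma_exists.
apply: (displacement_chain c0 lcc s0 (hs (true, b.1))) => -[//|N] _.
exists (size (bs ++ flatten (nseq N (b :: bs)))).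
  by rewrite size_cat size_flatten_nseq mulSn.
rewrite -/(bw _) /bw -map_flatten_nseq -/(bw _).
apply: depth_blocks => //; first exact: cycle_path_repeat.
by rewrite -cat_cons all_cat red all_flatten_nseq.
Qed.

Lemma displacement_cuffs c t : 0 <= c -> ls = expR c -> t != [::] ->
  cycle (fun l k => l != k) t ->
  forall p, c * (size t)%:R <= hdist p (hw (cw t) p).
Proof.
move=> c0 lsc; case: t => [//|l t] _ cyc.
have [sigma s0 hs] := sigma_exists.
apply: (displacement_chain c0 lsc s0 (hs (false, l))) => -[//|N] _.
exists (size (t ++ flatten (nseq N (l :: t)))).
  by rewrite size_cat size_flatten_nseq mulSn.
have -> : flatten (nseq N.+1 (cw (l :: t))) = cw (flatten (nseq N.+1 (l :: t))).
  by elim: N.+1 => //= M IH; rewrite IH /cw -map_cat.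
apply: depth_cuffs => //; exact: (cycle_path_repeat N cyc).
Qed.

Lemma cw_reduce t : exists t', [/\ creduced t', weq (cw t) (cw t') & (size t' <= size t)%N].
Proof.
elim: t => [|l t [t' [rt tt' st]]]; first by exists [::].
case: t' => [|k t'] in rt tt' st *.
  by exists [:: l]; split=> //; exact: weq_cons tt'.
have [lk|lk] := eqVneq l k; last first.
  by exists [:: l, k & t']; split; rewrite /creduced /= ?lk //; exact: weq_cons tt'.
exists t'; split; last by apply: leq_trans (leq_trans st _); rewrite /= ltnW.
  by move: rt => /=; case: t' {tt' st} => //= x s /andP[].
by apply: weq_trans (weq_cons _ tt') _; rewrite lk; exact: weq_cancel.
Qed.

Section Covering.
Variables (V : Type) (eps : 'I_3 -> V -> V).
Hypothesis epsK : forall l, involutive (eps l).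

Definition side_map (g : letter) (w : V * bool) : V * bool :=
  if g.1 then (w.1, ~~ w.2) else (eps g.2 w.1, w.2).

Lemma side_mapK g : involutive (side_map g).
Proof. by case: g => -[] l [v b]; rewrite /side_map /= ?negbK ?epsK. Qed.

Definition side_gen g : bijection (V * bool) := involution_bij (side_mapK g).

Lemma side_gen_rep : racg_rep side_gen.
Proof.
split=> [g|g h /andP[gh _]]; apply: bijection_eq => w; first exact: side_mapK.
by case: g h w gh => [[] l] [[] k] [v b].
Qed.

Local Notation ow := (evw side_gen).

Lemma ow_cw t v b : ow (cw t) (v, b) = (foldr eps v t, b).
Proof.
elim: t => // l t IH.
by rewrite -[LHS]/(side_map (false, l) (ow (cw t) (v, b))) IH.
Qed.

Lemma ow_parity u w : (ow u w).2 = odd (count fst u) (+) w.2.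
Proof.
elim: u => [//|g u IH]; rewrite -[ow _ w]/(side_map g (ow u w)) /side_map.
by case: g => [[] l] /=; rewrite IH // addNb.
Qed.

Lemma parse_word u : exists t bs, u = cw t ++ bw bs /\ size bs = count fst u.
Proof.
elim: u => [|[[] l] u [t [bs [E s]]]]; first by exists [::], [::].
  by exists [::], ((l, t) :: bs); split; rewrite /= ?s // E.
by exists (l :: t), bs; split; rewrite /= ?s // E.
Qed.

Lemma blocks_reduce bs : exists bs', [/\ size bs' = size bs,
  all (fun b => creduced b.2) bs' & weq (bw bs) (bw bs')].
Proof.
elim: bs => [|[s t] bs [bs' [sz al w]]]; first by exists [::].
have [t' [rt tt' _]] := cw_reduce t.
exists ((s, t') :: bs'); rewrite /= sz rt al; split=> //.
by rewrite !bw_cons; apply: weq_cat w; exact: weq_cons tt'.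
Qed.

Lemma not_path_split (T : eqType) (r : rel T) x p : ~~ path r x p ->
  exists p1 a b p2, x :: p = p1 ++ [:: a, b & p2] /\ ~~ r a b.
Proof.
elim: p x => //= y p IH x; rewrite negb_and => /orP[rxy|/IH[p1 [a [b [p2 [E h]]]]]].
  by exists [::], x, y, p.
by exists (x :: p1), a, b, p2; rewrite E.
Qed.

(** The violating pair may consist of the last and the first entry; length at least 2 makes these
    two different positions. *)
Lemma not_cycle_rot (T : eqType) (r : rel T) (s : seq T) : (1 < size s)%N ->
  ~~ cycle r s -> exists s1 s2 a b s3, [/\ s = s1 ++ s2, s2 ++ s1 = [:: a, b & s3] & ~~ r a b].
Proof.
case: s => [//|x p] sz /= /not_path_split[p1 [a [b [p2 [E h]]]]].
case: (lastP p2) E => [|q c] E.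
  have e' : x :: p = rcons p1 a /\ x = b.
    by move: E; rewrite -cats1 -cat_cons -[p1 ++ _]cat_rcons -cats1 => /eqP;
       rewrite !cats1 eqseq_rcons => /andP[/eqP -> /eqP ->].
  case: e' => e1' xb; subst b; case: p1 e1' {E} => [|y p1] e1'.
    by move: sz; rewrite e1'.
  have xy : x = y by case: e1'.
  exists (y :: p1), [:: a], a, y, p1; rewrite e1' cats1; split=> //.
  by rewrite -xy.
exists p1, [:: a, b & q], a, b, (q ++ p1); split=> //.
have : rcons (x :: p) x = rcons (p1 ++ [:: a, b & q]) c.
  by rewrite -[LHS]/(x :: rcons p x) E rcons_cat.
by move/eqP; rewrite eqseq_rcons => /andP[/eqP].
Qed.

Lemma cw_cancel s t : s \notin t -> weq (blk (s, t) ++ [:: (true, s)]) (cw t).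
Proof.
elim: t => [_|l t IH]; first exact: weq_cancel.
rewrite inE negb_or => /andP[sl /IH h].
apply: (@weq_trans ((false, l) :: blk (s, t) ++ [:: (true, s)])); last exact: weq_cons.
by apply: weq_swap; rewrite /adj /=.
Qed.

Variables (L cc cs : R) (k0 : nat).
Hypothesis cc0 : 0 <= cc.
Hypothesis cs0 : 0 <= cs.
Hypothesis lc_exp : lc = expR cc.
Hypothesis ls_exp : ls = expR cs.
Hypothesis L_cc : L <= cc * 2.
Hypothesis L_cs : L <= cs * k0%:R.
Hypothesis k0_gt1 : (1 < k0)%N.
Hypothesis girth : forall v t, creduced t -> t != [::] -> foldr eps v t = v ->
  (k0 <= size t)%N.

Let stab u := (exists w, ow u w = w) /\ ~ weq u [::].
Let disp u := forall p, L <= hdist p (hw u p).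

Lemma stab_weq u v : weq u v -> stab u -> stab v.
Proof.
move=> uv [[w wf] nt]; split; first by exists w; rewrite -(uv _ _ side_gen_rep).
by move=> v0; apply: nt; exact: weq_trans uv v0.
Qed.

Lemma disp_weq u v : weq u v -> disp v -> disp u.
Proof. by move=> uv h p; rewrite (uv _ _ (hgen_rep e1 e_adj)); exact: h. Qed.

Lemma stab_rot u v : stab (u ++ v) -> stab (v ++ u).
Proof.
case=> [[w wf] nt]; split.
  exists ((ow u)^-1%g w); move: wf; rewrite !evw_cat !bijME bijKV => wf.
  by rewrite -{2}wf bijVK.
move=> h; apply: nt => K rho r; have := h K rho r; rewrite !evw_cat /= => E.
by apply: (mulgI (evw rho v)); rewrite mulgA E mul1g mulg1.
Qed.

Lemma disp_rot u v : disp (v ++ u) -> disp (u ++ v).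
Proof.
move=> h p; have := h ((hw u)^-1%g p).
rewrite !evw_cat !bijME bijKV -(hdist_hw e1 u) bijKV //.
Qed.

(** A cyclically reduced closed walk has length at least the girth; otherwise a conjugation brings
    two equal letters together and they cancel. *)
Lemma displacement_cuff_word t : stab (cw t) -> disp (cw t).
Proof.
have [n] := ubnP (size t); elim: n => // n IH in t *; rewrite ltnS => tn st.
have [t' [rt' tt' szt']] := cw_reduce t; apply: (disp_weq tt').
have {st} st := stab_weq tt' st; have {}szt' := leq_trans szt' tn.
have t'0 : t' != [::] by apply/eqP => e0; case: st => _; apply; rewrite e0.
have [cyc|ncyc] := boolP (cycle (fun l k => l != k) t').
  have [[[v b]]] := st; rewrite ow_cw => -[/girth gt] _ p.
  apply: le_trans (displacement_cuffs cs0 ls_exp t'0 cyc p).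
  by apply: le_trans L_cs _; rewrite ler_wpM2l // ler_nat; exact: gt.
have [sz1|sz1] := leqP (size t') 1.
  have [[[v b]]] := st; rewrite ow_cw => -[/(girth rt' t'0) gt] _.
  by move: (leq_trans k0_gt1 (leq_trans gt sz1)).
have [s1 [s2 [a [b [s3 [es er]]]]]] := not_cycle_rot sz1 ncyc.
rewrite negbK => /eqP ab; rewrite es /cw map_cat; apply: disp_rot.
rewrite -map_cat er ab -/(cw _); move: st; rewrite es /cw map_cat => /stab_rot.
rewrite -map_cat er ab -/(cw _) => st.
apply: (disp_weq (v := cw s3)); first exact: weq_cancel.
apply: IH; last by apply: stab_weq st; exact: weq_cancel.
by move: szt'; rewrite es size_cat addnC -size_cat er; exact: ltnW.
Qed.

Lemma bw_extend b bs t : exists2 bs', size bs' = (size bs).+1 &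
  bw (b :: bs) ++ cw t = bw bs'.
Proof.
rewrite lastI; case: (last b bs) => s t0.
exists (rcons (belast b bs) (s, t0 ++ t)); first by rewrite size_rcons size_belast.
by rewrite -!cats1 !bw_cat -catA /bw /= !cats0 /blk /= /cw map_cat.
Qed.

(** Induction on the number of seams. A fixed point makes this number even, as each seam exchanges
    front and back; so there are either no blocks or at least two, and two blocks displace by 2 cc
    >= L. *)
Lemma displacement_word u : stab u -> disp u.
Proof.
have [n] := ubnP (count fst u); elim: n => // n IH in u *; rewrite ltnS => un su.
have [t [bs [E sz]]] := parse_word u.
case: bs => [|b bs] in E sz.
  by move: su; rewrite E /= cats0; exact: displacement_cuff_word.
have [bs1 sz1 E1] := bw_extend b bs t.
have par : ~~ odd (size bs1).
  have [[w wf] _] := su; move/(congr1 snd): wf; rewrite ow_parity.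
  by rewrite sz1 -/(size (b :: bs)) sz; case: (odd _); case: w.2.
rewrite E; apply: disp_rot; rewrite E1.
have {}su : stab (bw bs1) by rewrite -E1; apply: stab_rot; rewrite -E.
have [bs2 [sz2 red2 w2]] := blocks_reduce bs1.
apply: (disp_weq w2); have {}su := stab_weq w2 su.
have size2 : (1 < size bs2)%N.
  by move: par; rewrite sz2 sz1; case: (size bs) => //.
have [cyc|ncyc] := boolP (cycle noncancel bs2).
  move=> p; apply: le_trans (displacement_blocks cc0 lc_exp _ cyc red2 p).
    by apply: le_trans L_cc _; rewrite ler_wpM2l // ler_nat.
  by case: bs2 size2 {cyc red2 w2 sz2 su}.
have [s1 [s2 [[s ta] [b' [s3 [es er]]]]]] := not_cycle_rot size2 ncyc.
rewrite negbK /= => /andP[/eqP sb sta]; case: b' sb er => s' tb /= <- er.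
(* The seam s passes through ta and cancels, which merges ta with tb and removes two seams. *)
have wq : weq (bw (s2 ++ s1)) (cw (ta ++ tb) ++ bw s3).
  rewrite er !bw_cons catA (_ : _ ++ blk (s, tb) =
    (blk (s, ta) ++ [:: (true, s)]) ++ cw tb); last by rewrite -catA.
  rewrite /cw map_cat; apply: weq_cat => //; apply: weq_cat => //.
  exact: cw_cancel.
rewrite es bw_cat; apply: disp_rot; rewrite -bw_cat; apply: (disp_weq wq).
apply: IH; last by apply: (stab_weq wq); rewrite bw_cat; apply: stab_rot; rewrite -bw_cat -es.
have cbw l : count fst (bw l) = size l.
  elim: l => // -[x y] l IHl; rewrite bw_cons count_cat IHl /= -[RHS]addn1 addnC.
  by congr (_ + _)%N; elim: y.
have ccw l : count fst (cw l) = 0%N by elim: l.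
rewrite count_cat ccw cbw add0n; move: un; rewrite -sz /= -sz1 -sz2 es size_cat addnC -size_cat er.
exact: ltnW.
Qed.

End Covering.
End Displacement.

(** * The hexagon with threefold symmetry *)

Section HexagonExists.
Variable R : realType.

(** Coordinates in which [mink] becomes the standard form x^2 + y^2 - z^2. *)
Definition vec3 (x y z : R) : 'rV[R]_3 := \row_(i < 3) [:: z + y; x; z - y]`_i.

Lemma mink_vec3 x y z x' y' z' :
  mink (vec3 x y z) (vec3 x' y' z') = x * x' + y * y' - z * z'.
Proof. by rewrite /mink !mxE /=; field. Qed.

Lemma mink_hi_vec3 x y z : mink (hvec (hi R)) (vec3 x y z) = - z.
Proof. by rewrite mink_hi !mxE /=; field. Qed.

(** With [third_y], the unit vectors at angles 0, 120 and 240 degrees. *)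
Definition third_x (l : 'I_3) : R := [:: 1; - 1 / 2; - 1 / 2]`_l.
Definition third_y (l : 'I_3) : R := [:: 0; Num.sqrt 3 / 2; - Num.sqrt 3 / 2]`_l.

Lemma third_dot l k :
  third_x l * third_x k + third_y l * third_y k = if l == k then 1 else - 1 / 2.
Proof.
have : Num.sqrt 3 ^+ 2 = 3 :> R by rewrite sqr_sqrtr.
rewrite /third_x /third_y; move: (Num.sqrt 3) => r r3.
by case: l k => [[|[|[|//]]] hl] [[|[|[|//]]] hk]; rewrite /eq_op /=; lra.
Qed.

(* With eta = cosh s - 1, where s is the common length of the seams, the cuff
   sides have length c with (cosh s - 1) (cosh c - 1) = 1. *)
Lemma hexagon_exists (Cs : R) : 1 < Cs -> exists e : letter -> 'rV[R]_3,
  [/\ forall g, mink (e g) (e g) = 1,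
      forall g h, adj g h -> mink (e g) (e h) = 0,
      forall g, 0 < mink (hvec (hi R)) (e g) &
  [/\ forall l k, l != k -> mink (e (false, l)) (e (false, k)) = - Cs,
      forall l k, l != k -> mink (e (true, l)) (e (true, k)) = - (1 + (Cs - 1)^-1) &
      exists ch, [/\ 0 <= ch, ch ^+ 2 = (2 * Cs - 1) * (Cs + 1) / (Cs - 1) &
        forall l, mink (e (true, l)) (e (false, l)) = - ch]]].
Proof.
move=> Cs1; pose eta := Cs - 1; have eta0 : 0 < eta by rewrite subr_gt0.
(* Here b and b' are the sinh of the distances from the centre to cuffs and to seams, solved from
   the prescribed pairings of two cuffs and of two seams; [aa] is then the orthogonality of adjacent
   sides. *)
pose b := Num.sqrt ((2 * Cs - 1) / 3); pose a := Num.sqrt (1 + b ^+ 2).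
pose b' := Num.sqrt ((2 + eta) / (3 * eta)); pose a' := Num.sqrt (1 + b' ^+ 2).
have hb : 0 < (2 * Cs - 1) / 3 by lra.
have hb' : 0 < (2 + eta) / (3 * eta) by rewrite divr_gt0 ?mulr_gt0 // addr_gt0.
have b0 : 0 < b by rewrite sqrtr_gt0.
have b'0 : 0 < b' by rewrite sqrtr_gt0.
have b2 : b ^+ 2 = (2 * Cs - 1) / 3 by rewrite sqr_sqrtr // ltW.
have b'2 : b' ^+ 2 = (2 + eta) / (3 * eta) by rewrite sqr_sqrtr // ltW.
have a2 : a ^+ 2 = 1 + b ^+ 2 by rewrite sqr_sqrtr // addr_ge0 ?sqr_ge0.
have a'2 : a' ^+ 2 = 1 + b' ^+ 2 by rewrite sqr_sqrtr // addr_ge0 ?sqr_ge0.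
have a0 : 0 <= a by exact: sqrtr_ge0.
have a'0 : 0 <= a' by exact: sqrtr_ge0.
have etan : eta != 0 by rewrite gt_eqF.
have aa : a * a' = 2 * (b * b').
  apply/eqP; rewrite -(@eqrXn2 _ 2) ?mulr_ge0 ?(ltW b0) ?(ltW b'0) //.
  rewrite !exprMn a2 a'2 b2 b'2; apply/eqP; rewrite /eta in etan *.
  by field; rewrite etan.
pose e (g : letter) := if g.1 then vec3 (- a' * third_x g.2) (- a' * third_y g.2) (- b')
  else vec3 (a * third_x g.2) (a * third_y g.2) (- b).
have ss l k : mink (e (true, l)) (e (true, k)) =
    a' ^+ 2 * (third_x l * third_x k + third_y l * third_y k) - b' ^+ 2.
  by rewrite /e /= mink_vec3; ring.
have cc l k : mink (e (false, l)) (e (false, k)) =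
    a ^+ 2 * (third_x l * third_x k + third_y l * third_y k) - b ^+ 2.
  by rewrite /e /= mink_vec3; ring.
have sc l k : mink (e (true, l)) (e (false, k)) =
    - (a * a') * (third_x l * third_x k + third_y l * third_y k) - b * b'.
  by rewrite /e /= mink_vec3; ring.
exists e; split=> [[[] l]|[[] l] [[] k]|[[] l]|].
- by rewrite ss third_dot eqxx a'2; ring.
- by rewrite cc third_dot eqxx a2; ring.
- by [].
- by rewrite /adj /= => lk; rewrite sc third_dot (negbTE lk) aa; field.
- by rewrite /adj /= => lk; rewrite minkC sc third_dot eq_sym (negbTE lk) aa; field.
- by [].
- by rewrite /e /= mink_hi_vec3 opprK.
- by rewrite /e /= mink_hi_vec3 opprK.
split=> [l k lk|l k lk|].
- by rewrite cc third_dot (negbTE lk) a2 b2; field.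
- rewrite ss third_dot (negbTE lk) a'2 b'2 -/eta.
  by field; rewrite etan.
exists (3 * (b * b')); split=> [||l].
- by rewrite !mulr_ge0 // ltW.
- by rewrite !exprMn b2 b'2 /eta in etan *; field.
by rewrite sc third_dot eqxx aa; ring.
Qed.

(** For seams of length 1/K the hexagon relation gives cosh c - 1 >= K^2, by the estimate e^(-1/K)
    >= 1 - 1/K. *)
Lemma cosh_inv_bound (K : R) : 4 <= K ->
  let Cs : R := (expR K^-1 + (expR K^-1)^-1) / 2 in
  [/\ 1 < Cs, K ^+ 2 <= (Cs - 1)^-1 & Cs <= 2].
Proof.
move=> K4 Cs; pose x := expR K^-1.
have K0 : 0 < K by lra.
have x1 : 1 < x by rewrite expR_gt1 invr_gt0.
have x0 : 0 < x by lra.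
have xn : x != 0 by rewrite gt_eqF.
have Kn : K != 0 by rewrite gt_eqF.
have xle : (K - 1) * (x - 1) <= 1.
  have h : (1 - K^-1) * x <= 1.
    have := expR_ge1Dx (- K^-1); rewrite expRN -/x => h.
    by have := ler_wpM2r (ltW x0) h; rewrite mulVf.
  have := ler_wpM2l (ltW K0) h; rewrite mulrA mulrBr mulfV // !mulr1; lra.
have CsE : Cs - 1 = (x - 1) ^+ 2 / (2 * x).
  by rewrite /Cs -/x; field.
have Cs1 : 0 < Cs - 1.
  by rewrite CsE divr_gt0 ?exprn_gt0 ?subr_gt0 // mulr_gt0.
have sq : ((K - 1) * (x - 1)) ^+ 2 <= 1.
  by rewrite expr_le1 // mulr_ge0; lra.
have Csle : (Cs - 1) * K ^+ 2 <= 1.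
  rewrite CsE mulrAC ler_pdivrMr ?mulr_gt0 // mul1r.
  have h : K ^+ 2 <= 2 * (K - 1) ^+ 2 by nra.
  have := ler_wpM2l (sqr_ge0 (x - 1)) h; move: sq; rewrite exprMn.
  move: ((K - 1) ^+ 2) ((x - 1) ^+ 2) (K ^+ 2) => u v w; lra.
split; first by lra.
  by rewrite -[leRHS]mul1r ler_pdivlMr // mulrC.
have h : 1 <= K ^+ 2 by rewrite expr_ge1 //; lra.
have := ler_wpM2l (ltW Cs1) h; lra.
Qed.

Lemma expR15_le : expR 15 <= (2 ^+ 12) ^+ 2 :> R.
Proof.
have e1 : expR 1 <= 3 :> R.
  have h := expR_ge1Dx (- (1 / 8) : R); rewrite expRN in h.
  have y0 : 0 < expR (1 / 8 : R) by exact: expR_gt0.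
  have y1 : expR (1 / 8 : R) <= 8 / 7.
    have := ler_wpM2r (ltW y0) h; rewrite mulVf ?gt_eqF //; lra.
  have -> : 1 = 8%:R * (1 / 8) :> R by field.
  rewrite expRM_natl; apply: (@le_trans _ _ ((8 / 7) ^+ 8)); last by lra.
  by rewrite ler_pXn2r ?nnegrE ?expR_ge0 //; lra.
have -> : 15 = 15%:R * 1 :> R by rewrite mulr1.
rewrite expRM_natl; apply: (@le_trans _ _ (3 ^+ 15)).
  by rewrite ler_pXn2r ?nnegrE ?expR_ge0.
rewrite -exprM -[15%N]/(5 * 3)%N -[(12 * 2)%N]/(8 * 3)%N exprM [leRHS]exprM.
by rewrite ler_pXn2r ?nnegrE ?exprn_ge0 //; lra.
Qed.

(* The group generated by the reflections in the sides of a right-angled hexagon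
   with short seams. *)
Lemma hexagon_group : exists (gen : letter -> bijection (hplane R)),
  [/\ racg_rep gen,
      forall u p q, hdist (evw gen u p) (evw gen u q) = hdist p q,
      forall u, evw gen u = 1%g -> weq u [::] &
      forall (V : Type) (eps : 'I_3 -> V -> V) (epsK : forall l, involutive (eps l)),
        (forall v t, creduced t -> t != [::] -> foldr eps v t = v ->
          (30 * 2 ^ 12 <= size t)%N) ->
        forall u, (exists w, evw (side_gen epsK) u w = w) -> ~ weq u [::] ->
        forall p, 30 <= hdist p (evw gen u p)].
Proof.
(* The seam length is 1/K: then 30 K cuff letters displace by 30, and K^2 >= e^15 makes the cuffs at
   least 15 long. *)
pose K : R := 2 ^+ 12.
have K4 : 4 <= K.
  have -> : 4 = 2 ^+ 2 :> R by rewrite expr2; lra.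
  by rewrite /K ler_eXn2l // ltr1n.
have [Cs1 Csb Cs2] := cosh_inv_bound K4; move: Cs1 Csb Cs2.
set Cs := (expR _ + _) / 2 => Cs1 Csb Cs2.
have [e [e1 e_adj e_base [cuff seam [ch [ch0 ch2 opp]]]]] := hexagon_exists Cs1.
have e15 : (expR 15 + (expR 15)^-1) / 2 <= 1 + (Cs - 1)^-1 :> R.
  have := expR15_le; rewrite -/K; have := expR_gt0 (15 : R).
  have : (expR 15)^-1 <= 1 :> R by rewrite invf_le1 ?expR_gt0 // -expR0 ler_expR.
  by move: Csb; move: (Cs - 1)^-1 (expR (15 : R))^-1 (expR (15 : R)) (K ^+ 2) => u w v k; lra.
have ls1 : 1 <= expR K^-1 by rewrite -expR0 ler_expR invr_ge0; lra.
have lc1 : 1 <= expR 15 :> R by rewrite -expR0 ler_expR.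
have chb : 1 + (Cs - 1)^-1 <= 2 * ch ^+ 2 - 1.
  rewrite ch2; have eta0 : 0 < Cs - 1 by rewrite subr_gt0.
  have i0 : 0 < (Cs - 1)^-1 by rewrite invr_gt0.
  have i1 : 1 <= (Cs - 1)^-1.
    have h : (Cs - 1)^-1 * (Cs - 1) <= (Cs - 1)^-1 * 1.
      by rewrite ler_wpM2l ?(ltW i0) //; lra.
    by move: h; rewrite mulVf ?gt_eqF // mulr1.
  have h : 2 <= (2 * Cs - 1) * (Cs + 1) by nra.
  have := ler_wpM2r (ltW i0) h.
  move: ((2 * Cs - 1) * (Cs + 1) / (Cs - 1)) (Cs - 1)^-1 i1 => u v; lra.
have ch1 : 1 <= ch.
  rewrite -(ler_pXn2r (n := 2)) ?nnegrE // expr1n.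
  have : 0 < (Cs - 1)^-1 by rewrite invr_gt0 subr_gt0.
  by move: chb; move: (Cs - 1)^-1 (ch ^+ 2) => u v; lra.
have cuff_gap l k : l != k -> mink (e (false, l)) (e (false, k)) <=
    - (expR K^-1 + (expR K^-1)^-1) / 2 by move/cuff ->; rewrite mulNr.
have seam_gap l k : l != k -> mink (e (true, l)) (e (true, k)) <=
    - (expR 15 + (expR 15)^-1) / 2 by move/seam ->; rewrite mulNr lerN2.
have opp_gap l : mink (e (true, l)) (e (false, l)) <= - ch by rewrite opp.
have far := e_far ls1 lc1 ch1 cuff_gap seam_gap opp_gap.
exists (hgen e1); split.
- exact: hgen_rep.
- exact: hdist_hw.
- by move=> u u1; apply: (hw_faithful (e1 := e1) e_adj far e_base); rewrite u1.
move=> V eps epsK girth u fx nt.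
have Ki : 0 <= K^-1 by rewrite invr_ge0; lra.
have L1 : 30 <= 15 * 2 :> R by rewrite -natrM.
have L2 : 30 <= K^-1 * (30 * 2 ^ 12)%:R.
  by rewrite natrM natrX -/K mulrC mulfK // gt_eqF //; lra.
have k1 : (1 < 30 * 2 ^ 12)%N.
  by apply: (@leq_trans 30) => //; rewrite leq_pmulr // expn_gt0.
exact: (displacement_word e1 e_adj e_base ls1 lc1 ch1 cuff_gap seam_gap opp_gap
  (le_trans e15 chb) (ler0n _ 15) Ki erefl erefl L1 L2 k1 girth (conj fx nt)).
Qed.

End HexagonExists.

(** * Cubic graphs of large girth *)

Local Open Scope nat_scope.

Section LargeGirth.
Variables (V : finType) (alpha beta : V -> V) (col : V -> bool).
Hypothesis alphaK : involutive alpha.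
Hypothesis betaK : involutive beta.
Hypothesis col_alpha : forall v, col (alpha v) = ~~ col v.
Hypothesis col_beta : forall v, col (beta v) = ~~ col v.
Hypothesis col_balanced : #|[pred v | col v]| = #|[pred v | ~~ col v]|.
Implicit Types (mu : V -> V) (u v w x y : V) (t m : seq 'I_3).

Definition cubic mu (l : 'I_3) : V -> V :=
  if l == 0 :> nat then alpha else if l == 1 :> nat then beta else mu.

Definition walk mu v t : V := foldl (fun w l => cubic mu l w) v t.

(* The edges of the graph are the pairs {v, cubic mu l v} with two elements. *)
Fixpoint moves mu v t : bool :=
  if t is l :: t' then (cubic mu l v != v) && moves mu (cubic mu l v) t' else true.

Definition nobt t := sorted (fun l k : 'I_3 => l != k) t.

Arguments nobt : simpl never.

Definition girth_ge mu k := forall v t, nobt t -> t != [::] -> moves mu v t ->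
  walk mu v t = v -> k <= size t.

(** A partial matching between the two colours, whose fixed points are the unmatched vertices. *)
Definition bip_involution mu :=
  involutive mu /\ forall v, mu v != v -> col (mu v) = ~~ col v.

Lemma cubicK mu l : involutive mu -> involutive (cubic mu l).
Proof. by move=> h; rewrite /cubic; case: ifP => // _; case: ifP. Qed.

Lemma walk_cat mu v s t : walk mu v (s ++ t) = walk mu (walk mu v s) t.
Proof. exact: foldl_cat. Qed.

Lemma moves_cat mu v s t : moves mu v (s ++ t) = moves mu v s && moves mu (walk mu v s) t.
Proof. by elim: s v => //= l s IH v; rewrite IH andbA. Qed.

Lemma walk_rev mu v t : involutive mu -> walk mu (walk mu v t) (rev t) = v.
Proof.
move=> muK; elim: t v => //= l t IH v.
by rewrite rev_cons -cats1 walk_cat IH /= cubicK.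
Qed.

Lemma moves_rev mu v t : involutive mu -> moves mu v t -> moves mu (walk mu v t) (rev t).
Proof.
move=> muK; elim: t v => //= l t IH v /andP[h /IH ht].
by rewrite rev_cons -cats1 moves_cat ht walk_rev //= cubicK // eq_sym h.
Qed.

Lemma nobt_rev t : nobt (rev t) = nobt t.
Proof. by rewrite /nobt rev_sorted; apply: eq_sorted => l k; rewrite eq_sym. Qed.

Lemma nobt_cat s t : nobt (s ++ t) -> nobt s /\ nobt t.
Proof.
rewrite /nobt; case: s => // l s; rewrite /= cat_path => /andP[-> h]; split=> //.
exact: path_sorted h.
Qed.

Lemma nobt_join l s k t : nobt (l :: s ++ k :: t) -> last l s != k.
Proof. by rewrite /nobt /= cat_path /= => /and3P[]. Qed.

Let c2 : 'I_3 := ord_max.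

Lemma cubic_c2 mu : cubic mu c2 = mu. Proof. by []. Qed.

Lemma cubic_n2 mu mu' l : l != c2 -> cubic mu l = cubic mu' l.
Proof. by case: l => [[|[|[|]]] h] //; rewrite -val_eqE. Qed.

Section Change.
Variables (mu mu' : V -> V) (k : nat) (B : pred V).
Hypothesis muK : involutive mu.
Hypothesis muK' : involutive mu'.
Hypothesis girth_mu : girth_ge mu k.

(** The ends of new edges. [B] contains an end of each of them, and no short old walk leads from [B]
    to such an end, whereas a short closed walk using new edges would contain one. The bound counts
    size s + 1 letters and one new edge. *)
Let new v := (mu' v != v) && (mu' v != mu v).

Hypothesis newB : forall v, new v -> B v || B (mu' v).
Hypothesis segB : forall b c l s, B b -> new c -> nobt (l :: s) ->
  l != c2 -> last l s != c2 -> moves mu b (l :: s) -> (size s).+2 < k ->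
  walk mu b (l :: s) <> c.

Lemma old_prefix v s : moves mu' v s -> exists m r, [/\ s = m ++ r, moves mu v m,
  walk mu v m = walk mu' v m & r = [::] \/ exists2 r', r = c2 :: r' & new (walk mu v m)].
Proof.
elim: s v => [|l s IH] v /=; first by exists [::], [::]; split=> //; left.
case/andP => h /IH[m [r [-> mv wv hr]]].
have [/andP[/eqP lc nv]|nn] := boolP ((l == c2) && new v).
  by exists [::], (l :: m ++ r); split=> //; right; exists (m ++ r); rewrite ?lc.
have e : cubic mu' l v = cubic mu l v.
  have [lc|lc] := eqVneq l c2; last by rewrite (cubic_n2 mu mu' lc).
  move: nn h; rewrite lc eqxx /= !cubic_c2 /new => nn h.
  by move: nn; rewrite h /= negbK => /eqP.
by exists (l :: m), r; rewrite /= -e h.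
Qed.

(** Stopping at the first new edge leaves an old walk that still ends at an end of a new edge,
    against [segB]. *)
Lemma new_segment b l s : B b -> nobt (l :: s) -> l != c2 -> last l s != c2 ->
  moves mu' b (l :: s) -> new (walk mu' b (l :: s)) -> (size s).+2 < k -> False.
Proof.
move=> Bb nb lc sc mv nw sz.
have [m [r [E mvm wm]]] := old_prefix mv.
case: m => [|l' m] in E mvm wm *.
  by case=> [r0|[r' r0 _]]; move: E; rewrite r0 // => -[E]; rewrite E eqxx in lc.
case: E => e1 E; rewrite -e1 in mvm wm *.
case=> [r0|[r' rc nm]].
  rewrite r0 cats0 in E; rewrite -E in mvm wm.
  by apply: (segB Bb nw nb lc sc mvm sz); rewrite wm.
rewrite E rc in nb sz; have [nb1 _] : nobt (l :: m) /\ nobt (c2 :: r').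
  exact: (@nobt_cat (l :: m) (c2 :: r')).
apply: (segB Bb nm nb1 lc (nobt_join nb) mvm) => //.
by apply: leq_trans sz; rewrite size_cat /= addnS !ltnS leqW ?leq_addr.
Qed.

Lemma girth_change : girth_ge mu' k.
Proof.
move=> v t; have [n] := ubnP (size t); elim: n => // n IH in v t *; rewrite ltnS => tn.
move=> nt t0 mv wv; rewrite leqNgt; apply/negP => tk.
have [m [r [E mvm wm hr]]] := old_prefix mv.
case: hr => [r0|[r' rc nm]].
  move: E; rewrite r0 cats0 => E; rewrite -E in mvm wm.
  by have := girth_mu nt t0 mvm; rewrite wm wv leqNgt tk => /(_ erefl).
rewrite rc in E; set w := walk mu v m in nm wm.
(* The closed walk is rotated so as to start just after its first new edge. *)
pose s := r' ++ m.
have wr' : walk mu' (mu' w) r' = v by rewrite -[RHS]wv E walk_cat -wm.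
have ws : walk mu' (mu' w) s = w by rewrite /s walk_cat wr' -wm.
have mvs : moves mu' (mu' w) s.
  move: mv; rewrite E moves_cat /= -wm => /and3P[m1 _ m2].
  by rewrite /s moves_cat m2 /= wr'.
have sz : (size s).+1 < k.
  by move: tk; rewrite E /s !size_cat /= addnS addnC.
have s0 : s != [::].
  apply/eqP => s0; move: ws nm; rewrite s0 /= /new => e.
  by rewrite e eqxx.
(* the closed walk is cyclically reduced, otherwise it can be shortened *)
have cyc l s' : t = l :: s' -> s' != [::] -> last l s' != l.
  move=> e s'n; apply/eqP => el.
  case: (lastP s') e s'n el => // q z e _; rewrite last_rcons => zl.
  rewrite zl in e; rewrite e in mv wv nt tn tk; move: mv => /= /andP[h].
  rewrite -cats1 moves_cat => /andP[mv' _].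
  have q0 : q != [::] by apply: contraTneq nt => ->; rewrite /nobt /= eqxx.
  have nq : nobt q.
    by move: nt; rewrite -cat1s -cats1 => /nobt_cat[_ /nobt_cat[]].
  have := IH (cubic mu' l v) q _ nq q0 mv'.
  have -> : walk mu' (cubic mu' l v) q = cubic mu' l v.
    move: wv; rewrite /= -cats1 walk_cat /= => /(congr1 (cubic mu' l)).
    by rewrite cubicK.
  move: tn tk; rewrite /= size_rcons => h1 h2 h3.
  have := leq_trans h2 (h3 (ltnW h1) erefl).
  by move=> /ltnW /ltnW; rewrite ltnn.
have [l0 [s1 [es ns hs ls]]] : exists l0 s1,
    [/\ s = l0 :: s1, nobt (l0 :: s1), l0 != c2 & last l0 s1 != c2].
  move: nt cyc s0; rewrite /s E.
  case: (m) => [|l m']; case: (r') => [|l' r''] //= nt cyc _.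
  - exists l', r''; rewrite cats0; move: nt; rewrite /nobt /= => /andP[h1 h2].
    by split=> //; [rewrite eq_sym|exact: (cyc c2 (l' :: r'') erefl)].
  - exists l, m'; move: (nt); rewrite -cat_cons => /nobt_cat[h1 _].
    split=> //; last exact: (nobt_join nt).
    rewrite eq_sym; have := cyc l (m' ++ [:: c2]) erefl.
    by rewrite cats1 last_rcons; apply; case: (m').
  exists l', (r'' ++ l :: m'); move: (nt); rewrite -cat_cons => /nobt_cat[h1].
  rewrite /nobt /= => /andP[h2 h3]; split=> //.
  - move: h1; rewrite /nobt /= => h1; rewrite cat_path h3 /= h1 andbT.
    have := cyc l (m' ++ c2 :: l' :: r'') erefl.
    by rewrite last_cat /=; apply; case: (m').
  - by rewrite eq_sym.
  - by rewrite last_cat /=; exact: (nobt_join nt).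
have nww : new (mu' w).
  move: nm; rewrite /new muK' => /andP[h1 h2]; rewrite eq_sym h1 /=.
  by apply: contraNneq h2 => e; rewrite [in mu w]e muK.
rewrite es in ws mvs sz; case/orP: (newB nm) => [Bw|Bw]; last first.
  apply: (new_segment Bw ns hs ls mvs) => //; first by rewrite ws.
(* If it is w that lies in [B], the walk is read backwards. *)
have mr := moves_rev muK' mvs; have wr := walk_rev (mu' w) (l0 :: s1) muK'.
rewrite ws in mr wr; move: mr wr ns hs ls sz.
rewrite -nobt_rev -[(size s1).+2]/((size (l0 :: s1)).+1) -(size_rev (l0 :: s1)).
rewrite lastI rev_rcons; set q := rev _ => mr wr nq hl ll sq.
apply: (new_segment Bw nq ll _ mr) => //; last by rewrite wr.
rewrite /q; move: hl; case: (s1) => //= z s2.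
by rewrite rev_cons last_rcons.
Qed.
End Change.

Definition nb mu (S : {set V}) : {set V} :=
  S :|: (alpha @: S) :|: (beta @: S) :|: (mu @: S).

Definition graph_ball mu v k := iter k (nb mu) [set v].

Lemma card_graph_ball mu v k : #|graph_ball mu v k| <= 4 ^ k.
Proof.
elim: k => [|k IH]; first by rewrite cards1.
rewrite /graph_ball iterS -/(graph_ball mu v k) expnS; set S := graph_ball mu v k in IH *.
apply: (@leq_trans (4 * #|S|)); last by rewrite leq_mul2l.
have U (A B : {set V}) : #|A :|: B| <= #|A| + #|B| by rewrite cardsU leq_subr.
have h1 := U (S :|: (alpha @: S) :|: (beta @: S)) (mu @: S).
have h2 := U (S :|: (alpha @: S)) (beta @: S).
have h3 := U S (alpha @: S).
have i1 := leq_imset_card alpha S; have i2 := leq_imset_card beta S.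
have i3 := leq_imset_card mu S; rewrite -/(nb mu S) in h1.
by lia.
Qed.

Lemma sub_nb mu (S : {set V}) : S \subset nb mu S.
Proof. by rewrite /nb -!finset.setUA finset.subsetUl. Qed.

Lemma walk_graph_ball mu v t k : size t <= k -> walk mu v t \in graph_ball mu v k.
Proof.
rewrite /graph_ball; have : v \in [set v] by rewrite inE.
move: [set v] => S; elim: k t v S => [|k IH] [|l t] v S vS //.
  by move=> _; rewrite iterSr; apply: IH => //; apply: (fintype.subsetP (sub_nb mu S)).
rewrite iterSr /= ltnS; apply: IH; rewrite /cubic /nb !inE.
by case: ifP => _; [|case: ifP => _]; rewrite imset_f ?orbT.
Qed.

(** Otherwise [mu] would map the colour class opposite to u injectively, hence onto, the equally
    large class of u, and reach u. *)
Lemma unmatched_pair mu u : bip_involution mu -> mu u = u ->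
  exists2 w, mu w = w & col w = ~~ col u.
Proof.
case=> muK mucol uu.
pose S := [set v | col v == ~~ col u]; pose T := [set v | col v == col u].
have ST : #|S| = #|T|.
  have e1 b : #|[set v | col v == b]| = #|[pred v | col v == b]| by rewrite cardsE.
  rewrite /S /T !e1; move: col_balanced.
  have -> : #|[pred v | col v]| = #|[pred v | col v == true]|.
    by apply: eq_card => v; rewrite !inE eqb_id.
  have -> : #|[pred v | ~~ col v]| = #|[pred v | col v == false]|.
    by apply: eq_card => v; rewrite !inE eqbF_neg.
  by case: (col u).
have [/existsP[w /andP[/eqP ww /eqP wc]]|] :=
  boolP [exists w, (mu w == w) && (col w == ~~ col u)]; first by exists w.
rewrite negb_exists => /forallP h.
have sub : mu @: S \subset T.
  apply/fintype.subsetP => _ /imsetP[y yS ->]; rewrite !inE in yS *.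
  have := h y; rewrite yS andbT => /mucol ->; by rewrite (eqP yS) negbK.
have : mu @: S = T.
  by apply/eqP; rewrite eqEcard sub (card_imset _ (inv_inj muK)) ST leqnn.
move/setP/(_ u); rewrite [RHS]inE eqxx => /imsetP[y yS uy].
by move: yS; rewrite inE -[y]muK -uy uu; case: (col u).
Qed.

(** The exchange argument of Erdos and Sachs. If a far unmatched vertex of the other colour exists,
    it is joined to u. Otherwise an edge {x, y} far from u and from an unmatched w is replaced by
    {u, y} and {w, x}. Two balls and their images under [mu] contain at most 4 * 4^k vertices, which
    leaves room for y. *)
Lemma improve mu u k : bip_involution mu -> mu u = u -> girth_ge mu k ->
  4 ^ k.+1 < #|[pred v | col v]| ->
  exists mu', [/\ bip_involution mu', girth_ge mu' k &
    [set v | mu' v == v] \proper [set v | mu v == v]].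
Proof.
move=> bip uu gk big; have [muK mucol] := bip.
have [w0 w0w0 w0c] := unmatched_pair bip uu.
have [/existsP[w /and3P[/eqP ww /eqP wc far]]|] := boolP
    [exists w, [&& mu w == w, col w == ~~ col u & w \notin graph_ball mu u k]].
  have uw : u != w by apply/eqP => e; move: wc; rewrite -e; case: (col u).
  pose mu' v := if v == u then w else if v == w then u else mu v.
  have mu'K : involutive mu'.
    move=> v; rewrite /mu'; have [->|vu] := eqVneq v u.
      by rewrite eq_sym (negbTE uw) eqxx.
    have [->|vw] := eqVneq v w; first by rewrite eqxx.
    rewrite -{1}uu (inj_eq (inv_inj muK)) (negbTE vu).
    by rewrite -{1}ww (inj_eq (inv_inj muK)) (negbTE vw) muK.
  have newE v : (mu' v != v) && (mu' v != mu v) -> v = u \/ v = w.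
    rewrite /mu'; have [->|vu] := eqVneq v u; first by left.
    by have [->|vw] := eqVneq v w; [right|rewrite eqxx andbF].
  exists mu'; split.
  - split=> // v; rewrite /mu'; have [->|vu] := eqVneq v u; first by rewrite wc.
    have [->|vw] := eqVneq v w; first by rewrite wc negbK.
    exact: mucol.
  - apply: (girth_change (B := pred1 u) muK mu'K gk) => [v /newE[]->|].
    + by rewrite /= eqxx.
    + by rewrite /= /mu' eq_sym (negbTE uw) eqxx /= eqxx.
    move=> b c l s /eqP -> /newE nc nb _ _ mv sz.
    case: nc => -> e; first by have := gk _ _ nb isT mv e; rewrite /= leqNgt (ltnW sz).
    by move: far; rewrite -e walk_graph_ball //; exact: ltnW (ltnW sz).
  apply/properP; split; last first.
    by exists u; rewrite inE ?uu // /mu' eqxx eq_sym.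
  apply/fintype.subsetP => v; rewrite !inE /mu'; have [->|vu] := eqVneq v u; first by rewrite uu.
  by have [->|vw] := eqVneq v w; rewrite ?ww.
rewrite negb_exists => /forallP near; pose w := w0.
have ww : mu w = w by []. have wc : col w = ~~ col u by [].
pose Z := graph_ball mu u k :|: graph_ball mu w k.
have [y yc yZ] : exists2 y, col y = ~~ col u & y \notin Z :|: (mu @: Z).
  have cardZ : #|Z :|: (mu @: Z)| <= 4 ^ k.+1.
    have U (A B : {set V}) : #|A :|: B| <= #|A| + #|B| by rewrite cardsU leq_subr.
    have h1 := U (graph_ball mu u k) (graph_ball mu w k); rewrite -/Z in h1.
    have h2 := U Z (mu @: Z); have h3 := leq_imset_card mu Z.
    by have := card_graph_ball mu u k; have := card_graph_ball mu w k; rewrite expnS; lia.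
  have : ~~ ([set v | col v == ~~ col u] \subset Z :|: (mu @: Z)).
    apply/negP => /subset_leq_card; rewrite leqNgt => /negP; apply.
    apply: leq_ltn_trans cardZ _; apply: leq_trans big _.
    case: (col u); last by apply: subset_leq_card; apply/fintype.subsetP => v; rewrite !inE => ->.
    rewrite col_balanced; apply: subset_leq_card; apply/fintype.subsetP => v.
    by rewrite !inE => /negbTE ->.
  by case/fintype.subsetPn => y; rewrite inE => /eqP yc yZ; exists y.
have ymat : mu y != y.
  apply/eqP => yy; have := near y; rewrite yy eqxx yc eqxx /= negbK => yu.
  by move: yZ; rewrite !inE yu.
pose x := mu y; have xy : mu x = y by rewrite /x muK.
have xc : col x = col u by rewrite /x mucol // yc negbK.
have [yZ' xZ'] : y \notin Z /\ x \notin Z.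
  move: yZ; rewrite inE negb_or => /andP[h1 h2]; split=> //.
  by apply: contraNN h2 => xZ; apply/imsetP; exists x.
have wu : w == u = false by apply/eqP => e; move: wc; rewrite e; case: (col u).
have yu : y == u = false by apply/eqP => e; move: yc; rewrite e; case: (col u).
have xw : x == w = false by apply/eqP => e; move: wc; rewrite -e xc; case: (col u).
have xu : x == u = false by apply/eqP => e; move: yu; rewrite -xy e uu eqxx.
have yw : y == w = false by apply/eqP => e; move: ymat; rewrite e ww eqxx.
have yx : x == y = false by apply/eqP => e; move: ymat; rewrite -/x e eqxx.
pose mu' v := if v == u then y else if v == y then u else
  if v == w then x else if v == x then w else mu v.
have mu'u : mu' u = y by rewrite /mu' eqxx.
have mu'y : mu' y = u by rewrite /mu' yu eqxx.
have mu'w : mu' w = x by rewrite /mu' wu eq_sym yw eqxx.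
have mu'x : mu' x = w by rewrite /mu' xu yx xw eqxx.
have mu'v v : v != u -> v != y -> v != w -> v != x -> mu' v = mu v.
  by rewrite /mu' => /negbTE -> /negbTE -> /negbTE -> /negbTE ->.
have mu'K : involutive mu'.
  move=> v; have [->|vu] := eqVneq v u; first by rewrite mu'u.
  have [->|vy] := eqVneq v y; first by rewrite mu'y.
  have [->|vw] := eqVneq v w; first by rewrite mu'w.
  have [->|vx] := eqVneq v x; first by rewrite mu'x.
  rewrite (mu'v v) // mu'v ?muK //.
  - by rewrite -uu (inj_eq (inv_inj muK)).
  - by rewrite -xy (inj_eq (inv_inj muK)).
  - by rewrite -ww (inj_eq (inv_inj muK)).
  - by rewrite /x (inj_eq (inv_inj muK)).
have newE v : (mu' v != v) && (mu' v != mu v) -> [\/ v = u, v = y, v = w | v = x].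
  have [->|vu] := eqVneq v u; first by constructor.
  have [->|vy] := eqVneq v y; first by constructor.
  have [->|vw] := eqVneq v w; first by constructor.
  have [->|vx] := eqVneq v x; first by constructor.
  by rewrite mu'v // eqxx andbF.
exists mu'; split.
- split=> // v; have [->|vu] := eqVneq v u; first by rewrite mu'u yc.
  have [->|vy] := eqVneq v y; first by rewrite mu'y yc negbK.
  have [->|vw] := eqVneq v w; first by rewrite mu'w xc wc negbK.
  have [->|vx] := eqVneq v x; first by rewrite mu'x xc wc.
  by rewrite mu'v //; exact: mucol.
(* Only x and y can serve as [B], since u and w may be close to each other. *)
- apply: (girth_change (B := pred2 x y) muK mu'K gk) => [v /newE[]->|].
  + by rewrite /= mu'u eqxx !orbT.
  + by rewrite /= eqxx orbT.
  + by rewrite /= mu'w eqxx orbT.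
  + by rewrite /= eqxx.
  have far b l s : b \notin Z -> (size s).+2 < k ->
      walk mu b (l :: s) = u \/ walk mu b (l :: s) = w -> False.
    move=> bZ sz h; move: bZ; rewrite inE.
    have sr : size (rev (l :: s)) <= k by rewrite size_rev; exact: ltnW (ltnW sz).
    case: h => h; [have := walk_graph_ball mu u sr|have := walk_graph_ball mu w sr];
      by rewrite -{1}h walk_rev // => ->; rewrite ?orbT.
  (* A short old walk between x and y closes up with the removed edge to a short old cycle. *)
  have close b b' l s : mu b' = b -> b != b' -> nobt (l :: s) -> last l s != c2 ->
      moves mu b (l :: s) -> (size s).+2 < k -> walk mu b (l :: s) = b' -> False.
    move=> bb' nb' nb lc mv sz e; have := gk b ((l :: s) ++ [:: c2]).
    rewrite walk_cat e moves_cat mv e /= cubic_c2 bb' nb' size_cat /=.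
    have n2 : nobt (l :: s ++ [:: c2]).
      by move: nb; rewrite /nobt /= cat_path => -> /=; rewrite lc.
    by move=> /(_ n2 isT isT erefl); rewrite addn1 leqNgt sz.
  move=> b c l s Bb /newE nc nb _ lc mv sz e.
  have self : b = c -> False.
    by move=> bc; have := gk _ _ nb isT mv; rewrite e bc => /(_ erefl) /=; rewrite leqNgt (ltnW sz).
  case/pred2P: Bb => bE; subst b; case: nc => cE; subst c.
  - by apply: (far x l s); [exact: xZ'|exact: sz|left].
  - by apply: (close x y l s) => //; rewrite yx.
  - by apply: (far x l s); [exact: xZ'|exact: sz|right].
  - exact: self.
  - by apply: (far y l s); [exact: yZ'|exact: sz|left].
  - exact: self.
  - by apply: (far y l s); [exact: yZ'|exact: sz|right].
  - by apply: (close y x l s) => //; rewrite eq_sym yx.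
apply/properP; split; last by exists u; rewrite inE ?uu // mu'u yu.
apply/fintype.subsetP => v; rewrite !inE; have [->|vu] := eqVneq v u; first by rewrite uu.
have [->|vy] := eqVneq v y; first by rewrite mu'y eq_sym yu.
have [->|vw] := eqVneq v w; first by rewrite ww.
have [->|vx] := eqVneq v x; first by rewrite mu'x eq_sym xw.
by rewrite mu'v.
Qed.

Lemma matching_exists k : girth_ge id k -> 4 ^ k.+1 < #|[pred v | col v]| ->
  exists mu, [/\ involutive mu, forall v, col (mu v) = ~~ col v & girth_ge mu k].
Proof.
move=> g0 big; suff [mu [[muK mucol] g nf]] : exists mu, [/\ bip_involution mu,
    girth_ge mu k & forall v, mu v != v].
  by exists mu; split=> // v; exact: mucol.
have : exists2 mu, bip_involution mu & girth_ge mu k.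
  by exists id => //; split=> // v; rewrite eqxx.
case=> mu0; have [n] := ubnP #|[set v | mu0 v == v]|.
elim: n => // n IH in mu0 *; rewrite ltnS => le bip g.
have [/existsP[u /eqP uu]|] := boolP [exists u, mu0 u == u]; last first.
  by rewrite negb_exists => /forallP h; exists mu0.
have [mu1 [bip1 g1 /proper_card lt]] := improve bip uu g big.
by apply: IH bip1 g1; exact: leq_trans lt le.
Qed.

End LargeGirth.

(** * A Hamiltonian cycle completed to a cubic graph *)

Section CycleMatching.
Variable n : nat.
Let N := (n.*2).+2.
Local Notation V := 'I_(n.*2).+2.

Definition even_edge (v : V) : V := inord (if odd v then v.-1 else v.+1).
Definition odd_edge (v : V) : V :=
  inord (if odd v then (if v == N.-1 :> nat then 0 else v.+1)
         else (if v == 0 :> nat then N.-1 else v.-1)).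

Lemma even_edgeE (v : V) : even_edge v = (if odd v then v.-1 else v.+1) :> nat.
Proof.
rewrite /even_edge inordK //; case: v => v /= hv; case: ifP => o; first by lia.
have : v != n.*2.+1 by apply: contraFneq o => ->; rewrite /= odd_double.
by lia.
Qed.

Lemma odd_edgeE (v : V) : odd_edge v =
  (if odd v then (if v == N.-1 :> nat then 0 else v.+1)
   else (if v == 0 :> nat then N.-1 else v.-1)) :> nat.
Proof.
rewrite /odd_edge inordK // /N; case: v => v /= hv.
by case: ifP => o; case: ifP => h //; move/negbT: h => h; lia.
Qed.

Lemma odd_even_edge (v : V) : odd (even_edge v) = ~~ odd v.
Proof. by rewrite even_edgeE; case: ifP => o; lia. Qed.

Lemma odd_odd_edge (v : V) : odd (odd_edge v) = ~~ odd v.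
Proof.
rewrite odd_edgeE /N; case: ifP => o; case: ifP => h.
- by [].
- by lia.
- by rewrite /= odd_double.
- by lia.
Qed.

Lemma even_edgeK : involutive even_edge.
Proof.
move=> v; apply: val_inj; rewrite /= even_edgeE odd_even_edge !even_edgeE.
by case: (boolP (odd v)) => o /=; lia.
Qed.

Lemma odd_edgeK : involutive odd_edge.
Proof.
move=> v; apply: val_inj; rewrite /= odd_edgeE odd_odd_edge !odd_edgeE /N.
have hv := ltn_ord v.
case: (boolP (odd v)) => o /=.
  by have [e|h] := eqVneq (v : nat) n.*2.+1; rewrite ?e.
have [e|h] := eqVneq (v : nat) 0; first by rewrite e eqxx.
have e : v.-1.+1 = v by rewrite prednK // lt0n.
case: eqP => [e'|_]; last by rewrite e.
by move: hv; rewrite -e e' /N ltnn.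
Qed.

Lemma balanced : #|[pred v : V | odd v]| = #|[pred v : V | ~~ odd v]|.
Proof.
rewrite -(card_imset _ (inv_inj even_edgeK)); apply: eq_card => v.
apply/imsetP/idP => [[w hw ->]|hv]; first by rewrite !inE odd_even_edge negbK.
exists (even_edge v); rewrite ?even_edgeK // !inE odd_even_edge.
by move: hv; rewrite !inE.
Qed.

Let fwd (v : V) (l : 'I_3) := odd v == (l == 1 :> nat).

(** Without backtracking a walk alternates the two matchings, so it runs round the cycle in one
    direction, which [fwd] reads off from its first letter. *)
Lemma cycle_walk (v : V) (l : 'I_3) t : nobt (l :: t) ->
  moves even_edge odd_edge id v (l :: t) ->
  if fwd v l then walk even_edge odd_edge id v (l :: t) = v + (size t).+1 %[mod N]
  else walk even_edge odd_edge id v (l :: t) + (size t).+1 = v %[mod N].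
Proof.
have step w k : cubic even_edge odd_edge id k w != w -> [/\ k < 2,
    odd (cubic even_edge odd_edge id k w) = ~~ odd w &
    if fwd w k then cubic even_edge odd_edge id k w = w + 1 %[mod N]
    else cubic even_edge odd_edge id k w + 1 = w %[mod N]].
  rewrite /cubic /fwd; case: k => -[|[|k]] hk /=; rewrite ?eqxx // => _; split => //.
  - exact: odd_even_edge.
  - rewrite even_edgeE eqbF_neg; case: (boolP (odd w)) => o /=; last by rewrite addn1.
    by rewrite addn1 prednK // odd_gt0.
  - exact: odd_odd_edge.
  rewrite odd_edgeE eqb_id /N; case: (boolP (odd w)) => o.
    case: eqP => [->|_]; last by rewrite addn1.
    by rewrite addn1 /= modnn mod0n.
  case: eqP => [->|/eqP h]; first by rewrite addn1 /= modnn mod0n.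
  by rewrite addn1 prednK // lt0n.
elim: t v l => [|k t IH] v l.
  by move=> _ /= /andP[/step[_ _ h] _]; move: h; case: ifP.
move=> nb mv0; have /andP[/step[l2 ol h] mv] := mv0.
have lk : l != k by move: nb; rewrite /nobt /= => /andP[].
have nb' : nobt (k :: t) by move: nb; rewrite /nobt /= => /andP[].
have k2 : k < 2 by case/andP: (mv) => /step[].
have := IH _ _ nb' mv.
have -> : fwd (cubic even_edge odd_edge id l v) k = fwd v l.
  rewrite /fwd ol; move: lk; rewrite -val_eqE /=.
  by move: (l : nat) (k : nat) l2 k2 => [|[|?]] [|[|?]] //=; case: (odd v).
have -> : walk even_edge odd_edge id v [:: l, k & t] =
  walk even_edge odd_edge id (cubic even_edge odd_edge id l v) (k :: t) by [].
rewrite [size (k :: t)]/=.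
move: h; case: ifP => _ h1 h2.
  by rewrite h2 -modnDml h1 modnDml -addnA add1n.
by rewrite -h1 -[in RHS]modnDml -h2 modnDml -addnA addn1.
Qed.

Lemma cycle_girth k : k <= N -> girth_ge even_edge odd_edge id k.
Proof.
move=> kN v [//|l t] nb _ mv wv; apply: leq_trans kN _; apply: dvdn_leq => //.
have := cycle_walk nb mv; rewrite wv; case: ifP => _ h.
  have : v + (size t).+1 == v + 0 %[mod N] by rewrite addn0 h.
  by rewrite eqn_modDl mod0n.
have : v + (size t).+1 == v + 0 %[mod N] by rewrite addn0 h.
by rewrite eqn_modDl mod0n.
Qed.

Lemma cycle_matching k : 4 ^ k.+1 <= n -> exists mu : V -> V,
  [/\ involutive mu, forall v, odd (mu v) = ~~ odd v &
   forall v t, nobt t -> t != [::] ->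
     foldr (cubic even_edge odd_edge mu) v t = v -> k <= size t].
Proof.
move=> big.
have card_odd : #|[pred v : V | odd v]| = n.+1.
  have := cardC [pred v : V | odd v].
  have -> : #|predC [pred v : V | odd v]| = #|[pred v : V | ~~ odd v]|.
    by apply: eq_card => v; rewrite !inE.
  by rewrite -balanced card_ord addnn => /(congr1 half); rewrite !doubleK /= doubleK.
have kN : k <= N.
  have : k < 4 ^ k by exact: ltn_expl.
  by move: big; rewrite expnS /N; lia.
have [|mu [muK muodd g]] := matching_exists even_edgeK odd_edgeK balanced (cycle_girth kN).
  by rewrite card_odd ltnS.
exists mu; split=> // v t nt t0 fx; rewrite -(size_rev t).
have w : walk even_edge odd_edge mu v (rev t) = v by rewrite /walk foldl_rev.
apply: g w; rewrite ?nobt_rev // -?size_eq0 ?size_rev ?size_eq0 //.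
move: {nt t0 fx} (rev t) => s; elim: s v => //= l s IH v; rewrite IH andbT.
apply/eqP => /(congr1 (fun v : V => odd v)); rewrite /cubic.
case: ifP => _; first by rewrite odd_even_edge; case: (odd v).
by case: ifP => _; rewrite ?odd_odd_edge ?muodd; case: (odd v).
Qed.

End CycleMatching.

(** * The surface relation in the reflection group *)

Section NormalForm.
Local Open Scope group_scope.
Variables (V : eqType) (mu : V -> V).
Hypothesis muK : involutive mu.
Hypothesis mu_nfix : forall i, mu i != i.

Definition commp (K : groupType) (p : K * K) : K := p.1 * p.2 * p.1^-1 * p.2^-1.
Definition cprod (K : groupType) (l : seq (K * K)) : K :=
  foldr (fun p k => commp p * k) 1 l.
Definition wprod (K : groupType) (w : V -> K) (s : seq V) : K :=
  foldr (fun i k => w i * k) 1 s.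

Lemma cprod_cat (K : groupType) (l l' : seq (K * K)) : cprod (l ++ l') = cprod l * cprod l'.
Proof. by elim: l => [|p l IH] /=; rewrite ?mul1g // IH mulgA. Qed.

Lemma wprod_cat (K : groupType) (w : V -> K) s s' :
  wprod w (s ++ s') = wprod w s * wprod w s'.
Proof. by elim: s => [|p l IH] /=; rewrite ?mul1g // IH mulgA. Qed.

(* Collects the pair of letters w_i and w_(mu i) = y^-1 w_i^-1 y of a word
   w_i U w_(mu i) W into the commutator [w_i, U y^-1], leaving the word U W. *)
Fixpoint collect (K : groupType) (k : nat) (s : seq V) (w y : V -> K) : seq (K * K) :=
  match k, s with
  | k'.+1, i :: s' =>
      let U := take (index (mu i) s') s' in
      let W := drop (index (mu i) s').+1 s' in
      (w i, wprod w U * (y i)^-1) :: collect k' (U ++ W) w y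
  | _, _ => [::]
  end.

Definition paired (s : seq V) : Prop := uniq s /\ {in s, forall i, mu i \in s}.

Lemma paired_split i s : paired (i :: s) ->
  exists U W, [/\ take (index (mu i) s) s = U, drop (index (mu i) s).+1 s = W,
    s = U ++ mu i :: W, paired (U ++ W) & i \notin U ++ W /\ mu i \notin U ++ W].
Proof.
case=> /= /andP[iS us] cl.
have ms : mu i \in s by have := cl i (mem_head _ _); rewrite inE (negbTE (mu_nfix i)).
have [U [W e]] : exists U W, s = U ++ mu i :: W.
  by case/splitPr: ms => U W; exists U, W.
have mU : mu i \notin U.
  by move: us; rewrite e cat_uniq /= => /and3P[_]; rewrite negb_or => /andP[].
have ix : index (mu i) s = size U by rewrite e index_cat (negbTE mU) /= eqxx addn0.
have mW : mu i \notin W by move: us; rewrite e cat_uniq /= => /and4P[].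
have iUW : i \notin U ++ W.
  by move: iS; rewrite e !mem_cat !inE !negb_or => /and3P[-> _ ->].
have eU : take (size U) s = U by rewrite e take_size_cat.
have eW : drop (size U).+1 s = W.
  by rewrite e -cat_rcons drop_size_cat // size_rcons.
exists U, W; rewrite ix; split=> //; last by split=> //; rewrite mem_cat negb_or mU mW.
split.
  move: us; rewrite e !cat_uniq /= => /and4P[-> h1 _ ->]; rewrite andbT.
  by move: h1; rewrite negb_or => /andP[].
move=> j jUW; have js : j \in s by move: jUW; rewrite e !mem_cat inE => /orP[->|->]; rewrite ?orbT.
have := cl j; rewrite inE js orbT => /(_ isT); rewrite inE e mem_cat inE => /or4P[|jU||jW].
- by move=> /eqP mj; move: mW mU jUW; rewrite -mj muK mem_cat => /negbTE -> /negbTE ->.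
- by rewrite mem_cat jU.
- move=> /eqP mj; move: iUW; rewrite -(inv_inj muK mj) jUW //.
- by rewrite mem_cat jW orbT.
Qed.

(** Two boundary curves glued along an edge of the third matching: they are conjugate by y up to
    orientation. *)
Definition conj_pair (K : groupType) (w y : V -> K) (i : V) : Prop :=
  w (mu i) = (y i)^-1 * (w i)^-1 * y i /\ y (mu i) = (y i)^-1.

Lemma collect_prod (K : groupType) (w y : V -> K) k s : (size s <= k)%N -> paired s ->
  {in s, forall i, conj_pair w y i} -> cprod (collect k s w y) = wprod w s.
Proof.
elim: k s => [|k IH] [|i s] // sk ps cp.
have [U [W [eU eW es pUW _]]] := paired_split ps.
rewrite /= eU eW IH //; last 2 first.
- move: sk; rewrite /= es !size_cat /= addnS ltnS => /ltnW //.
- move=> j jUW; apply: cp; rewrite inE es mem_cat inE.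
  by move: jUW; rewrite mem_cat => /orP[->|->]; rewrite ?orbT.
rewrite es !wprod_cat /= (cp i (mem_head _ _)).1 /commp /= invgM invgK.
by rewrite !mulgA mulgVK.
Qed.

Lemma collect_ext (K : groupType) (w y w' y' : V -> K) k s : paired s ->
  {in s, w =1 w'} -> {in s, y =1 y'} -> collect k s w y = collect k s w' y'.
Proof.
elim: k s => [|k IH] [|i s] // ps hw hy.
have [U [W [eU eW es pUW _]]] := paired_split ps.
have sub : {subset U ++ W <= i :: s}.
  move=> j jUW; rewrite inE es mem_cat inE.
  by move: jUW; rewrite mem_cat => /orP[->|->]; rewrite ?orbT.
rewrite /= eU eW (IH (U ++ W)) //; try by move=> j /sub; [exact: hw|exact: hy].
- rewrite hw ?mem_head // hy ?mem_head //; congr ((_, _ * _) :: _).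
  have : {in U, w =1 w'} by move=> j jU; apply/hw/sub; rewrite mem_cat jU.
  elim: U {eU es sub pUW} => //= j U IHU h; rewrite h ?mem_head // IHU // => j' j'U.
  by apply: h; rewrite inE j'U orbT.
- by move=> j /sub; exact: hw.
- by move=> j /sub; exact: hy.
Qed.

(** [collect] is an invertible change of generators: the first commutator determines w and y at i
    once the remaining letters are known by induction. *)
Lemma collect_onto (G : groupType) k s (l : seq (G * G)) : paired s ->
  (size s <= k)%N -> (size l).*2 = size s -> exists w y : V -> G,
    {in s, forall i, conj_pair w y i} /\ collect k s w y = l.
Proof.
elim: k s l => [|k IH] [|i s] [|[a b] l] //; try by exists (fun=> 1), (fun=> 1).
move=> ps sk sl; have [U [W [eU eW es pUW [iUW mUW]]]] := paired_split ps.
have [||w [y [cp cl]]] := IH (U ++ W) l pUW.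
- by move: sk; rewrite /= es !size_cat /= addnS ltnS => /ltnW.
- by move: sl; rewrite /= es !size_cat /= addnS => -[].
pose z := b^-1 * wprod w U.
pose y' j := if j == i then z else if j == mu i then z^-1 else y j.
pose w' j := if j == i then a else if j == mu i then z^-1 * a^-1 * z else w j.
have ww' : {in U ++ W, w' =1 w}.
  move=> j jU; rewrite /w'; have [ji|_] := eqVneq j i; first by move: iUW; rewrite -ji jU.
  by have [ji|//] := eqVneq j (mu i); move: mUW; rewrite -ji jU.
have yy' : {in U ++ W, y' =1 y}.
  move=> j jU; rewrite /y'; have [ji|_] := eqVneq j i; first by move: iUW; rewrite -ji jU.
  by have [ji|//] := eqVneq j (mu i); move: mUW; rewrite -ji jU.
have w'i : w' i = a by rewrite /w' eqxx.
have y'i : y' i = z by rewrite /y' eqxx.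
have w'm : w' (mu i) = z^-1 * a^-1 * z by rewrite /w' (negbTE (mu_nfix i)) eqxx.
have y'm : y' (mu i) = z^-1 by rewrite /y' (negbTE (mu_nfix i)) eqxx.
exists w', y'; split.
  move=> j; rewrite inE es mem_cat inE => h; rewrite /conj_pair.
  have [->|ji] := eqVneq j i; first by rewrite w'i y'i w'm y'm.
  have [->|jm] := eqVneq j (mu i).
    rewrite muK w'i y'i w'm y'm; split; last by rewrite invgK.
    by move: z {y' w' ww' yy' w'i y'i w'm y'm} => z; rewrite !invgM !invgK mulVKg mulgK.
  have jUW : j \in U ++ W.
    by move: h; rewrite (negbTE ji) (negbTE jm) /= mem_cat.
  have mj : mu j \in U ++ W by exact: pUW.2.
  by rewrite !ww' // !yy' //; exact: cp.
rewrite /= eU eW w'i y'i (collect_ext _ _ ww' yy') // cl.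
have -> : wprod w' U = wprod w U.
  have : {in U, w' =1 w} by move=> j jU; apply: ww'; rewrite mem_cat jU.
  elim: (U) => //= j U' IHU h; rewrite h ?mem_head // IHU // => j' j'U.
  by apply: h; rewrite inE j'U orbT.
by rewrite /z invgM invgK mulVKg.
Qed.

(** [collect] is made of group operations only, so it transports a compatible relation from the
    pants generators to the commutator pairs. *)
Lemma collect_rel (K G : groupType) (C : K -> G -> Prop) :
  C 1 1 -> (forall a b a' b', C a b -> C a' b' -> C (a * a') (b * b')) ->
  (forall a b, C a b -> C a^-1 b^-1) ->
  forall k s (w y : V -> K) (w' y' : V -> G),
  (forall i, C (w i) (w' i)) -> (forall i, C (y i) (y' i)) ->
  forall j, C (nth (1, 1) (collect k s w y) j).1 (nth (1, 1) (collect k s w' y') j).1 /\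
            C (nth (1, 1) (collect k s w y) j).2 (nth (1, 1) (collect k s w' y') j).2.
Proof.
move=> C1 CM CV; elim=> [|k IH] [|i s] w y w' y' hw hy [|j] //=.
  split=> //; apply: (CM); last exact: CV.
  by elim: (take _ _) => //= i' U IHU; exact: CM.
exact: IH.
Qed.

Lemma size_collect (K : groupType) (w y : V -> K) k s : paired s -> (size s <= k)%N ->
  (size (collect k s w y)).*2 = size s.
Proof.
elim: k s => [|k IH] [|i s] // ps sk.
have [U [W [eU eW es pUW _]]] := paired_split ps.
rewrite /= eU eW doubleS IH //; first by rewrite es !size_cat /= addnS.
by move: sk; rewrite /= es !size_cat /= addnS ltnS => /ltnW.
Qed.

End NormalForm.

(** * The labelled square complex *)

Section Labels.
Local Open Scope group_scope.
Variables (n : nat) (mu : 'I_(n.*2).+2 -> 'I_(n.*2).+2).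
Local Notation V := 'I_(n.*2).+2.
Let N := (n.*2).+2.
Hypothesis muK : involutive mu.
Hypothesis mu_odd : forall v, odd (mu v) = ~~ odd v.
Variables (G : groupType) (w y : V -> G) (u0 yc : G).
Hypothesis wy : forall i, conj_pair mu w y i.
Hypothesis tot : wprod w (enum 'I_N) * commp (yc, u0) = 1.

Definition eps := cubic (@even_edge n) (@odd_edge n) mu.

Lemma epsK l : involutive (eps l).
Proof. by apply: cubicK => //; [exact: even_edgeK|exact: odd_edgeK]. Qed.

Let c0 : 'I_3 := @Ordinal 3 0 isT.
Let c1 : 'I_3 := @Ordinal 3 1 isT.
Let c2 : 'I_3 := @Ordinal 3 2 isT.

Lemma ord3P (l : 'I_3) : [\/ l = c0, l = c1 | l = c2].
Proof.
by case: l => -[|[|[|]]] // h; [constructor 1|constructor 2|constructor 3]; apply: val_inj.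
Qed.

(** Cut along the third cuffs, the pairs of pants form a ring: a torus with N holes, with boundary
    loops w and with yc running round the ring. These are the loops along the successive cuffs of
    the ring, and [ulabS] is the relation of one pair of pants. *)
Definition ulab (j : nat) : G := wprod w (drop j (enum 'I_N)) * (yc * u0 * yc^-1).

Lemma ulabS (v : V) : ulab v = w v * ulab v.+1.
Proof.
have e : drop v (enum 'I_N) = v :: drop v.+1 (enum 'I_N).
  by rewrite (drop_nth v) ?size_enum_ord ?ltn_ord // nth_ord_enum.
by rewrite /ulab e [RHS]mulgA.
Qed.

Lemma ulab_last : ulab N = yc * u0 * yc^-1.
Proof. by rewrite /ulab drop_oversize ?size_enum_ord //= mul1g. Qed.

Lemma ulab0 : ulab 0 = u0.
Proof.
rewrite /ulab drop0; apply: (mulIg u0^-1); rewrite mulgV -[RHS]tot /commp /=.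
by rewrite !mulgA.
Qed.

(* Labels, read along the edges of the dual square complex: [xlab v i] goes from
   the front to the back of the pair of pants v through the seam i, [ylab v l]
   from v to its neighbour across the cuff l, on the front. *)
Definition xlab (v : V) (i : 'I_3) : G :=
  if i == c2 then 1 else if (i == c1) == odd v then ulab v else ulab v.+1.

Definition ylab (v : V) (l : 'I_3) : G :=
  if l == c2 then y v else if l == c0 then 1 else
  if v == N.-1 :> nat then yc else if v == 0%N :> nat then yc^-1 else 1.

Definition adj_seam (l : 'I_3) : 'I_3 := if l == c2 then c0 else c2.

(** The label on the back is forced by the square at one adjacent seam. That the square at the other
    seam also commutes is the content of [xlab_even_edge], [xlab_odd_edge] and [xlab_mu]. *)
Definition yback (v : V) (l : 'I_3) : G :=
  (xlab v (adj_seam l))^-1 * ylab v l * xlab (eps l v) (adj_seam l).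

Lemma xlab_even_edge v : xlab v c1 = xlab (even_edge v) c1.
Proof.
rewrite /xlab odd_even_edge even_edgeE.
by case: (boolP (odd v)) => o //=; rewrite prednK // odd_gt0.
Qed.

Lemma xlab_odd_edge v : xlab v c0 * ylab v c1 = ylab v c1 * xlab (odd_edge v) c0.
Proof.
rewrite /xlab /ylab odd_odd_edge odd_edgeE.
case: (boolP (odd v)) => o /=.
  have [e|ne] := eqVneq (v : nat) N.-1.
    by rewrite {1}e -/N ulab_last ulab0 mulgVK.
  by rewrite (gtn_eqF (odd_gt0 o)) mulg1 mul1g.
have nN : (v == N.-1 :> nat) = false.
  by apply/eqP => e; move: o; rewrite e /= odd_double.
rewrite nN; have [e|ne] := eqVneq (v : nat) 0%N.
  by rewrite e ulab0 -/N ulab_last !mulgA mulVg mul1g.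
by rewrite mulg1 mul1g prednK // lt0n.
Qed.

(** The quotient of the two seam labels is the boundary loop or its inverse, according to parity;
    [mu] reverses the parity and, by [conj_pair], also the loop. *)
Lemma xlab_mu v :
  xlab v c1 * (xlab v c0)^-1 * y v = y v * (xlab (mu v) c1 * (xlab (mu v) c0)^-1).
Proof.
have h v' : xlab v' c1 * (xlab v' c0)^-1 = if odd v' then w v' else (w v')^-1.
  rewrite /xlab /=; case: (odd v') => /=; rewrite ulabS ?mulgK //.
  by rewrite invgM mulgA mulgV mul1g.
rewrite !h mu_odd (wy v).1; case: (odd v) => /=; last by rewrite !mulgA mulgV mul1g.
by rewrite !invgM !invgK !mulgA mulgV mul1g.
Qed.

Lemma ylab_eps v l : ylab (eps l v) l = (ylab v l)^-1.
Proof.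
case: (ord3P l) => ->; rewrite /ylab /eps /cubic /=; last exact: (wy v).2.
  by rewrite invg1.
rewrite odd_edgeE; case: (boolP (odd v)) => o.
  have [e|ne] := eqVneq (v : nat) N.-1; first by [].
  rewrite (gtn_eqF (odd_gt0 o)) /= invg1.
  case: ifP => // /eqP e; move: o; have := odd_double n.
  by move: e; rewrite /N /= => -[->] ->.
have nN : (v == N.-1 :> nat) = false.
  by apply/eqP => e; move: o; rewrite e /= odd_double.
rewrite nN; have [e|ne] := eqVneq (v : nat) 0%N; first by rewrite -/N eqxx invgK.
have lt := ltn_ord v; have v0 : (0 < v)%N by rewrite lt0n.
case: ifP => [/eqP e|_]; first by move: lt; rewrite -(prednK v0) e /N /= ltnn.
case: ifP => [/eqP e|_]; last by rewrite invg1.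
by move: o; rewrite -(prednK v0) e.
Qed.

Lemma xlab_yback v i l : i != l -> xlab v i * yback v l = ylab v l * xlab (eps l v) i.
Proof.
rewrite /yback; have x2 v' : xlab v' c2 = 1 by [].
case: (ord3P l) => ->; case: (ord3P i) => -> // _; rewrite /adj_seam /= ?x2.
- by rewrite invg1 /ylab /= ?mulg1 ?mul1g; exact: xlab_even_edge.
- by rewrite invg1 ?mulg1 ?mul1g.
- by rewrite invg1 ?mulg1 ?mul1g; exact: xlab_odd_edge.
- by rewrite invg1 ?mulg1 ?mul1g.
- by rewrite !mulgA mulgV mul1g.
- rewrite mulgA mulgA; have := xlab_mu v; rewrite -[ylab v c2]/(y v) => ->.
  by rewrite -[eps c2 v]/(mu v) -!mulgA mulVg mulg1.
Qed.

Definition ell (g : letter) (s : V * bool) : G :=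
  if g.1 then (if s.2 then (xlab s.1 g.2)^-1 else xlab s.1 g.2)
  else (if s.2 then (ylab s.1 g.2)^-1 else (yback s.1 g.2)^-1).

(** Skew product of the permutation action with left multiplication by labels. Since it satisfies
    the relations of the reflection group, a word trivial there has trivial label; this gives
    injectivity. *)
Definition lab_map (g : letter) (t : (V * bool) * G) : (V * bool) * G :=
  (side_map eps g t.1, ell g t.1 * t.2).

Lemma yback_eps v l : yback (eps l v) l = (yback v l)^-1.
Proof. by rewrite /yback ylab_eps epsK !invgM invgK mulgA. Qed.

Lemma lab_mapK g : involutive (lab_map g).
Proof.
case=> s a; rewrite /lab_map /= (side_mapK epsK) mulgA; congr (_, _).
suff -> : ell g (side_map eps g s) * ell g s = 1 by rewrite mul1g.
case: g s => [[] l] [v []]; rewrite /ell /side_map /= ?mulgV ?mulVg //.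
  by rewrite ylab_eps invgK mulgV.
by rewrite yback_eps invgK mulgV.
Qed.

Definition lab_gen g : bijection ((V * bool) * G) := involution_bij (lab_mapK g).

Lemma ell_comm i l s : i != l ->
  ell (true, i) (side_map eps (false, l) s) * ell (false, l) s =
  ell (false, l) (side_map eps (true, i) s) * ell (true, i) s.
Proof.
move=> il; case: s => v []; rewrite /ell /side_map /=.
  by apply: invg_inj; rewrite !invgM !invgK; symmetry; exact: xlab_yback.
apply: (mulIg (yback v l)); rewrite mulgVK; apply: (mulgI (ylab v l)).
by rewrite -!mulgA mulVKg -xlab_yback.
Qed.

Lemma lab_rep : racg_rep lab_gen.
Proof.
split=> [g|g h]; first by apply: bijection_eq => t; exact: lab_mapK.
move=> gh; apply: bijection_eq => -[s a]; rewrite !bijME /= /lab_map /=.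
case: g h gh => [[] i] [[] l]; rewrite /adj //= => il.
  by rewrite !mulgA ell_comm.
by rewrite !mulgA -ell_comm // eq_sym.
Qed.

Local Notation lw := (evw lab_gen).

Lemma lw_cat u v t : lw (u ++ v) t = lw u (lw v t).
Proof. by rewrite evw_cat. Qed.

Lemma lw_cons g u t : lw (g :: u) t = lab_map g (lw u t).
Proof. by []. Qed.

Lemma lab_cover u t : (lw u t).1 = evw (side_gen epsK) u t.1.
Proof. by elim: u => [//|g u IH]; rewrite !bijME /= IH. Qed.

Lemma lab_equivariant u s a : lw u (s, a) = ((lw u (s, 1)).1, (lw u (s, 1)).2 * a).
Proof.
elim: u => [|g u IH]; first by rewrite /= mul1g.
by rewrite !bijME IH /= /lab_map /= mulgA.
Qed.

Let v0 : V := ord0.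
Let base : V * bool := (v0, true).

(** The ring without its closing edge is a path with trivial labels. The last letter of a word acts
    first, so [rev (pth v)] leads from the base to v. *)
Definition pth (j : nat) : seq letter :=
  mkseq (fun k => (false, if odd k then c1 else c0)) j.

Lemma pthS j : pth j.+1 = rcons (pth j) (false, if odd j then c1 else c0).
Proof. by rewrite /pth mkseqS. Qed.

Lemma lab_path (v : V) a : lw (rev (pth v)) (base, a) = ((v, true), a).
Proof.
have : (v < N)%N by [].
have [j e] : exists j : nat, j = v by exists v.
rewrite -e => jN; have -> : v = inord j by apply: val_inj; rewrite /= e inordK.
elim: j jN {e} => [|j IH] jN.
  by congr (_, _, _); apply: val_inj; rewrite /= inordK.
have jN' := ltnW jN; rewrite pthS rev_rcons.
rewrite lw_cons IH // /lab_map /side_map /ell /=.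
have ej : (inord j : V) = j :> nat by rewrite inordK.
case: (boolP (odd j)) => o.
  rewrite /ylab /= ej (gtn_eqF (odd_gt0 o)) ifF; last first.
    by apply/eqP => e; move: jN; rewrite e ltnn.
  rewrite invg1 mul1g; congr (_, _, _); apply: val_inj.
  rewrite /= odd_edgeE ej o ifF ?inordK //.
  by apply/eqP => e; move: jN; rewrite e ltnn.
rewrite /ylab /= invg1 mul1g; congr (_, _, _); apply: val_inj.
by rewrite /= even_edgeE ej (negbTE o) inordK.
Qed.

Lemma lab_pathV (v : V) a : lw (pth v) ((v, true), a) = (base, a).
Proof.
by rewrite -(lab_path v a) evw_rev ?bijKV //; exact: lab_rep.
Qed.

Definition sa (v : V) : 'I_3 := if odd v then c1 else c0.
Definition sb (v : V) : 'I_3 := if odd v then c0 else c1.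

Definition w_word (v : V) : seq letter := pth v ++ [:: (true, sa v); (true, sb v)] ++ rev (pth v).
Definition y_word (v : V) : seq letter := pth v ++ (false, c2) :: rev (pth (mu v)).
Definition u_word : seq letter := [:: (true, c0); (true, c2)].
Definition yc_word : seq letter := pth N.-1 ++ [:: (false, c1)].

Lemma lab_w_word v : lw (w_word v) (base, 1) = (base, w v).
Proof.
rewrite /w_word !lw_cat lab_path.
have -> : lw [:: (true, sa v); (true, sb v)] ((v, true), 1) = ((v, true), w v).
  rewrite !lw_cons /lab_map /side_map /ell /=; congr (_, _).
  by rewrite /xlab /sa /sb; case: (odd v) => /=; rewrite mulg1 ulabS mulgK.
exact: lab_pathV.
Qed.

Lemma lab_y_word v : lw (y_word v) (base, 1) = (base, y v).
Proof.
rewrite /y_word lw_cat lw_cons lab_path /lab_map /side_map /ell /= /eps /cubic /= muK mulg1.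
by rewrite -[ylab _ _]/(y (mu v)) (wy v).2 invgK lab_pathV.
Qed.

Lemma lab_u_word : lw u_word (base, 1) = (base, u0).
Proof.
rewrite /u_word !lw_cons /lab_map /side_map /ell /=; congr (_, _).
by rewrite /xlab /= ulab0 invg1 !mulg1.
Qed.

Lemma lab_yc_word : lw yc_word (base, 1) = (base, yc).
Proof.
have e : eps c1 v0 = inord N.-1 :> V.
  by apply: val_inj; rewrite /eps [LHS]odd_edgeE /= inordK.
have e' : lw [:: (false, c1)] (base, 1) = ((inord N.-1, true), yc).
  by rewrite lw_cons /lab_map /side_map /ell -e /= mulg1 invgK.
have f : (inord N.-1 : V) = N.-1 :> nat by rewrite inordK.
by rewrite /yc_word lw_cat e' -[in pth _]f lab_pathV.
Qed.

Section Geometric.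
Variables (K : groupType) (gen : letter -> K).
Hypothesis gen_rep : racg_rep gen.
Local Notation kw := (evw gen).

Let sK g : gen g * gen g = 1. Proof. by case: gen_rep => ->. Qed.
Let sV g : (gen g)^-1 = gen g. Proof. by apply: (mulIg (gen g)); rewrite mulVg sK. Qed.
Let pV j : kw (rev (pth j)) = (kw (pth j))^-1. Proof. exact: evw_rev. Qed.
Let comm i l : i != l -> gen (true, i) * gen (false, l) = gen (false, l) * gen (true, i).
Proof. by move=> il; case: gen_rep => _; apply; rewrite /adj. Qed.

Let conjc i k l : i != l -> k != l ->
  gen (false, l) * (gen (true, i) * gen (true, k)) * gen (false, l) =
  gen (true, i) * gen (true, k).
Proof. by move=> il kl; rewrite mulgA -comm // -!mulgA (mulgA (gen (false, l))) -comm // -mulgA sK mulg1. Qed.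

Let wE u : kw (w_word u) = kw (pth u) * (gen (true, sa u) * gen (true, sb u)) * (kw (pth u))^-1.
Proof. by rewrite /w_word !evw_cat pV /= mulg1 !mulgA. Qed.

(** The seams used by [w_word] commute with the third cuff, and [mu] exchanges their order by
    changing parity. *)
Lemma geo_pair (v : V) : conj_pair mu (fun v => kw (w_word v)) (fun v => kw (y_word v)) v.
Proof.
have yE u : kw (y_word u) = kw (pth u) * gen (false, c2) * (kw (pth (mu u)))^-1.
  by rewrite /y_word evw_cat /= pV mulgA.
split; last by rewrite !yE muK !invgM invgK sV mulgA.
have -> : (kw (w_word v))^-1 = kw (pth v) * (gen (true, sb v) * gen (true, sa v)) * (kw (pth v))^-1.
  by rewrite wE !invgM !invgK !sV !mulgA.
rewrite wE yE !invgM !invgK sV.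
move: (kw (pth v)) (kw (pth (mu v))) => p q.
have -> : gen (true, sa (mu v)) * gen (true, sb (mu v)) = gen (true, sb v) * gen (true, sa v).
  by rewrite /sa /sb mu_odd; case: (odd v).
rewrite -[in LHS](@conjc _ _ c2); try by rewrite /sa /sb; case: (odd v).
move: (gen _ * gen (true, _)) (gen (false, c2)) => a b.
by rewrite !mulgA !mulgVK.
Qed.

Let aj j : 'I_3 := if odd j then c1 else c0.
Let UK j := kw (pth j) * (gen (true, aj j) * gen (true, c2)) * (kw (pth j))^-1.

Let UKS (v : V) : kw (w_word v) = UK v * (UK v.+1)^-1.
Proof.
have -> : UK v.+1 = kw (pth v) * (gen (true, sb v) * gen (true, c2)) * (kw (pth v))^-1.
  rewrite /UK pthS -cats1 evw_cat /= mulg1 invgM sV.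
  rewrite -[in RHS](@conjc (sb v) c2 (if odd v then c1 else c0)); first last.
  - by case: (odd v).
  - by rewrite /sb; case: (odd v).
  by rewrite /aj /sb /=; case: (odd v); rewrite /= !mulgA.
rewrite wE /UK !invgM !invgK !sV !mulgA mulgVK; congr (_ * _).
by rewrite -[in RHS](mulgA _ (gen (true, c2)) (gen (true, c2))) sK mulg1.
Qed.

(** The product telescopes by [UKS]; what remains is [u_word] times the inverse of its conjugate by
    [yc_word]. *)
Lemma geo_tot :
  wprod (fun v => kw (w_word v)) (enum 'I_N) * commp (kw yc_word, kw u_word) = 1.
Proof.
have tele j : (j <= N)%N ->
    wprod (fun v => kw (w_word v)) (drop (N - j) (enum 'I_N)) = UK (N - j) * (UK N)^-1.
  elim: j => [|j IH] jN.
    by rewrite subn0 drop_oversize ?size_enum_ord //= mulgV.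
  have lt : (N - j.+1 < N)%N by rewrite ltn_subrL.
  have e : (N - j.+1).+1 = (N - j)%N by rewrite subnSK.
  rewrite (drop_nth (Ordinal lt)) ?size_enum_ord //.
  have -> : nth (Ordinal lt) (enum 'I_N) (N - j.+1) = Ordinal lt.
    by apply: val_inj; rewrite /= nth_enum_ord.
  have h := UKS (Ordinal lt); rewrite [nat_of_ord _]/(N - j.+1)%N e in h.
  by rewrite -[LHS]/(kw (w_word (Ordinal lt)) * wprod _ (drop _ _)) e (IH (ltnW jN)) h mulgA mulgVK.
have := tele N (leqnn N); rewrite subnn drop0 => ->.
have -> : UK 0 = kw u_word by rewrite /UK /= !mulg1 mul1g invg1 mulg1.
have -> : UK N = kw yc_word * kw u_word * (kw yc_word)^-1.
  rewrite /UK -[N]/(N.-1.+1) pthS -cats1 /yc_word /u_word.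
  have -> : odd N.-1 by rewrite /= odd_double.
  have -> : aj N.-1.+1 = c0 by rewrite /aj /= odd_double.
  by rewrite /= mulg1.
rewrite /commp /=; set U := kw u_word; set Y := kw yc_word.
by move: (Y * U * Y^-1) => A; rewrite mulgA mulgVK mulgV.
Qed.

End Geometric.

Definition lifts (K : groupType) (gen : letter -> K) (k : K) (a : G) : Prop :=
  exists u, evw gen u = k /\ lw u (base, 1) = (base, a).

Lemma lifts1 (K : groupType) (gen : letter -> K) : lifts gen 1 1.
Proof. by exists [::]. Qed.

Lemma liftsM (K : groupType) (gen : letter -> K) k a k' a' :
  lifts gen k a -> lifts gen k' a' -> lifts gen (k * k') (a * a').
Proof.
case=> u [<- hu] [u' [<- hu']]; exists (u ++ u'); rewrite evw_cat; split=> //.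
by rewrite lw_cat hu' lab_equivariant hu.
Qed.

Lemma liftsV (K : groupType) (gen : letter -> K) k a : racg_rep gen ->
  lifts gen k a -> lifts gen k^-1 a^-1.
Proof.
move=> rep [u [<- hu]]; exists (rev u); rewrite evw_rev //; split=> //.
have h : lw u (base, a^-1) = (base, 1) by rewrite lab_equivariant hu /= mulgV.
by rewrite evw_rev ?h -?h ?bijVK //; exact: lab_rep.
Qed.

End Labels.

Local Open Scope ring_scope.

(* [C k a] says that some word of the reflection group evaluates to k in K and
   leads from the base chamber of the labelled square complex back to itself,
   with label a. *)
Theorem isometry_realization (R : realType) (n : nat) (G : groupType) (l : seq (G * G)) :
  (4 ^ (30 * 2 ^ 12).+1 <= n)%N -> size l = n.+2 -> cprod l = 1%g ->
  exists (L : seq (bijection (hplane R) * bijection (hplane R)))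
         (C : bijection (hplane R) -> G -> Prop),
   [/\ cprod L = 1%g /\ size L = n.+2,
       [/\ C 1%g 1%g, (forall k a k' a', C k a -> C k' a' -> C (k * k')%g (a * a')%g) &
         forall k a, C k a -> C k^-1%g a^-1%g],
       forall j, (j < n.+2)%N -> C (nth (1, 1)%g L j).1 (nth (1, 1)%g l j).1 /\
             C (nth (1, 1)%g L j).2 (nth (1, 1)%g l j).2,
       forall k a, C k a -> forall p q, hdist (k p) (k q) = hdist p q &
       forall k a, C k a -> (k = 1%g -> a = 1%g) /\
         (k <> 1%g -> forall p, 30 <= hdist p (k p))].
Proof.
move=> big sl pl; have [mu [muK mu_odd girth]] := cycle_matching big.
have mu_nfix v : mu v != v by apply/eqP => e; have := mu_odd v; rewrite e; case: odd.
have [gen [grep giso gfaith gdisp]] := hexagon_group R.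
have {big girth}gdisp := gdisp _ (eps mu) (epsK muK) girth.
pose V := 'I_(n.*2).+2; pose s := enum V.
have ps : paired mu s by split; [exact: enum_uniq|move=> i _; rewrite mem_enum].
have ss : size s = (n.*2).+2 by rewrite size_enum_ord.
have sk : (size s <= (n.*2).+2)%N by rewrite ss.
(* The last pair becomes (yc, u0), the handle of the ring; the other n + 1 pairs come from the 2n +
   2 boundary loops. *)
have [l' [[yc u0] el]] : exists l' p, l = rcons l' p.
  by case/lastP: l sl {pl} => // l' p _; exists l', p.
have sl' : (size l').*2 = size s by move: sl; rewrite ss el size_rcons => -[->].
have [w [y [cp cl]]] := collect_onto muK mu_nfix ps sk sl'.
have wy i : conj_pair mu w y i by apply: cp; rewrite mem_enum.
have tot : (wprod w s * commp (yc, u0) = 1)%g.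
  move: pl; rewrite el -cats1 cprod_cat -cl (collect_prod muK mu_nfix sk ps cp) /=.
  by rewrite mulg1.
pose wK (v : V) := evw gen (w_word v); pose yK v := evw gen (y_word mu v).
pose L' := collect mu (n.*2).+2 s wK yK.
pose q := (evw gen (yc_word n), evw gen u_word).
pose C := lifts muK u0 yc wy gen.
have hw v : C (wK v) (w v) by exists (w_word v); split=> //; exact: lab_w_word.
have hy v : C (yK v) (y v) by exists (y_word mu v); split=> //; exact: lab_y_word.
have C1 : C 1%g 1%g by exact: lifts1.
have CM k a k' a' : C k a -> C k' a' -> C (k * k')%g (a * a')%g by exact: liftsM.
have CV k a : C k a -> C k^-1%g a^-1%g by exact: liftsV.
have sL' : size L' = n.+1.
  by apply: double_inj; rewrite (size_collect muK mu_nfix _ _ ps sk) ss.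
exists (rcons L' q), C; split=> //.
- split; last by rewrite size_rcons sL'.
  rewrite -cats1 cprod_cat (collect_prod muK mu_nfix sk ps); last first.
    by move=> i _; exact: geo_pair.
  by rewrite /= mulg1; exact: geo_tot.
- move=> j jn; rewrite el !nth_rcons sL'.
  have -> : size l' = n.+1 by apply: double_inj; rewrite sl' ss.
  case: ltngtP => jn'; last first.
  + split; [exists (yc_word n)|exists u_word]; split=> //; first exact: lab_yc_word.
    exact: lab_u_word.
  + by move: jn; rewrite ltnS leqNgt jn'.
  rewrite -cl. have := @collect_rel V mu _ _ C C1 CM CV (n.*2).+2 s wK yK w y hw hy j. by [].
- by move=> k a [u [<- _]] p r; exact: giso.
move=> k a [u [<- hu]]; split=> [e|ne].
  (* A word that is trivial as an isometry is trivial in the reflection group, so it acts trivially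
     on the labels too. *)
  have := gfaith _ e _ (lab_gen muK u0 yc wy) (lab_rep muK mu_odd wy tot).
  by move=> e'; move: hu; rewrite e' => -[].
move=> p; apply: gdisp.
- by exists (ord0, true); rewrite -(lab_cover muK u0 yc wy u (_, 1%g)) hu.
- by move=> e; apply: ne; exact: e.
Qed.

(** * Homotopy of paths *)

Local Open Scope classical_set_scope.
Local Open Scope ring_scope.

Section Contw.

Definition contw (T U : topologicalType) (A : set T) (f : T -> U) : Prop :=
  forall x, A x -> f @ within A (nbhs x) --> f x.

Lemma contwP (T U : topologicalType) (A : set T) (f : T -> U) :
  {within A, continuous f} <-> contw A f.
Proof. exact: subspace_continuousP. Qed.

Lemma continuous_contw (T U : topologicalType) (A : set T) (f : T -> U) :
  continuous f -> contw A f.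
Proof.
move=> cf x _ O /cf /= h; rewrite /within /=; apply: (@filterS _ (nbhs x)) h.
by move=> y Oy _.
Qed.

Lemma contw_comp (T U V : topologicalType) (A : set T) (B : set U) (f : T -> U) (g : U -> V) :
  contw A f -> (forall x, A x -> B (f x)) -> contw B g -> contw A (g \o f).
Proof.
move=> cf AB cg x Ax O /(cg _ (AB x Ax)) h; have := cf x Ax _ h.
rewrite /within /=; apply: (@filterS _ (nbhs x)) => y h' Ay; apply: h' => //.
exact: AB.
Qed.

Lemma contw_sub (T U : topologicalType) (A B : set T) (f : T -> U) :
  A `<=` B -> contw B f -> contw A f.
Proof.
move=> AB cf x Ax O /(cf x (AB x Ax)); rewrite /within /=.
by apply: (@filterS _ (nbhs x)) => y h /AB.
Qed.

Lemma contw_eq (T U : topologicalType) (A : set T) (f g : T -> U) :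
  (forall x, A x -> f x = g x) -> contw A f -> contw A g.
Proof.
move=> fg cf x Ax O; rewrite -fg // => /(cf x Ax); rewrite /within /=.
by apply: (@filterS _ (nbhs x)) => y h Ay; have := h Ay; rewrite /= fg.
Qed.

Lemma contw_glue (R : realType) (T U : topologicalType) (A : set T) (f : T -> U)
    (h : T -> R) (c : R) : continuous h ->
  contw (A `&` [set x | h x <= c]) f -> contw (A `&` [set x | c <= h x]) f -> contw A f.
Proof.
move=> ch cl cr x Ax O Of.
have hl : \forall y \near x, A y -> h y <= c -> O (f y).
  have [hx|hx] := leP (h x) c.
    have := cl x (conj Ax hx) O Of; rewrite /within /=.
    by apply: (@filterS _ (nbhs x)) => y k Ay hy; apply: k.
  have : \forall y \near x, c < h y by apply: (cvgr_gt (h x)) => //; exact: ch.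
  by apply: (@filterS _ (nbhs x)) => y k _; rewrite leNgt k.
have hr : \forall y \near x, A y -> c <= h y -> O (f y).
  have [hx|hx] := leP c (h x).
    have := cr x (conj Ax hx) O Of; rewrite /within /=.
    by apply: (@filterS _ (nbhs x)) => y k Ay hy; apply: k.
  have : \forall y \near x, h y < c by apply: (cvgr_lt (h x)) => //; exact: ch.
  by apply: (@filterS _ (nbhs x)) => y k _; rewrite leNgt k.
rewrite /within /=; apply: (@filterS2 _ (nbhs x) _ _ _ _ _ hl hr) => y k k' Ay.
by have [/ltW|] := ltP (h y) c; [exact: k|exact: k'].
Qed.

Lemma contw_pair (T U V : topologicalType) (A : set T) (f : T -> U) (g : T -> V) :
  contw A f -> contw A g -> contw A (fun x => (f x, g x)).
Proof. by move=> cf cg x Ax; apply: cvg_pair; [exact: cf|exact: cg]. Qed.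

End Contw.

Section ContwReal.
Variables (R : realType) (T : topologicalType) (A : set T).
Implicit Types f g : T -> R.

Lemma contw_cst (U : topologicalType) (c : U) : contw A (fun=> c).
Proof. by move=> x _; exact: cvg_cst. Qed.

Lemma contwD f g : contw A f -> contw A g -> contw A (fun x => f x + g x).
Proof. by move=> cf cg x Ax; apply: cvgD; [exact: cf|exact: cg]. Qed.

Lemma contwB f g : contw A f -> contw A g -> contw A (fun x => f x - g x).
Proof. by move=> cf cg x Ax; apply: cvgB; [exact: cf|exact: cg]. Qed.

Lemma contwM f g : contw A f -> contw A g -> contw A (fun x => f x * g x).
Proof. by move=> cf cg x Ax; apply: cvgM; [exact: cf|exact: cg]. Qed.

Lemma contw_min f g : contw A f -> contw A g -> contw A (fun x => Order.min (f x) (g x)).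
Proof.
move=> cf cg; apply: (@contw_comp _ _ _ A setT (fun x => (f x, g x))
  (fun xy : R * R => Order.min xy.1 xy.2)) => //; first exact: contw_pair.
exact/continuous_contw/min_continuous.
Qed.

Lemma contw_max f g : contw A f -> contw A g -> contw A (fun x => Order.max (f x) (g x)).
Proof.
move=> cf cg; apply: (@contw_comp _ _ _ A setT (fun x => (f x, g x))
  (fun xy : R * R => Order.max xy.1 xy.2)) => //; first exact: contw_pair.
exact/continuous_contw/max_continuous.
Qed.

End ContwReal.

Lemma contw_id (T : topologicalType) (A : set T) : contw A (fun x => x).
Proof. by apply: continuous_contw => x. Qed.

Lemma contw_fst (T U : topologicalType) (A : set (T * U)) : contw A fst.
Proof. by apply: continuous_contw => x; exact: cvg_fst. Qed.

Lemma contw_snd (T U : topologicalType) (A : set (T * U)) : contw A snd.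
Proof. by apply: continuous_contw => x; exact: cvg_snd. Qed.

Lemma contw_comp_fst (T U V : topologicalType) (A : set T) (h : T -> U * V) :
  contw A h -> contw A (fun x => (h x).1).
Proof. by move=> ch; exact: (contw_comp ch (B := setT) (fun _ _ => I) (@contw_fst _ _ _)). Qed.

Lemma contw_comp_snd (T U V : topologicalType) (A : set T) (h : T -> U * V) :
  contw A h -> contw A (fun x => (h x).2).
Proof. by move=> ch; exact: (contw_comp ch (B := setT) (fun _ _ => I) (@contw_snd _ _ _)). Qed.

Ltac cont_lin := repeat match goal with
  | |- contw _ (fun x => (@?f x, @?g x)) => apply: (@contw_pair _ _ _ _ f g)
  | |- contw _ fst => exact: contw_fst
  | |- contw _ snd => exact: contw_snd
  | |- contw _ (fun x => x) => exact: contw_id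
  | |- contw _ (fun x => ?c) => exact: contw_cst
  | |- contw _ (fun x => (fst x)) => exact: contw_fst
  | |- contw _ (fun x => (snd x)) => exact: contw_snd
  | |- contw _ (fun x => @?f x - @?g x) => apply: (@contwB _ _ _ f g)
  | |- contw _ (fun x => @?f x + @?g x) => apply: (@contwD _ _ _ f g)
  | |- contw _ (fun x => @?f x * @?g x) => apply: (@contwM _ _ _ f g)
  | |- contw _ (fun x => Order.min (@?f x) (@?g x)) => apply: (@contw_min _ _ _ f g)
  | |- contw _ (fun x => Order.max (@?f x) (@?g x)) => apply: (@contw_max _ _ _ f g)
  end.

Section Homotopy.
Variable R : realType.

Definition unit_itv : set R := [set t | 0 <= t <= 1].
Definition unit_square : set (R * R) := [set z | unit_itv z.1 /\ unit_itv z.2].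
Local Notation uI := unit_itv.
Local Notation sq := unit_square.

Lemma uI0 : uI 0. Proof. by rewrite /uI /=; lra. Qed.
Lemma uI1 : uI 1. Proof. by rewrite /uI /=; lra. Qed.
Lemma uIC t : uI t -> uI (1 - t). Proof. by rewrite /uI /=; lra. Qed.

Section Space.
Variable S : topologicalType.
Implicit Types al be ga : R -> S.

Lemma contw_cat2 (H1 H2 : R * R -> S) : contw sq H1 -> contw sq H2 ->
  (forall s, uI s -> H1 (s, 1) = H2 (s, 0)) ->
  contw sq (fun z => loop_cat (fun t => H1 (z.1, t)) (fun t => H2 (z.1, t)) z.2).
Proof.
move=> c1 c2 h; apply: (@contw_glue R _ _ _ _ snd (2^-1)).
- by move=> x; exact: cvg_snd.
- apply: (@contw_eq _ _ _ (H1 \o (fun z => (z.1, 2 * z.2)))).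
    by move=> [s t] /= [_]; rewrite /loop_cat => ->.
  apply: (contw_comp (B := sq)) => //.
    apply: contw_pair; first exact: contw_fst.
    by apply: contwM; [exact: contw_cst|exact: contw_snd].
  move=> [s t] [[/= us ut] th]; split=> //=; move: ut; rewrite /uI /=.
  by move: th; rewrite /=; lra.
apply: (@contw_eq _ _ _ (H2 \o (fun z => (z.1, 2 * z.2 - 1)))).
  move=> [s t] /= [[/= us ut] th]; rewrite /loop_cat; case: ifP => // t'.
  have -> : t = 2^-1 by apply/eqP; rewrite eq_le t' th.
  by rewrite mulfV ?subrr ?h // pnatr_eq0.
apply: (contw_comp (B := sq)) => //.
  apply: contw_pair; first exact: contw_fst.
  apply: contwB; last exact: contw_cst.
  by apply: contwM; [exact: contw_cst|exact: contw_snd].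
move=> [s t] [[/= us ut] th]; split=> //=; move: ut; rewrite /uI /=.
by move: th; rewrite /=; lra.
Qed.

Lemma contw_cat al be : contw uI al -> contw uI be -> al 1 = be 0 ->
  contw uI (loop_cat al be).
Proof.
move=> ca cb h.
have := @contw_cat2 (al \o snd) (be \o snd).
move=> /(_ _ _ (fun _ _ => h)) H.
apply: (@contw_comp _ _ _ _ sq (fun t : R => (0 : R, t)) _ _ _ (H _ _)).
- by apply: contw_pair; [exact: contw_cst|exact: contw_id].
- by move=> t ut; split=> //=; exact: uI0.
- by apply: contw_comp ca; [exact: contw_snd|move=> x []].
- by apply: contw_comp cb; [exact: contw_snd|move=> x []].
Qed.

Lemma cat0 al be : loop_cat al be 0 = al 0.
Proof. by rewrite /loop_cat mulr0 ifT //; lra. Qed.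

Lemma cat1 al be : loop_cat al be 1 = be 1.
Proof. by rewrite /loop_cat ifF; [congr be; lra|apply/negbTE; rewrite -ltNge; lra]. Qed.

Definition phom al be : Prop := exists H : R * R -> S,
  [/\ contw sq H, forall t, uI t -> H (0, t) = al t /\ H (1, t) = be t &
      forall s, uI s -> H (s, 0) = al 0 /\ H (s, 1) = al 1].

Lemma phom_ends al be : phom al be -> be 0 = al 0 /\ be 1 = al 1.
Proof.
case=> H [_ h1 h2]; split.
  by rewrite -(h1 0 uI0).2 (h2 1 uI1).1.
by rewrite -(h1 1 uI1).2 (h2 1 uI1).2.
Qed.

Lemma phom_sym al be : phom al be -> phom be al.
Proof.
move=> ab; have [e0 e1] := phom_ends ab; case: ab => H [cH h1 h2].
exists (H \o (fun z => (1 - z.1, z.2))); split.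
- apply: contw_comp cH; last by move=> [s t] [us ut]; split=> //; exact: uIC.
  apply: contw_pair; last exact: contw_snd.
  by apply: contwB; [exact: contw_cst|exact: contw_fst].
- by move=> t ut /=; rewrite subr0 subrr (h1 t ut).1 (h1 t ut).2.
- by move=> s us /=; rewrite e0 e1; exact: h2 (uIC us).
Qed.

Lemma phom_trans be al ga : phom al be -> phom be ga -> phom al ga.
Proof.
move=> ab bc; have [e0 e1] := phom_ends ab.
case: ab bc => H [cH h1 h2] [H' [cH' h1' h2']].
pose sw (z : R * R) := (z.2, z.1).
have csw : contw sq sw by apply: contw_pair; [exact: contw_snd|exact: contw_fst].
have sws z : sq z -> sq (sw z) by case.
exists ((fun z => loop_cat (fun t => (H \o sw) (z.1, t)) (fun t => (H' \o sw) (z.1, t)) z.2) \o sw).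
split.
- apply: (contw_comp csw sws); apply: contw_cat2.
  + exact: contw_comp csw sws cH.
  + exact: contw_comp csw sws cH'.
  + by move=> s us; rewrite /= (h1 s us).2 (h1' s us).1.
- by move=> t ut /=; rewrite cat0 cat1 (h1 t ut).1 (h1' t ut).2.
- move=> s us; rewrite /= /loop_cat.
  have [s2|s2] := leP s (2^-1).
    by apply: h2; move: us; rewrite /uI /=; lra.
  by rewrite -e0 -e1; apply: h2'; move: us; rewrite /uI /=; lra.
Qed.

Lemma phom_refl al : contw uI al -> phom al al.
Proof.
move=> ca; exists (al \o snd); split=> //.
by apply: contw_comp ca; [exact: contw_snd|move=> x []].
Qed.

Lemma phom_cat al al' be be' : al 1 = be 0 -> phom al al' -> phom be be' ->
  phom (loop_cat al be) (loop_cat al' be').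
Proof.
move=> e [H [cH h1 h2]] [H' [cH' h1' h2']].
exists (fun z => loop_cat (fun t => H (z.1, t)) (fun t => H' (z.1, t)) z.2); split.
- by apply: contw_cat2 => // s us; rewrite (h2 s us).2 (h2' s us).1.
- move=> t ut /=; rewrite /loop_cat; case: ifP => t2.
    by apply: h1; move: ut t2; rewrite /uI /=; lra.
  by apply: h1'; move: ut (negbT t2); rewrite /uI /= -ltNge; lra.
- by move=> s us /=; rewrite !cat0 !cat1; split; [exact: (h2 s us).1|exact: (h2' s us).2].
Qed.

Definition convex2 (X : set (R * R)) : Prop := forall u v s, X u -> X v -> uI s ->
  X ((1 - s) * u.1 + s * v.1, (1 - s) * u.2 + s * v.2).

(** The straight-line homotopy in X, pushed forward by f. *)
Lemma phom_convex (X : set (R * R)) (f : R * R -> S) (p q : R -> R * R) :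
  convex2 X -> contw X f -> contw uI p -> contw uI q ->
  (forall t, uI t -> X (p t)) -> (forall t, uI t -> X (q t)) ->
  p 0 = q 0 -> p 1 = q 1 -> phom (f \o p) (f \o q).
Proof.
move=> cX cf cp cq Xp Xq e0 e1.
pose m z := ((1 - z.1) * (p z.2).1 + z.1 * (q z.2).1,
             (1 - z.1) * (p z.2).2 + z.1 * (q z.2).2).
have cs : contw sq (fun z : R * R => 1 - z.1).
  by apply: contwB; [exact: contw_cst|exact: contw_fst].
have co (p' : R -> R * R) : contw uI p' -> contw sq (fun z => (p' z.2).1) /\
    contw sq (fun z => (p' z.2).2).
  move=> cp'; have h : contw sq (p' \o snd).
    by apply: contw_comp cp'; [exact: contw_snd|move=> x []].
  by split; [exact: (contw_comp_fst h)|exact: (contw_comp_snd h)].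
exists (f \o m); split.
- apply: contw_comp cf; last first.
    by move=> [s t] [/= us ut]; apply: cX => //; [exact: Xp|exact: Xq].
  have [p1 p2] := co _ cp; have [q1 q2] := co _ cq.
  have c1 := @contw_fst R R sq.
  by apply: contw_pair; apply: contwD; apply: contwM.
- move=> t ut; rewrite /m /= subr0 subrr !mul0r !mul1r !add0r !addr0.
  by rewrite -!surjective_pairing.
- move=> s us; rewrite /m /= -e0 -e1.
  have mm (u : R * R) : ((1 - s) * u.1 + s * u.1, (1 - s) * u.2 + s * u.2) = u.
    by case: u => a b /=; congr (_, _); ring.
  by rewrite !mm.
Qed.

Lemma phom_reparam al (p q : R -> R) : contw uI al -> contw uI p -> contw uI q ->
  (forall t, uI t -> uI (p t)) -> (forall t, uI t -> uI (q t)) ->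
  p 0 = q 0 -> p 1 = q 1 -> phom (al \o p) (al \o q).
Proof.
move=> ca cp cq up uq e0 e1.
have := @phom_convex [set u | uI u.1] (al \o fst) (fun t => (p t, 0)) (fun t => (q t, 0)).
apply=> //.
- by move=> u v s; rewrite /uI /= => ? ? ?; nra.
- by apply: contw_comp ca; [exact: contw_fst|].
- by apply: contw_pair => //; exact: contw_cst.
- by apply: contw_pair => //; exact: contw_cst.
- by move=> /=; rewrite e0.
- by move=> /=; rewrite e1.
Qed.

Lemma phom_eq al be : contw uI al -> (forall t, uI t -> al t = be t) -> phom al be.
Proof.
move=> ca ab; exists (al \o snd); split=> //.
  by apply: contw_comp ca; [exact: contw_snd|move=> x []].
by move=> t ut /=; rewrite ab.
Qed.

Lemma phom_assoc al be ga : contw uI al -> contw uI be -> contw uI ga ->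
  al 1 = be 0 -> be 1 = ga 0 ->
  phom (loop_cat (loop_cat al be) ga) (loop_cat al (loop_cat be ga)).
Proof.
move=> ca cb cc e1 e2.
have cbc := contw_cat cb cc e2.
have e1' : al 1 = loop_cat be ga 0 by rewrite cat0.
have call := contw_cat ca cbc e1'.
pose p (t : R) := Order.min (Order.min (2 * t) (t + 4^-1)) ((t + 1) / 2).
have p1 t : t <= 4^-1 -> p t = 2 * t.
  by move=> h; rewrite /p (@min_l _ _ (2 * t)) ?min_l //; lra.
have p2 t : 4^-1 <= t <= 2^-1 -> p t = t + 4^-1.
  by move=> h; rewrite /p (@min_r _ _ (2 * t)) ?min_l //; lra.
have p3 t : 2^-1 <= t -> p t = (t + 1) / 2.
  by move=> h; rewrite /p (@min_r _ _ (2 * t)) ?min_r //; lra.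
have cp : contw uI p by rewrite /p; cont_lin.
have up t : uI t -> uI (p t).
  rewrite /uI /= => ut; have [h|h] := leP t 4^-1; first by rewrite p1 //; lra.
  by have [h'|h'] := leP t 2^-1; [rewrite p2; lra|rewrite p3; lra].
have p0 : p 0 = 0 by rewrite p1; lra.
have p11 : p 1 = 1 by rewrite p3; lra.
clearbody p.
apply: (@phom_trans (loop_cat al (loop_cat be ga) \o p)); last first.
  by apply: (phom_reparam (q := fun t => t) call cp _ up) => //; exact: contw_id.
apply/phom_sym/phom_eq; first exact: (contw_comp (B := uI)).
move=> t ut /=; rewrite /loop_cat; move: ut; rewrite /uI /= => ut.
have [t2|t2] := leP t 2^-1; last first.
  rewrite (p3 t (ltW t2)) ifF; last by apply/negbTE; rewrite -ltNge; lra.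
  by rewrite ifF; [congr ga; lra|apply/negbTE; rewrite -ltNge; lra].
have [t4|t4] := leP (2 * t) 2^-1.
  by rewrite p1; [rewrite ifT; [congr al; lra|lra]|lra].
rewrite p2; last by lra.
rewrite ifF; last by apply/negbTE; rewrite -ltNge; lra.
by rewrite ifT; [congr be; lra|lra].
Qed.

Lemma phom_cat1 al x : contw uI al -> al 1 = x -> phom (loop_cat al (fun=> x)) al.
Proof.
move=> ca e.
pose p (t : R) := Order.min (2 * t) 1.
apply: (@phom_trans (al \o p)).
  apply: phom_eq; first by apply: contw_cat => //; exact: contw_cst.
  move=> t; rewrite /uI /= /loop_cat /p => ut.
  by have [t2|t2] := leP t 2^-1; [rewrite min_l //; lra|rewrite min_r -?e //; lra].
have cp : contw uI p by rewrite /p; cont_lin.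
have up t : uI t -> uI (p t) by rewrite /uI /p /=; case: (leP (2 * t) 1); lra.
have p0 : p 0 = 0 by rewrite /p min_l //; lra.
have p1 : p 1 = 1 by rewrite /p min_r //; lra.
clearbody p.
by apply: (phom_reparam (q := fun t => t) ca cp _ up) => //; exact: contw_id.
Qed.

Lemma phom_1cat al x : contw uI al -> al 0 = x -> phom (loop_cat (fun=> x) al) al.
Proof.
move=> ca e.
pose p (t : R) := Order.max (2 * t - 1) 0.
apply: (@phom_trans (al \o p)).
  apply: phom_eq; first by apply: contw_cat => //; exact: contw_cst.
  move=> t; rewrite /uI /= /loop_cat /p => ut.
  by have [t2|t2] := leP t 2^-1; [rewrite max_r -?e //; lra|rewrite max_l //; lra].
have cp : contw uI p by rewrite /p; cont_lin.
have up t : uI t -> uI (p t) by rewrite /uI /p /=; case: (leP (2 * t - 1) 0); lra.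
have p0 : p 0 = 0 by rewrite /p max_r //; lra.
have p1 : p 1 = 1 by rewrite /p max_l //; lra.
clearbody p.
by apply: (phom_reparam (q := fun t => t) ca cp _ up) => //; exact: contw_id.
Qed.

End Space.
End Homotopy.

(** * Classes of paths and of lifts *)

Section PathClass.
Variables (R : realType) (S : topologicalType) (s0 : S) (G : groupType).
Variable cls : (R -> S) -> G.
Hypothesis cls_hom : forall f h, is_loop s0 f -> is_loop s0 h ->
  (cls f = cls h <-> loop_homotopic s0 f h).
Hypothesis cls_cat : forall f h, is_loop s0 f -> is_loop s0 h ->
  cls (loop_cat f h) = (cls f * cls h)%g.
Variables (Q : set (R * R)) (f : R * R -> S) (rep : S -> R * R).
Hypothesis convQ : convex2 Q.
Hypothesis cf : contw Q f.
Hypothesis repQ : forall x, Q (rep x).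
Hypothesis repK : forall x, f (rep x) = x.
Implicit Types al be : R -> S.

Local Notation uI := (@unit_itv R).
Local Notation sq := (@unit_square R).
Local Notation z0 := (rep s0).

Lemma is_loopP al : is_loop s0 al <-> [/\ contw uI al, al 0 = s0 & al 1 = s0].
Proof.
have h : [set` `[(0 : R), 1]] = uI.
  by apply/seteqP; split=> t /=; rewrite in_itv.
by rewrite /is_loop h; split=> -[/contwP ? ? ?].
Qed.

Lemma cls_phom al be : contw uI al -> contw uI be -> al 0 = s0 -> al 1 = s0 ->
  phom al be -> cls al = cls be.
Proof.
move=> ca cb a0 a1 ab; have [b0 b1] := phom_ends ab.
rewrite cls_hom; last 2 first.
- exact/is_loopP.
- by apply/is_loopP; rewrite b0 b1.
case: ab => H [cH h1 h2]; exists H; split.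
- apply/contwP; apply: contw_sub cH => -[s t] [/=]; rewrite !in_itv /= => us ut.
  by split.
- by move=> t; rewrite in_itv /= => ut; exact: h1.
- by move=> s; rewrite in_itv /= -{1}a0 -a1 => us; exact: h2.
Qed.

Definition seg (u v : R * R) (t : R) : R * R :=
  ((1 - t) * u.1 + t * v.1, (1 - t) * u.2 + t * v.2).

Lemma seg0 u v : seg u v 0 = u.
Proof. by case: u => a b; rewrite /seg /=; congr (_, _); ring. Qed.

Lemma seg1 u v : seg u v 1 = v.
Proof. by case: v => a b; rewrite /seg /=; congr (_, _); ring. Qed.

Lemma contw_seg (A : set R) u v : contw A (seg u v).
Proof. rewrite /seg; cont_lin. Qed.

Lemma seg_Q u v t : Q u -> Q v -> uI t -> Q (seg u v t).
Proof. exact: convQ. Qed.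

Definition Qpath (p : R -> R * R) : Prop := contw uI p /\ forall t, uI t -> Q (p t).

Lemma Qpath_seg u v : Q u -> Q v -> Qpath (seg u v).
Proof. by move=> Qu Qv; split; [exact: contw_seg|move=> t; exact: seg_Q]. Qed.

Lemma contw_Qpath p : Qpath p -> contw uI (f \o p).
Proof. by case=> cp Qp; exact: contw_comp cp Qp cf. Qed.

Lemma cat_comp (p q : R -> R * R) : loop_cat (f \o p) (f \o q) = f \o loop_cat p q.
Proof. by apply: funext => t; rewrite /loop_cat /=; case: ifP. Qed.

Lemma Qpath_cat p q : Qpath p -> Qpath q -> p 1 = q 0 -> Qpath (loop_cat p q).
Proof.
move=> [cp Qp] [cq Qq] e; split; first exact: contw_cat.
move=> t; rewrite /loop_cat /uI /= => ut; case: ifP => h.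
  by apply: Qp; rewrite /uI /=; move: h; lra.
by apply: Qq; rewrite /uI /=; move/negbT: h; rewrite -ltNge; lra.
Qed.

Lemma phom_Qpath p q : Qpath p -> Qpath q -> p 0 = q 0 -> p 1 = q 1 ->
  phom (f \o p) (f \o q).
Proof. by move=> [cp Qp] [cq Qq]; exact: phom_convex convQ cf cp cq Qp Qq. Qed.

Definition fseg u v : R -> S := f \o seg u v.

Lemma contw_fseg u v : Q u -> Q v -> contw uI (fseg u v).
Proof. by move=> Qu Qv; exact/contw_Qpath/Qpath_seg. Qed.

Definition tail0 x := fseg z0 (rep x).
Definition tail1 x := fseg (rep x) z0.

Lemma tail0_0 x : tail0 x 0 = s0. Proof. by rewrite /tail0 /fseg /= seg0 repK. Qed.
Lemma tail0_1 x : tail0 x 1 = x. Proof. by rewrite /tail0 /fseg /= seg1 repK. Qed.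
Lemma tail1_0 x : tail1 x 0 = x. Proof. by rewrite /tail1 /fseg /= seg0 repK. Qed.
Lemma tail1_1 x : tail1 x 1 = s0. Proof. by rewrite /tail1 /fseg /= seg1 repK. Qed.

Lemma contw_tail0 x : contw uI (tail0 x). Proof. exact: contw_fseg. Qed.
Lemma contw_tail1 x : contw uI (tail1 x). Proof. exact: contw_fseg. Qed.

Lemma tails x : phom (loop_cat (tail1 x) (tail0 x)) (fun=> x).
Proof.
rewrite /tail1 /tail0 /fseg cat_comp.
have -> : (fun=> x) = f \o (fun _ : R => rep x) by apply: funext => t /=; rewrite repK.
apply: phom_Qpath.
- by apply: Qpath_cat; [exact: Qpath_seg|exact: Qpath_seg|rewrite seg0 seg1].
- by split=> [|t _]; [exact: contw_cst|exact: repQ].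
- by rewrite cat0 seg0.
- by rewrite cat1 seg1.
Qed.

Hint Resolve contw_tail0 contw_tail1 contw_cat : core.

Ltac path_side := first [assumption | exact: contw_tail0 | exact: contw_tail1
  | exact: contw_cst
  | apply: contw_cat; path_side
  | (rewrite ?cat0 ?cat1 ?tail0_0 ?tail0_1 ?tail1_0 ?tail1_1 //; congruence) ].

(* Class of a path, closed up through the images of the segments from the base
   point to the chosen lifts of its ends. *)
Definition pc al : G := cls (loop_cat (loop_cat (tail0 (al 0)) al) (tail1 (al 1))).

Lemma pc_phom al be : contw uI al -> contw uI be -> phom al be -> pc al = pc be.
Proof.
move=> ca cb ab; have [e0 e1] := phom_ends ab.
rewrite /pc; apply: cls_phom; try path_side.
rewrite e0 e1; apply: phom_cat; first path_side.
  by apply: phom_cat => //; [path_side|apply: phom_refl].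
exact: phom_refl.
Qed.

Lemma pc_cat al be : contw uI al -> contw uI be -> al 1 = be 0 ->
  pc (loop_cat al be) = (pc al * pc be)%g.
Proof.
move=> ca cb e; rewrite /pc cat0 cat1 -cls_cat; last 2 first.
- apply/is_loopP; split; path_side.
- apply/is_loopP; split; path_side.
set A := tail0 (al 0); set B := tail1 (al 1); set A' := tail0 (be 0); set C := tail1 (be 1).
have cA : contw uI A by exact: contw_tail0. have cB : contw uI B by exact: contw_tail1.
have cA' : contw uI A' by exact: contw_tail0. have cC : contw uI C by exact: contw_tail1.
have A1 : A 1 = al 0 by exact: tail0_1.
have B0 : B 0 = al 1 by exact: tail1_0.
have B1 : B 1 = s0 by exact: tail1_1.
have A'0 : A' 0 = s0 by exact: tail0_0.
have A'1 : A' 1 = be 0 by exact: tail0_1.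
have C0 : C 0 = be 1 by exact: tail1_0.
have BA' : phom (loop_cat B A') (fun=> al 1) by rewrite /B /A' -e; exact: tails.
apply/esym; apply: cls_phom; try path_side.
- by rewrite !cat0; exact: tail0_0.
- by rewrite !cat1; exact: tail1_1.
clearbody A B A' C.
apply: (phom_trans (be := loop_cat (loop_cat A al) (loop_cat B (loop_cat (loop_cat A' be) C)))).
  by apply: phom_assoc; path_side.
apply: (phom_trans (be := loop_cat (loop_cat A al) (loop_cat be C))); last first.
  apply: (phom_trans (be := loop_cat (loop_cat (loop_cat A al) be) C)).
    by apply: phom_sym; apply: phom_assoc; path_side.
  apply: phom_cat; [path_side| |exact: phom_refl].
  by apply: phom_assoc; path_side.
apply: phom_cat; [path_side|apply: phom_refl; path_side|].
apply: (phom_trans (be := loop_cat B (loop_cat A' (loop_cat be C)))).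
  apply: phom_cat; [path_side|exact: phom_refl|].
  by apply: phom_assoc; path_side.
apply: (phom_trans (be := loop_cat (loop_cat B A') (loop_cat be C))).
  by apply: phom_sym; apply: phom_assoc; path_side.
apply: (phom_trans (be := loop_cat (fun=> al 1) (loop_cat be C))).
  apply: phom_cat => //; first path_side.
  by apply: phom_refl; path_side.
by apply: phom_1cat; path_side.
Qed.

(** The path and its two tails lift together to a loop in Q, which contracts by convexity. *)
Lemma pc_lift p : Qpath p -> p 0 = rep (f (p 0)) -> p 1 = rep (f (p 1)) -> pc (f \o p) = 1%g.
Proof.
move=> Qp e0 e1.
have cls1 : cls (fun=> s0) = 1%g.
  apply: (mulgI (cls (fun=> s0))); rewrite mulg1 -cls_cat; last 2 first.
  - by apply/is_loopP; split=> //; exact: contw_cst.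
  - by apply/is_loopP; split=> //; exact: contw_cst.
  congr cls; by apply: funext => t; rewrite /loop_cat; case: ifP.
rewrite -cls1 /pc /= /tail0 /tail1 /fseg -e0 -e1 !cat_comp.
have -> : (fun=> s0) = f \o (fun _ : R => z0) by apply: funext => t /=; rewrite repK.
have Q0 : Q (p 0) by apply: Qp.2; exact: uI0.
have Q1 : Q (p 1) by apply: Qp.2; exact: uI1.
have Qc : Qpath (loop_cat (loop_cat (seg z0 (p 0)) p) (seg (p 1) z0)).
  apply: Qpath_cat; [|exact: Qpath_seg|by rewrite cat1 seg0].
  by apply: Qpath_cat => //; [exact: Qpath_seg|rewrite seg1].
have Qz : Qpath (fun=> z0) by split=> [|t _]; [exact: contw_cst|exact: repQ].
apply: cls_phom.
- exact: contw_Qpath.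
- exact: contw_Qpath.
- by rewrite /= !cat0 seg0 repK.
- by rewrite /= !cat1 seg1 repK.
by apply: phom_Qpath => //; rewrite ?cat0 ?cat1 ?seg0 ?seg1.
Qed.

Lemma pc_const x : pc (fun=> x) = 1%g.
Proof.
have -> : (fun=> x) = f \o (fun _ : R => rep x) by apply: funext => t /=; rewrite repK.
apply: pc_lift; rewrite ?repK //.
by split=> [|t _]; [exact: contw_cst|exact: repQ].
Qed.

Lemma pc_loop al : is_loop s0 al -> pc al = cls al.
Proof.
move=> /is_loopP[ca a0 a1]; rewrite /pc a0 a1.
have t0 : tail0 s0 = fun=> s0.
  apply: funext => t; rewrite /tail0 /fseg /= -[RHS]repK; congr f; rewrite /seg.
  by case: (z0) => a b /=; congr (_, _); ring.
have t1 : tail1 s0 = fun=> s0 by exact: t0.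
rewrite t0 t1; apply: cls_phom => //.
- by apply: contw_cat; [apply: contw_cat => //; exact: contw_cst|exact: contw_cst|rewrite cat1].
- by rewrite !cat0.
- by rewrite !cat1.
apply: phom_trans (phom_1cat ca a0).
by apply: phom_cat1; [apply: contw_cat => //; exact: contw_cst|rewrite cat1].
Qed.

(** Measures in the group how the lift u differs from the chosen lift of the same point; [rep] may
    well be discontinuous. *)
Definition lift_class (u : R * R) : G := pc (fseg (rep (f u)) u).

Lemma pc_Qpath p : Qpath p -> pc (f \o p) = ((lift_class (p 0%R))^-1 * lift_class (p 1%R))%g.
Proof.
move=> Qp.
have Q0 : Q (p 0) by apply: Qp.2; exact: uI0.
have Q1 : Q (p 1) by apply: Qp.2; exact: uI1.
have back u : Q u -> (lift_class u * pc (fseg u (rep (f u))) = 1)%g.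
  move=> Qu; rewrite -pc_cat; try exact: contw_fseg; last by rewrite /fseg /= seg0 seg1.
  rewrite /fseg cat_comp pc_lift //.
  - by apply: Qpath_cat; [exact: Qpath_seg|exact: Qpath_seg|rewrite seg0 seg1].
  - by rewrite cat0 seg0 repK.
  - by rewrite cat1 seg1 repK.
apply: (mulgI (lift_class (p 0))); rewrite mulVKg.
apply: (mulIg (pc (fseg (p 1) (rep (f (p 1)))))); rewrite back //.
have c1 : contw uI (fseg (rep (f (p 0))) (p 0)) by exact: contw_fseg.
have c2 : contw uI (fseg (p 1) (rep (f (p 1)))) by exact: contw_fseg.
have c3 := contw_Qpath Qp.
have e1 : fseg (rep (f (p 0))) (p 0) 1 = (f \o p) 0 by rewrite /fseg /= seg1.
have e2 : loop_cat (fseg (rep (f (p 0))) (p 0)) (f \o p) 1 = fseg (p 1) (rep (f (p 1))) 0.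
  by rewrite cat1 /fseg /= seg0.
rewrite -(pc_cat c1 c3 e1) -(pc_cat (contw_cat c1 c3 e1) c2 e2).
rewrite /fseg !cat_comp pc_lift //.
- apply: Qpath_cat; [|exact: Qpath_seg|by rewrite cat1 seg0].
  by apply: Qpath_cat => //; [exact: Qpath_seg|rewrite seg1].
- by rewrite !cat0 seg0 repK.
- by rewrite !cat1 seg1 repK.
Qed.

Lemma lift_class_rep x : lift_class (rep x) = 1%g.
Proof.
rewrite /lift_class repK pc_lift //; first exact: Qpath_seg.
- by rewrite seg0 repK.
- by rewrite seg1 repK.
Qed.

Lemma pc_square (H : R * R -> S) : contw (@unit_square R) H ->
  (pc (fun t : R => H (t, 0%R)) * pc (fun t : R => H (1%R, t)) =
   pc (fun t : R => H (0%R, t)) * pc (fun t : R => H (t, 1%R)))%g.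
Proof.
move=> cH.
have csq : convex2 (@unit_square R).
  by move=> u v s [u1 u2] [v1 v2]; move: u1 u2 v1 v2; rewrite /sq /unit_itv /= => *; split; nra.
have side (p : R -> R * R) : contw uI p -> (forall t, uI t -> sq (p t)) -> contw uI (H \o p).
  by move=> cp pq; exact: contw_comp cp pq cH.
pose p1 (t : R) := (t, (0 : R)); pose p2 (t : R) := ((1 : R), t).
pose p3 (t : R) := ((0 : R), t); pose p4 (t : R) := (t, (1 : R)).
have c1 : contw uI p1 by rewrite /p1; cont_lin.
have c2 : contw uI p2 by rewrite /p2; cont_lin.
have c3 : contw uI p3 by rewrite /p3; cont_lin.
have c4 : contw uI p4 by rewrite /p4; cont_lin.
have q1 t : uI t -> sq (p1 t) by move=> ut; split=> //; exact: uI0.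
have q2 t : uI t -> sq (p2 t) by move=> ut; split=> //; exact: uI1.
have q3 t : uI t -> sq (p3 t) by move=> ut; split=> //; exact: uI0.
have q4 t : uI t -> sq (p4 t) by move=> ut; split=> //; exact: uI1.
have catq (p q : R -> R * R) : (forall t, uI t -> sq (p t)) -> (forall t, uI t -> sq (q t)) ->
    forall t, uI t -> sq (loop_cat p q t).
  move=> hp hq t; rewrite /loop_cat /unit_itv /= => ut; case: ifP => h.
    by apply: hp; rewrite /unit_itv /=; move: h; lra.
  by apply: hq; rewrite /unit_itv /=; move/negbT: h; rewrite -ltNge; lra.
have catH (p q : R -> R * R) : loop_cat (H \o p) (H \o q) = H \o loop_cat p q.
  by apply: funext => t; rewrite /loop_cat /=; case: ifP.
rewrite -[LHS](@pc_cat (H \o p1) (H \o p2)) //; try exact: side.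
rewrite -[RHS](@pc_cat (H \o p3) (H \o p4)) //; try exact: side.
rewrite !catH; apply: pc_phom.
- by apply: side; [exact: contw_cat|exact: catq].
- by apply: side; [exact: contw_cat|exact: catq].
apply: (phom_convex csq cH); try exact: contw_cat; try exact: catq.
- by rewrite !cat0.
- by rewrite !cat1.
Qed.

End PathClass.

(** * The polygon in polar coordinates *)

Lemma fibre_tube (T S : topologicalType) (Q : set T) (f : T -> S) (J : Type)
    (F : set_system J) (x : J -> S) (p : S) (P : J -> T -> Prop) :
  Filter F -> compact Q -> hausdorff_space S -> contw Q f -> x @ F --> p ->
  (forall w, Q w -> f w = p -> \forall w' \near w & j \near F, Q w' -> P j w') ->
  \forall j \near F, forall w, Q w -> f w = x j -> P j w.
Proof.
move=> FF cQ hS cf xp h.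
have := (compact_near_coveringP Q).1 cQ J F (fun j w => Q w -> f w = x j -> P j w) FF.
move=> H; have : \forall j \near F, Q `<=` (fun w => Q w -> f w = x j -> P j w).
  apply: H => w Qw; have [e|ne] := pselect (f w = p).
    by apply: filterS (h w Qw e) => -[w' j] /= k Qw' _; exact: k.
  move: hS; rewrite open_hausdorff => /(_ _ _ (introN eqP ne))[[A B] /=].
  rewrite !inE => -[Aw Bp] [oA oB AB].
  exists ([set w' | Q w' -> A (f w')], [set j | B (x j)]).
    split; first by apply: (cf w Qw); exact: open_nbhs_nbhs.
    by apply: xp; exact: open_nbhs_nbhs.
  move=> [w' j] /= [Aw' Bj] Qw' e; have : (A `&` B) (x j) by split=> //; rewrite -e; exact: Aw'.
  by rewrite AB.
by apply: filterS => j k w Qw; exact: k.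
Qed.

Section PolarDisk.
Variables (R : realType) (g : nat).
Hypothesis g_gt0 : (0 < g)%N.
Local Notation N4 := ((4 * g)%:R : R).

Lemma N4_gt0 : 0 < N4. Proof. by rewrite ltr0n muln_gt0. Qed.

(** In the rectangle of polar coordinates, unlike in the disk, the side identifications are affine,
    so straight segments can be made compatible with them. *)
Definition Qset : set (R * R) := [set u | 0 <= u.1 <= 1 /\ 0 <= u.2 <= N4].

Definition polar (u : R * R) : R * R :=
  (u.1 * (polygon_boundary g u.2).1, u.1 * (polygon_boundary g u.2).2).

Lemma convex_Qset : convex2 Qset.
Proof.
have c (M a b s : R) : 0 <= a <= M -> 0 <= b <= M -> 0 <= s <= 1 ->
    0 <= (1 - s) * a + s * b <= M.
  move=> ha hb hs; apply/andP; split; first by nra.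
  have h1 : s * b <= s * M by apply: ler_wpM2l; lra.
  have h2 : (1 - s) * a <= (1 - s) * M by apply: ler_wpM2l; lra.
  by lra.
by move=> u v s [u1 u2] [v1 v2] us; split; apply: c.
Qed.

Lemma compact_Qset : compact Qset.
Proof.
have -> : Qset = [set` `[0 : R, 1]] `*` [set` `[0 : R, N4]].
  by apply/seteqP; split=> -[a b] /= []; rewrite !in_itv.
by apply: compact_setX; exact: segment_compact.
Qed.

Lemma contw_polar (A : set (R * R)) : contw A polar.
Proof.
have c2 : contw A (fun u : R * R => 2 * pi * u.2 / N4).
  apply: contwM; last exact: contw_cst.
  by apply: contwM; [exact: contw_cst|exact: contw_snd].
apply: contw_pair; apply: contwM; try exact: contw_fst.
  exact: (contw_comp c2 (B := setT) (fun _ _ => I) (continuous_contw (@continuous_cos R))).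
exact: (contw_comp c2 (B := setT) (fun _ _ => I) (continuous_contw (@continuous_sin R))).
Qed.

Lemma polar_disk u : Qset u -> unit_disk (polar u).
Proof.
move=> [u1 _]; rewrite /unit_disk /polar /polygon_boundary /= !exprMn -mulrDr cos2Dsin2 mulr1.
by rewrite expr_le1 //; case/andP: u1.
Qed.

Lemma angle_exists (c s : R) : c ^+ 2 + s ^+ 2 = 1 ->
  exists2 t, 0 <= t <= 2 * pi & cos t = c /\ sin t = s.
Proof.
move=> cs; have c1 : -1 <= c <= 1 by have := sqr_ge0 s; rewrite expr2 in cs; nra.
have ca : cos (acos c) = c by apply: acosK; rewrite in_itv.
have sa : sin (acos c) = `|s|.
  by rewrite sin_acos // -sqrtr_sqr; congr Num.sqrt; rewrite -cs; ring.
have a0 := acos_ge0 c1; have a1 := acos_lepi c1; have p0 := pi_ge0 R.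
have [s0|s0] := leP 0 s.
  by exists (acos c); [lra|rewrite ca sa ger0_norm].
exists (pi *+ 2 - acos c); first by rewrite mulr2n; lra.
by rewrite cosB sinB cos2pi sin2pi ca sa ltr0_norm //; split; ring.
Qed.

Lemma angle_scaleK (p N t : R) : 0 < p -> 0 < N -> 2 * p * (t * N / (2 * p)) / N = t.
Proof. by move=> p0 N0; field; rewrite !gt_eqF. Qed.

Lemma angle_scaleVK (p N t : R) : 0 < p -> 0 < N -> (2 * p * t / N) / (2 * p) * N = t.
Proof. by move=> p0 N0; field; rewrite !gt_eqF. Qed.

Lemma polar_onto z : unit_disk z -> exists2 u, Qset u & polar u = z.
Proof.
case: z => x y; rewrite /unit_disk /= => xy; have N0 := N4_gt0.
pose r := Num.sqrt (x ^+ 2 + y ^+ 2).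
have r2 : r ^+ 2 = x ^+ 2 + y ^+ 2 by rewrite sqr_sqrtr // addr_ge0 ?sqr_ge0.
have r0 : 0 <= r by exact: sqrtr_ge0.
have r1 : r <= 1 by rewrite -(@expr_le1 _ 2) // r2.
have [e|ne] := eqVneq r 0.
  exists (0, 0); first by split=> /=; lra.
  move: r2; rewrite e expr0n /= => h.
  have x0 : x = 0 by apply/eqP; rewrite -sqrf_eq0; apply/eqP; have := sqr_ge0 x; have := sqr_ge0 y; lra.
  have y0 : y = 0 by apply/eqP; rewrite -sqrf_eq0; apply/eqP; have := sqr_ge0 x; have := sqr_ge0 y; lra.
  by rewrite x0 y0 /polar /= !mul0r.
have [|t t0 [ct st]] := @angle_exists (x / r) (y / r).
  by rewrite !expr_div_n -mulrDl -r2 mulfV // expf_neq0.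
have p0 := pi_gt0 R.
exists (r, t * N4 / (2 * pi)).
  split=> /=; first by rewrite r0 r1.
  apply/andP; split; first by apply: divr_ge0; [apply: mulr_ge0|]; lra.
  by rewrite ler_pdivrMr ?mulr_gt0 // mulrC ler_pM2l //; lra.
rewrite /polar /polygon_boundary /=.
by rewrite angle_scaleK //; rewrite ct st; congr (_, _); rewrite mulrC mulfVK.
Qed.

Lemma angle_inj (x y : R) : 0 <= x <= 2 * pi -> 0 <= y <= 2 * pi ->
  cos x = cos y -> sin x = sin y ->
  [\/ x = y, x = 0 /\ y = 2 * pi | x = 2 * pi /\ y = 0].
Proof.
move=> hx hy cxy sxy; have p0 := pi_gt0 R.
pose d := (x - y) / 2.
have sd : sin d = 0.
  apply/eqP; rewrite -sqrf_eq0; apply/eqP.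
  have : cos (x - y) = 1 by rewrite cosB cxy sxy -!expr2 cos2Dsin2.
  have -> : x - y = d *+ 2 by rewrite /d mulr2n; field.
  by rewrite cos_mulr2n sin2cos2 mulr2n; lra.
have dpi : - pi <= d <= pi by rewrite /d; lra.
have [d0|d0|d0] := ltgtP d 0.
- have [d1|d1] := ltP (- pi) d.
    by have := @sin_gt0_pi _ (- d); rewrite sinN sd oppr0 ltxx => h; have : false by apply: h; lra.
  by constructor 2; split; move: d1 dpi; rewrite /d; lra.
- have [d1|d1] := ltP d pi.
    by have := @sin_gt0_pi _ d; rewrite sd ltxx => h; have : false by apply: h; lra.
  by constructor 3; split; move: d1 dpi; rewrite /d; lra.
by constructor 1; move: d0; rewrite /d; lra.
Qed.

Lemma polar_inj u v : Qset u -> Qset v -> polar u = polar v -> u.1 = v.1 /\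
  [\/ u.1 = 0, u.2 = v.2, u.2 = 0 /\ v.2 = N4 | u.2 = N4 /\ v.2 = 0].
Proof.
case: u v => r t [r' t'] [/= hr ht] [/= hr' ht'] [].
rewrite /polygon_boundary /=; set a := _ / N4; set a' := _ / N4 => ec es.
have N0 := N4_gt0; have p0 := pi_gt0 R.
have rr : r = r'.
  have : r ^+ 2 = r' ^+ 2.
    rewrite -[LHS]mulr1 -[RHS]mulr1 -{1}(cos2Dsin2 a) -{1}(cos2Dsin2 a') !mulrDr.
    by rewrite -!exprMn ec es.
  by move/eqP; rewrite eqrXn2 //; [move/eqP|case/andP: hr|case/andP: hr'].
split=> //; have [r0|r0] := eqVneq r 0; first by constructor 1.
rewrite -rr in ec es; move: ec es => /(mulfI r0) ec /(mulfI r0) es.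
have b s : 0 <= s <= N4 -> 0 <= 2 * pi * s / N4 <= 2 * pi.
  move=> /andP[s0 s1]; apply/andP; split.
    by apply: divr_ge0; [apply: mulr_ge0|]; lra.
  by rewrite ler_pdivrMr // ler_pM2l ?mulr_gt0.
have back s : s = (2 * pi * s / N4) / (2 * pi) * N4 by rewrite angle_scaleVK.
have pp : 2 * pi / (2 * pi) * N4 = N4 by rewrite mulfV ?mul1r // gt_eqF // mulr_gt0.
have ta : t = a / (2 * pi) * N4 by exact: back.
have ta' : t' = a' / (2 * pi) * N4 by exact: back.
have ha : 0 <= a <= 2 * pi by exact: b.
have ha' : 0 <= a' <= 2 * pi by exact: b.
clearbody a a'; clear back b.
have [e|[e e']|[e e']] := angle_inj ha ha' ec es.
- by constructor 2; rewrite ta ta' e.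
- constructor 3; rewrite ta ta' e e' ?pp.
  by split; [rewrite !mul0r|].
- constructor 4; rewrite ta ta' e e' ?pp.
  by split; [|rewrite !mul0r].
Qed.

Lemma polar_boundary t : polar (1, t) = polygon_boundary g t.
Proof. by rewrite /polar /= !mul1r. Qed.

Section Fibres.
Variables (S : topologicalType) (f : R * R -> S).
Hypothesis f_fibre : forall z w, z \in @unit_disk R -> w \in @unit_disk R ->
  (f z = f w <-> clos_refl_sym_trans _ (side_pairing g) z w).

Lemma side_pairing_disk (z w : R * R) : side_pairing g z w -> unit_disk z /\ unit_disk w.
Proof.
have h t : unit_disk (polygon_boundary g t : R * R).
  by rewrite /unit_disk /polygon_boundary /= cos2Dsin2.
by case.
Qed.

Lemma Qset_side (i j : nat) (s : R) : (i < g)%N -> (j < 4)%N -> 0 <= s <= 1 ->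
  Qset (1, (4 * i + j)%:R + s) /\ Qset (1, (4 * i + j.+1)%:R - s).
Proof.
move=> ig j4 hs.
have h : (4 * i + j.+1)%:R <= N4.
  rewrite ler_nat (@leq_trans (4 * i.+1)%N) ?leq_mul2l //.
  by rewrite mulnS addnC leq_add2r.
have j0 : 0 <= (4 * i + j)%:R :> R by [].
by move: h; rewrite addnS -natr1 /Qset /= => h; split; split; lra.
Qed.

Definition side_pair (k m : nat) : Prop :=
  exists2 i, (i < g)%N & (k = 4 * i /\ m = 4 * i + 3 \/ k = 4 * i + 1 /\ m = 4 * i + 4)%N.

Lemma Qset_side_pair k m (s : R) : side_pair k m -> 0 <= s <= 1 ->
  Qset (1, k%:R + s) /\ Qset (1, m%:R - s).
Proof.
case=> i ig [[-> ->]|[-> ->]] hs; split.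
- by have := (@Qset_side i 0 s ig isT hs).1; rewrite addn0.
- exact: (@Qset_side i 2 s ig isT hs).2.
- exact: (@Qset_side i 1 s ig isT hs).1.
- exact: (@Qset_side i 3 s ig isT hs).2.
Qed.

Lemma fibre_side k m (s : R) : side_pair k m -> 0 <= s <= 1 ->
  f (polar (1, k%:R + s)) = f (polar (1, m%:R - s)).
Proof.
move=> km hs; have [q1 q2] := Qset_side_pair km hs.
apply/(f_fibre (mem_set (polar_disk q1)) (mem_set (polar_disk q2))).
apply: rst_step; rewrite !polar_boundary.
by case: km => i ig [[-> ->]|[-> ->]]; constructor.
Qed.

Lemma fibre_centre (t t' : R) : f (polar (0, t)) = f (polar (0, t')).
Proof. by rewrite /polar !mul0r. Qed.

Lemma fibre_cut (r : R) : f (polar (r, 0)) = f (polar (r, N4)).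
Proof.
rewrite /polar /polygon_boundary /= mulr0 mul0r mulfK ?gt_eqF ?N4_gt0 //.
by rewrite mulr_natl cos0 sin0 cos2pi sin2pi.
Qed.

(* The generating identifications of the sides and of the degenerate sides of
   the rectangle of polar coordinates. *)
Lemma fibre_ind (P : R * R -> R * R -> Prop) :
  (forall u, Qset u -> P u u) ->
  (forall u v, Qset u -> Qset v -> P u v -> P v u) ->
  (forall u v w, Qset u -> Qset v -> Qset w -> P u v -> P v w -> P u w) ->
  (forall t t', 0 <= t <= N4 -> 0 <= t' <= N4 -> P (0, t) (0, t')) ->
  (forall r, 0 <= r <= 1 -> P (r, 0) (r, N4)) ->
  (forall k m s, side_pair k m -> 0 <= s <= 1 -> P (1, k%:R + s) (1, m%:R - s)) ->
  forall u v, Qset u -> Qset v -> f (polar u) = f (polar v) -> P u v.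
Proof.
move=> Pr Ps Pt P0 PN Pa u v Qu Qv.
have Pp u' v' : Qset u' -> Qset v' -> polar u' = polar v' -> P u' v'.
  case: u' v' => r t [r' t'] Qu' Qv' e.
  have [/= rr] := polar_inj Qu' Qv' e; case: Qu' Qv' => [/= hr ht] [/= hr' ht'].
  rewrite -rr => -[r0|->|[-> ->]|[-> ->]].
  - by rewrite r0; exact: P0.
  - exact: Pr.
  - exact: PN.
  - by apply: Ps; [split=> //=; have := N4_gt0; lra..|exact: PN].
have Psp z w : side_pairing g z w -> forall u v, Qset u -> Qset v -> polar u = z ->
    polar v = w -> P u v.
  have tr a b u' v' : Qset (1, a) -> Qset (1, b) -> Qset u' -> Qset v' ->
      polar u' = polygon_boundary g a -> polar v' = polygon_boundary g b ->
      P (1, a) (1, b) -> P u' v'.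
    move=> Qa Qb Qu' Qv' ea eb ab; apply: (Pt _ (1, a)) => //.
      by apply: Pp => //; rewrite polar_boundary.
    by apply: (Pt _ (1, b)) => //; apply: Pp => //; rewrite polar_boundary.
  case=> [i s ig hs|i s ig hs] u' v' Qu' Qv' eu ev.
    have km : side_pair (4 * i) (4 * i + 3) by exists i => //; left.
    have [q1 q2] := Qset_side_pair km hs.
    exact: tr eu ev (Pa _ _ _ km hs).
  have km : side_pair (4 * i + 1) (4 * i + 4) by exists i => //; right.
  have [q1 q2] := Qset_side_pair km hs.
  exact: tr eu ev (Pa _ _ _ km hs).
move=> /(f_fibre (mem_set (polar_disk Qu)) (mem_set (polar_disk Qv))).1 c.
suff H z w : clos_refl_sym_trans _ (side_pairing g) z w -> (unit_disk z <-> unit_disk w) /\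
    forall u v, Qset u -> Qset v -> polar u = z -> polar v = w -> P u v.
  exact: (H _ _ c).2.
elim=> {c}[z' w' zw|z'|z' w' _ [IH1 IH2]|z' y w' _ [I1 I2] _ [J1 J2]].
- by have [? ?] := side_pairing_disk zw; split=> //; exact: Psp.
- by split=> // u' v' Qu' Qv' e e'; apply: Pp => //; rewrite e e'.
- split; first by split; apply IH1.
  by move=> u' v' Qu' Qv' e e'; apply: Ps => //; exact: IH2.
split; first by split=> [/I1/J1|/J1/I1].
move=> u' v' Qu' Qv' e e'.
have [|y' Qy' ey] := @polar_onto y; first by apply/I1; rewrite -e; exact: polar_disk.
by apply: (Pt _ y') => //; [exact: I2|exact: J2].
Qed.

End Fibres.
End PolarDisk.

Section Lattice.
Variable R : realType.

(* The orbit of a under the infinite dihedral group of isometries of Z. *)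
Definition dihedral (a s : R) : Prop := exists m : int, s = a + m%:~R \/ s = m%:~R - a.

Lemma dihedral_refl a s : dihedral a s -> forall k : nat, dihedral a (k%:R - s).
Proof.
case=> m [->|->] k; [exists (k%:Z - m); right|exists (k%:Z - m); left];
  by rewrite intrB; change (k%:Z%:~R) with (k%:R : R); ring.
Qed.

Lemma int_small (m : int) : `|m%:~R : R| < 1 -> m = 0.
Proof.
move=> h; apply/eqP; rewrite eq_le -ltzD1 -[X in _ && X]ltzD1.
have : (m%:~R : R) < 1%:~R /\ (-1)%:~R < (m%:~R : R).
  by move: h; rewrite ltr_norml intrN => /andP[? ?]; split; lra.
by rewrite !ltr_int => -[? ?]; lra.
Qed.

(** The orbit is the union of a + Z and - a + Z; its gaps are governed by the fractional part b of 2
    a, and for b = 0 the two cosets coincide. *)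
Lemma dihedral_sep a : exists2 e : R, 0 < e & forall s t, dihedral a s -> dihedral a t ->
  `|s - t| < 2 * e -> s = t.
Proof.
pose b := 2 * a - (Num.floor (2 * a))%:~R.
have b1 : 0 <= b < 1.
  by have := floor_itv (2 * a); rewrite intrD /b; lra.
have opp (e : R) : (forall m : int, `|2 * a + m%:~R| < 2 * e -> 2 * a + m%:~R = 0) -> 2 * e <= 1 ->
    forall s t, dihedral a s -> dihedral a t -> `|s - t| < 2 * e -> s = t.
  move=> h e1 s t [m hm] [k hk] st.
  have same (c d : R) : s = c + m%:~R -> t = c + k%:~R -> s = t.
    move=> es et; have : m - k = 0; last by move=> /eqP; rewrite subr_eq0 => /eqP mk; rewrite es et mk.
    by apply: int_small; rewrite intrB; move: st; rewrite es et => st;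
       apply: lt_le_trans e1; move: st; congr (`|_| < _); ring.
  case: hm hk => hm [] hk.
  - exact: (same a a).
  - apply/eqP; rewrite -subr_eq0 hm hk; apply/eqP.
    have -> : a + m%:~R - (k%:~R - a) = 2 * a + (m - k)%:~R by rewrite intrB; ring.
    by apply: h; move: st; rewrite hm hk intrB; congr (`|_| < _); ring.
  - apply/eqP; rewrite -subr_eq0 -oppr_eq0 hm hk; apply/eqP.
    have -> : - (m%:~R - a - (a + k%:~R)) = 2 * a + (k - m)%:~R by rewrite intrB; ring.
    by apply: h; move: st; rewrite hm hk intrB -normrN; congr (`|_| < _); ring.
  - by apply: (same (- a) a); rewrite ?hm ?hk addrC.
have [b0|b0] := eqVneq b 0.
  exists (2^-1); first by rewrite invr_gt0.
  apply: opp => [m|]; last by rewrite mulfV.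
  rewrite mulfV //; have -> : 2 * a + m%:~R = (Num.floor (2 * a) + m)%:~R.
    by rewrite intrD; move: b0; rewrite /b => /eqP; rewrite subr_eq0 => /eqP {1}->.
  by move=> /int_small ->.
have b0' : 0 < b by rewrite lt0r b0; case/andP: b1.
pose e := Num.min b (1 - b).
have e0 : 0 < e by rewrite lt_min b0'; lra.
have eb : e <= b by rewrite ge_min lexx.
have eb' : e <= 1 - b by rewrite ge_min lexx orbT.
exists (e / 2); first by lra.
apply: opp => [m|]; last by lra.
have -> : 2 * a + m%:~R = b + (Num.floor (2 * a) + m)%:~R by rewrite intrD /b; ring.
move: (_ + m) => k; have -> : 2 * (e / 2) = e by field.
have [k0|k0] := leP 0 k.
  have : (0 : R) <= k%:~R by rewrite ler0z.
  by rewrite ltr_norml; lra.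
have : (k%:~R : R) <= (-1)%:~R by rewrite ler_int -ltzD1; lra.
by rewrite ltr_norml intrN; lra.
Qed.

End Lattice.

Lemma contwT (T U : topologicalType) (h : T -> U) : contw setT h -> continuous h.
Proof.
move=> ch x O /(ch x I); rewrite /within /=; apply: (@filterS _ (nbhs x)) => y; exact.
Qed.

Lemma near_dist_lt (R : realType) (T : topologicalType) (h : T -> R) (x : T) (l e : R) :
  h @ x --> h x -> `|h x - l| < e -> \forall y \near x, `|h y - l| < e.
Proof.
move=> ch hx; have cn : (fun y => `|h y - l|) @ x --> `|h x - l|.
  by apply: cvg_norm; apply: cvgB; [exact: ch|exact: cvg_cst].
exact: (cvgr_lt _ cn).
Qed.

(** * Local retractions of the surface *)

Section Contraction.
Variables (R : realType) (g : nat) (S : topologicalType) (f : R * R -> S).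
Hypothesis g_gt0 : (0 < g)%N.
Hypothesis hausS : hausdorff_space S.
Local Notation N4 := ((4 * g)%:R : R).
Local Notation Q := (@Qset R g).
Local Notation uI := (@unit_itv R).
Hypothesis cf : contw Q f.
Hypothesis f_centre : forall t t' : R, f (0, t) = f (0, t').
Hypothesis f_cut : forall r : R, f (r, 0) = f (r, N4).
Hypothesis f_side : forall k m (s : R), side_pair g k m -> 0 <= s <= 1 ->
  f (1, k%:R + s) = f (1, m%:R - s).
Hypothesis f_ind : forall (P : R * R -> R * R -> Prop),
  (forall u, Q u -> P u u) ->
  (forall u v, Q u -> Q v -> P u v -> P v u) ->
  (forall u v w, Q u -> Q v -> Q w -> P u v -> P v w -> P u w) ->
  (forall t t', 0 <= t <= N4 -> 0 <= t' <= N4 -> P (0, t) (0, t')) ->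
  (forall r, 0 <= r <= 1 -> P (r, 0) (r, N4)) ->
  (forall k m s, side_pair g k m -> 0 <= s <= 1 -> P (1, k%:R + s) (1, m%:R - s)) ->
  forall u v, Q u -> Q v -> f u = f v -> P u v.

Lemma fibre_radius u v : Q u -> Q v -> f u = f v -> u.1 = v.1.
Proof.
apply: (f_ind (P := fun u v => u.1 = v.1)) => //.
by move=> u' v' w' _ _ _ -> ->.
Qed.

(** The cut translates the angular coordinate by 4 g and a side pairing is the reflection t -> k + m
    - t. At the centre this coordinate carries no information. *)
Lemma fibre_dihedral u v : Q u -> Q v -> f u = f v -> u.1 != 0 -> dihedral u.2 v.2.
Proof.
move=> Qu Qv e; suff [_ h] : u.1 = v.1 /\ (u.1 != 0 -> dihedral u.2 v.2) by [].
move: u v Qu Qv e; apply: f_ind => /=.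
- by move=> u _; split=> // _; exists 0; left; rewrite addr0.
- move=> u v _ _ [e h]; split=> // v0; have [|m [->|->]] := h; first by rewrite e.
    by exists (- m); left; rewrite intrN addrK.
  by exists m; right; rewrite opprB addrC subrK.
- move=> u v w _ _ _ [e h] [e' h']; split; first by rewrite e.
  move=> u0; have [m hm] := h u0; have [|k hk] := h'; first by rewrite -e.
  case: hm hk => -> [] ->.
  + by exists (m + k); left; rewrite intrD addrA.
  + by exists (k - m); right; rewrite intrB; ring.
  + by exists (m + k); right; rewrite intrD; ring.
  + by exists (k - m); left; rewrite intrB; ring.
- by move=> t t' _ _; split=> //; rewrite eqxx.
- by move=> r _; split=> // _; exists (4 * g)%:Z; left; rewrite add0r.
- move=> k m s _ _; split=> // _; exists (k + m)%:Z; right.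
  by rewrite PoszD intrD; change (k%:Z%:~R) with (k%:R : R); change (m%:Z%:~R) with (m%:R : R); ring.
Qed.

Variable rep : S -> R * R.
Hypothesis repQ : forall x, Q (rep x).
Hypothesis repK : forall x, f (rep x) = x.

(* Near p the surface retracts to p along segments of the rectangle, towards
   the nearest point of the fibre of p.  Its second coordinate is the nearest
   point of a dihedral orbit, hence compatible with all identifications. *)
Lemma local_contraction (p : S) (A : R * R -> R * R -> Prop) :
  (forall w, Q w -> f w = p -> \forall z \near (w, w), Q z.1 -> Q z.2 -> A z.1 z.2) ->
  exists (n : R * R -> R * R) (U : set S),
  [/\ nbhs p U,
      forall x, U x -> [/\ Q (n (rep x)), f (n (rep x)) = p & A (rep x) (n (rep x))] &
      contw [set z : S * R | U z.1 /\ uI z.2]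
        (fun z => f (seg (rep z.1) (n (rep z.1)) z.2))].
Proof.
move=> hA; set rp := (rep p).1; set tp := (rep p).2.
have [rp0 rp1] : 0 <= rp /\ rp <= 1 by case: (repQ p) => /andP[].
have [e0 e0_gt0 sep0] := dihedral_sep tp.
(* Radii within e of [rp] reach 0 or 1 only if [rp] is itself 0 or 1. *)
pose e := Num.min e0 (Num.min (if rp == 0 then 1 else rp) (if rp == 1 then 1 else 1 - rp)).
have e_gt0 : 0 < e.
  rewrite !lt_min e0_gt0 /=; apply/andP; split.
    by case: eqVneq => // ne; rewrite lt0r ne.
  by case: eqVneq => // ne; rewrite subr_gt0 lt_neqAle ne.
have e_e0 : e <= e0 by rewrite ge_min lexx.
have e_rp : rp != 0 -> e <= rp by move=> /negbTE ne; rewrite /e ne !ge_min lexx orbT.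
have e_rp1 : rp != 1 -> e <= 1 - rp by move=> /negbTE ne; rewrite /e ne !ge_min lexx !orbT.
have sep s t : dihedral tp s -> dihedral tp t -> `|s - t| < 2 * e -> s = t.
  by move=> ds dt st; apply: sep0 => //; apply: lt_le_trans st _; lra.
clearbody e; clear sep0 e_e0.
pose c s := xget 0 [set l | dihedral tp l /\ `|s - l| < e].
have cE s l : dihedral tp l -> `|s - l| < e -> c s = l.
  move=> dl sl; have [dc sc] : dihedral tp (c s) /\ `|s - c s| < e.
    exact: (@xgetPex _ 0 [set l | dihedral tp l /\ `|s - l| < e] (ex_intro _ l (conj dl sl))).
  apply: sep => //; move: sc sl; rewrite !ltr_norml; lra.
clearbody c.
(* If p is the image of the centre, the whole edge r = 0 lies over it and the retraction is
   radial. *)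
pose n (w : R * R) := if rp == 0 then (0, w.2) else (rp, c w.2).
pose N w := [/\ `|w.1 - rp| < e, Q (n w), f (n w) = p, A w (n w) &
  rp != 0 -> dihedral tp (n w).2 /\ `|w.2 - (n w).2| < e].
have N_near w : Q w -> f w = p -> \forall w' \near w, Q w' -> N w'.
  move=> Qw fw; have wrp : w.1 = rp by apply: (fibre_radius Qw (repQ p)); rewrite repK.
  have n1 : \forall w' \near w, `|w'.1 - rp| < e.
    by apply: near_dist_lt; [exact: cvg_fst|rewrite wrp subrr normr0].
  have n2 : \forall w' \near w, `|w'.2 - w.2| < e.
    by apply: near_dist_lt; [exact: cvg_snd|rewrite subrr normr0].
  have [r0|r0] := eqVneq rp 0.
    have e' : (0, w.2) = w by rewrite -r0 -wrp -surjective_pairing.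
    have n3 : \forall w' \near w, Q w' -> Q (0, w'.2) -> A w' (0, w'.2).
      have : (fun w' : R * R => (w', ((0 : R), w'.2))) @ w --> (w, w).
        rewrite -{3}e'; apply: (contwT (h := fun w' : R * R => (w', ((0 : R), w'.2)))).
        by cont_lin.
      by move=> /(_ _ (hA w Qw fw)).
    apply: filterS2 n1 n3 => w' h1 h3 Qw'.
    have Q0 : Q (0, w'.2) by case: Qw' => _ ?; split=> //=; lra.
    rewrite /N /n r0 eqxx; split=> //; first by rewrite -r0.
      by rewrite (f_centre _ w.2) e'.
    exact: h3.
  have n3 : \forall w' \near w, Q w' -> A w' w.
    have : (fun w' : R * R => (w', w)) @ w --> (w, w).
      by apply: (contwT (h := fun w' : R * R => (w', w))); cont_lin.
    by move=> /(_ _ (hA w Qw fw)); apply: (@filterS _ (nbhs w)) => w' /= h Qw'; exact: h.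
  near=> w' => Qw'.
  have dw : dihedral tp w.2 by apply: (fibre_dihedral (repQ p) Qw); rewrite ?repK.
  have h2 : `|w'.2 - w.2| < e by near: w'.
  have nw : n w' = w by rewrite /n (negbTE r0) (cE _ _ dw h2) -wrp -surjective_pairing.
  by rewrite /N nw; split=> //; [near: w'|move: Qw'; near: w'].
pose U := [set x | forall w, Q w -> f w = x -> N w].
(* Independence of the lift is checked on the generating identifications: uniqueness of the close
   orbit point makes [n] commute with each of them. *)
have wd u v : Q u -> Q v -> f u = f v -> (forall w, Q w -> f w = f u -> N w) ->
    forall tau, uI tau -> f (seg u (n u) tau) = f (seg v (n v) tau).
  move=> Qu Qv fuv; suff [_ h] : f u = f v /\ ((forall w, Q w -> f w = f u -> N w) ->
    forall tau, uI tau -> f (seg u (n u) tau) = f (seg v (n v) tau)) by [].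
  move: u v Qu Qv fuv; apply: f_ind => //.
  - by move=> u v _ _ [e1 h]; split=> // hN tau ut; rewrite h // => w Qw fw; apply: hN; rewrite -?e1.
  - move=> u v w _ _ _ [e1 h] [e2 h2]; split; first by rewrite e1.
    by move=> hN tau ut; rewrite h // h2 // => w' Qw' fw'; apply: hN => //; rewrite e1.
  - move=> t t' ht ht'; split; first exact: f_centre.
    move=> hN tau _; have [/=|rpe _ _ _ _] := hN (0, t) _ erefl; first by split=> //=; lra.
    move: rpe; rewrite /= sub0r normrN ger0_norm // => rpe.
    have r0 : rp == 0 by apply: contraTT rpe => /e_rp; rewrite -leNgt.
    by rewrite /n r0 /seg /= !mulr0 !addr0; exact: f_centre.
  - move=> r hr; split; first exact: f_cut.
    have N0 := ltW (N4_gt0 R g_gt0).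
    have Qr0 : Q (r, 0) by split=> //=; lra.
    have Qr1 : Q (r, N4) by split=> //=; lra.
    move=> hN tau _; have [/= _ Qn0 _ _ n0] := hN _ Qr0 erefl.
    have [/= _ Qn1 _ _ n1] := hN _ Qr1 (esym (f_cut r)).
    have -> : n (r, 0) = ((n (r, 0)).1, 0).
      rewrite [LHS]surjective_pairing; congr (_, _).
      have [r0|r0] := eqVneq rp 0; first by rewrite /n r0 eqxx.
      have [d0 h0] := n0 r0; have := dihedral_refl d0 0; rewrite sub0r => d0'.
      have : (n (r, 0)).2 = - (n (r, 0)).2.
        by apply: sep => //; move: h0; rewrite sub0r opprK !ltr_norml; lra.
      lra.
    have -> : n (r, N4) = ((n (r, N4)).1, N4).
      rewrite [LHS]surjective_pairing; congr (_, _).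
      have [r0|r0] := eqVneq rp 0; first by rewrite /n r0 eqxx.
      have [d0 h0] := n1 r0; have := dihedral_refl d0 (4 * g + 4 * g); rewrite natrD => d0'.
      have : (n (r, N4)).2 = N4 + N4 - (n (r, N4)).2.
        by apply: sep => //; move: h0; rewrite !ltr_norml; lra.
      lra.
    have -> : (n (r, N4)).1 = (n (r, 0)).1 by rewrite /n; case: ifP.
    rewrite /seg /= !mulr0 addr0 -mulrDl subrK mul1r; exact: f_cut.
  move=> k m s km hs; split; first exact: f_side.
  have [q1 q2] := Qset_side_pair km hs.
  move=> hN tau ut; have [/= hr _ _ _ n0] := hN _ q1 erefl.
  have [/= _ _ _ _ n1] := hN _ q2 (esym (f_side km hs)).
  have r1 : rp = 1.
    have [//|ne] := eqVneq rp 1; have := e_rp1 ne.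
    by move: hr; rewrite ger0_norm; lra.
  have r0 : rp != 0 by rewrite r1 oner_eq0.
  have nE w : n w = (1, (n w).2) by rewrite /n (negbTE r0) /= r1.
  have [d0 h0] := n0 r0; have [d1 h1] := n1 r0.
  rewrite [n (1, k%:R + s)]nE [n (1, m%:R - s)]nE.
  set l := (n (1, k%:R + s)).2 in d0 h0 *; set l' := (n (1, m%:R - s)).2 in d1 h1 *.
  clearbody l l'; clear n0 n1 nE.
  have el' : l' = k%:R + m%:R - l.
    have := dihedral_refl d0 (k + m); rewrite natrD => d2.
    by apply: sep => //; move: h0 h1; rewrite !ltr_norml; lra.
  have lk : k%:R <= l.
    rewrite leNgt; apply/negP => lk; have := dihedral_refl d0 (k + k); rewrite natrD => d2.
    have : l = k%:R + k%:R - l by apply: sep => //; move: h0; rewrite !ltr_norml; lra.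
    lra.
  have lk1 : l <= k%:R + 1.
    rewrite leNgt; apply/negP => lk1; have := dihedral_refl d0 (k.+1 + k.+1).
    rewrite natrD -natr1 => d2.
    have : l = k%:R + 1 + (k%:R + 1) - l by apply: sep => //; move: h0; rewrite !ltr_norml; lra.
    lra.
  pose s' := (1 - tau) * s + tau * (l - k%:R).
  have hs' : 0 <= s' <= 1.
    move: ut; rewrite /unit_itv /= /s' => ut; apply/andP; split; first by nra.
    have h2 : tau * (l - k%:R) <= tau * 1 by apply: ler_wpM2l; lra.
    have h3 : (1 - tau) * s <= (1 - tau) * 1 by apply: ler_wpM2l; lra.
    lra.
  have -> : seg (1, k%:R + s) (1, l) tau = (1, k%:R + s').
    by rewrite /seg /s' /=; congr (_, _); ring.
  have -> : seg (1, m%:R - s) (1, l') tau = (1, m%:R - s').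
    by rewrite /seg /s' el' /=; congr (_, _); ring.
  exact: f_side.
have hU : nbhs p U.
  apply: (@fibre_tube _ _ Q f S (nbhs p) id p (fun _ w => N w)) => //.
  - exact: compact_Qset.
  - move=> w Qw fw; exists ([set w' | Q w' -> N w'], setT); last by move=> [w' j] /= [].
    by split; [exact: N_near|exact: filterT].
exists n, U; split=> // [x Ux|].
  by have [_ ? ? ? _] := Ux _ (repQ x) (repK x).
(* Although [rep] may jump, the retraction is continuous: [fibre_tube] treats all lifts of nearby
   points at once. *)
move=> [x0 t0] [/= Ux0 ut0] O hO.
have Fx : (fst : S * R -> S) @ within [set z | U z.1 /\ uI z.2] (nbhs (x0, t0)) --> x0.
  by apply: cvg_trans (@cvg_fst _ _ (nbhs x0) (nbhs t0) _); apply: cvg_app; exact: cvg_within.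
have Ft : (snd : S * R -> R) @ within [set z | U z.1 /\ uI z.2] (nbhs (x0, t0)) --> t0.
  by apply: cvg_trans (@cvg_snd _ _ (nbhs x0) (nbhs t0) _); apply: cvg_app; exact: cvg_within.
have FF : Filter (within [set z : S * R | U z.1 /\ uI z.2] (nbhs (x0, t0))) by exact: within_filter.
have := @fibre_tube _ _ Q f (S * R)%type (within [set z | U z.1 /\ uI z.2] (nbhs (x0, t0)))
  fst x0 (fun z w => uI z.2 -> O (f (seg w (n w) z.2))) FF (@compact_Qset R g) hausS cf Fx.
move=> H; have {H} : \forall z \near within [set z : S * R | U z.1 /\ uI z.2] (nbhs (x0, t0)),
    forall w, Q w -> f w = z.1 -> uI z.2 -> O (f (seg w (n w) z.2)).
  apply: H => w Qw fw.
  have [hr Qn fn _ hd] := Ux0 w Qw fw.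
  have hO' : nbhs (f (seg w (n w) t0)) O.
    have <- : f (seg (rep x0) (n (rep x0)) t0) = f (seg w (n w) t0) => //.
    by apply: wd => //; rewrite repK // => w' Qw'; exact: Ux0.
  have Qseg : Q (seg w (n w) t0) by exact: convex_Qset.
  have nn : \forall w' \near w, Q w' -> Q (n w').
    have [r0|r0] := eqVneq rp 0.
      near=> w'; rewrite /n r0 eqxx => -[_ h]; split=> //=; lra.
    have [dn hn] := hd r0.
    have : \forall w' \near w, `|w'.2 - (n w).2| < e.
      by apply: near_dist_lt hn; exact: cvg_snd.
    apply: filterS => w' h _; have -> : n w' = n w; last by [].
    by rewrite /n (negbTE r0) (cE _ _ dn h) /n (negbTE r0).
  have cn : n @ w --> n w.
    have [r0|r0] := eqVneq rp 0.
      rewrite /n r0 eqxx; apply: (contwT (h := fun w : R * R => ((0 : R), w.2))); cont_lin.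
    have [dn hn] := hd r0.
    have : \forall w' \near w, `|w'.2 - (n w).2| < e.
      by apply: near_dist_lt hn; exact: cvg_snd.
    move=> h B hB; apply: filterS h => w' h; have e' : n w' = n w.
      by rewrite /n (negbTE r0) (cE _ _ dn h) /n (negbTE r0).
    by rewrite /= e'; exact: nbhs_singleton.
  have ck : continuous (fun z : (R * R) * (R * R) * R => seg z.1.1 z.1.2 z.2).
    apply: contwT; pose X := ((R * R) * (R * R) * R)%type.
    have c1 : contw [set: X] (fun z => z.1.1.1) by do 2 apply: contw_comp_fst; exact: contw_fst.
    have c2 : contw [set: X] (fun z => z.1.1.2) by apply: contw_comp_snd; apply: contw_comp_fst; exact: contw_fst.
    have c3 : contw [set: X] (fun z => z.1.2.1) by apply: contw_comp_fst; apply: contw_comp_snd; exact: contw_fst.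
    have c4 : contw [set: X] (fun z => z.1.2.2) by do 2 apply: contw_comp_snd; exact: contw_fst.
    have c5 : contw [set: X] (fun z => z.2) by exact: contw_snd.
    have c6 : contw [set: X] (fun z => 1 - z.2) by apply: contwB => //; exact: contw_cst.
    by apply: contw_pair; apply: contwD; apply: contwM.
  have := ck ((w, n w), t0) _ (cf Qseg hO'); rewrite /within /=.
  move=> [[A' B'] [[[A1 A2] [/= hA1 hA2] subA] hB'] sub].
  exists ([set w' | A1 w' /\ A2 (n w') /\ (Q w' -> Q (n w'))], [set z | B' z.2]).
    split=> /=; last exact: Ft.
    by apply: filterI => //; apply: filterI => //; exact: cn.
  move=> [w' [x t]] [/= [hw1 [hw2 hw3]] hB] Qw' ut.
  have /= := sub ((w', n w'), t); apply; last by apply: convex_Qset => //; exact: hw3.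
  by split=> //; apply: subA.
rewrite /within /=; apply: (@filterS _ (nbhs (x0, t0))) => -[x t] /= h [Ux ut].
exact: (h (conj Ux ut) _ (repQ x) (repK x) ut).
Unshelve. all: end_near.
Qed.

End Contraction.

(** * Holonomy of a flat connection *)

Lemma lebesgue_number (R : realType) (T : pseudoMetricType R) (K : set T) (P : set T -> Prop) :
  compact K -> (forall A B : set T, A `<=` B -> P B -> P A) ->
  (forall z, K z -> exists2 O, nbhs z O & P (O `&` K)) ->
  exists2 e : R, 0 < e & forall z, K z -> P (ball z e `&` K).
Proof.
move=> cK Pm loc.
have H : \forall e \near (0 : R)^'+, K `<=` (fun z => P (ball z e `&` K)).
  apply: ((compact_near_coveringP K).1 cK) => z Kz.
  have [W /nbhs_ballP[d /= d0 dO] PO] := loc z Kz.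
  exists (ball z (d / 2), [set e | 0 < e < d / 2]).
    split=> /=; first by apply: nbhsx_ballx; lra.
    near=> e; apply/andP; split; near: e; first exact: nbhs_right_gt.
    by apply: nbhs_right_lt; lra.
  move=> [z' e] /= [zz' /andP[e0 ed]]; apply: Pm PO => y [yz' Ky]; split=> //.
  apply: dO; rewrite (splitr d); apply: ball_triangle zz' _.
  by apply: le_ball yz'; apply: ltW.
have [e /= [e0 he]] : exists e : R, 0 < e /\ K `<=` (fun z => P (ball z e `&` K)).
  have : \forall e \near (0 : R)^'+, 0 < e /\ K `<=` (fun z => P (ball z e `&` K)).
    near=> e; split; near: e; [exact: nbhs_right_gt|exact: H].
  by move=> /filter_ex [e h]; exists e.
by exists e.
Unshelve. all: end_near.
Qed.

Section Telescope.
Variables (S : Type) (K : groupType) (c : S -> S -> K).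
Local Open Scope group_scope.

Fixpoint tele (x : nat -> S) (n : nat) : K :=
  if n is n'.+1 then tele x n' * c (x n') (x n) else 1.

Lemma tele_add x a b : tele x (a + b) = tele x a * tele (fun j => x (a + j)%N) b.
Proof.
elim: b => [|b IH] /=; first by rewrite addn0 mulg1.
by rewrite addnS /= IH mulgA.
Qed.

Lemma tele_ext x y n : (forall k, (k <= n)%N -> x k = y k) -> tele x n = tele y n.
Proof.
elim: n => //= n IH h; rewrite !h ?IH // => k kn; apply: h; exact: leqW.
Qed.

Lemma tele_split x n (t : S -> K) :
  (forall i j, (i <= n)%N -> (j <= n)%N -> c (x i) (x j) = t (x i) * (t (x j))^-1) ->
  tele x n = c (x 0%N) (x n).
Proof.
move=> h; rewrite h //.
have : forall k, (k <= n)%N -> tele x k = t (x 0%N) * (t (x k))^-1.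
  elim=> [_|k IH kn] /=; first by rewrite mulgV.
  by rewrite (IH (ltnW kn)) (h _ _ (ltnW kn) kn) mulgA mulgVK.
by apply.
Qed.

Lemma tele_refine x n m :
  (forall k, (k < n)%N -> tele (fun j => x (k * m + j)%N) m = c (x (k * m)%N) (x (k.+1 * m)%N)) ->
  tele x (n * m) = tele (fun k => x (k * m)%N) n.
Proof.
elim: n => [_|n IH h]; first by rewrite mul0n.
rewrite mulSnr tele_add IH /=; last by move=> k kn; apply: h; exact: ltnW.
by rewrite h // mulSnr.
Qed.

Lemma tele_ladder x y n :
  (forall k, (k < n)%N -> c (x k) (x k.+1) * c (x k.+1) (y k.+1) =
                          c (x k) (y k) * c (y k) (y k.+1)) ->
  tele x n * c (x n) (y n) = c (x 0%N) (y 0%N) * tele y n.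
Proof.
elim: n => [_|n IH h] /=; first by rewrite mul1g mulg1.
rewrite -mulgA h // mulgA IH ?mulgA // => k kn; apply: h; exact: ltnW.
Qed.

End Telescope.

Section Holonomy.
Variables (R : realType) (S : topologicalType) (K : groupType) (c : S -> S -> K).
Hypothesis c_local : forall p : S, exists (U : set S) (t : S -> K), nbhs p U /\
  forall x y, U x -> U y -> c x y = (t x * (t y)^-1)%g.
Local Notation uI := (@unit_itv R).
Local Notation sq := (@unit_square R).

(* On A the transports c are the transition functions of a trivialization. *)
Definition split_on (A : set S) : Prop :=
  exists t : S -> K, forall x y, A x -> A y -> c x y = (t x * (t y)^-1)%g.

Lemma c_refl x : c x x = 1%g.
Proof.
by have [U [t [hU h]]] := c_local x; rewrite h ?mulgV //; exact: nbhs_singleton.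
Qed.

Definition sample (al : R -> S) (n : nat) (k : nat) : S := al (k%:R / n%:R).

Lemma compact_uI : compact uI.
Proof.
have -> : uI = [set` `[0 : R, 1]] by apply/seteqP; split=> t /=; rewrite in_itv.
exact: segment_compact.
Qed.

Lemma compact_sq : compact sq.
Proof.
have -> : sq = uI `*` uI by [].
by apply: compact_setX; exact: compact_uI.
Qed.

Lemma split_mesh (T : pseudoMetricType R) (A : set T) (H : T -> S) : compact A -> contw A H ->
  exists2 e : R, 0 < e & forall z, A z -> split_on (H @` (ball z e `&` A)).
Proof.
move=> cA cH; apply: (lebesgue_number (P := fun B => split_on (H @` B)) cA).
  move=> B B' BB' [t ht]; exists t => x y [u Bu <-] [v Bv <-].
  by apply: ht; [exists u => //; exact: BB'|exists v => //; exact: BB'].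
move=> z Az; have [U [t [hU ht]]] := c_local (H z).
exists [set w | A w -> U (H w)]; first exact: cH.
by exists t => x y [u [Au Uu] <-] [v [Av Uv] <-]; apply: ht; [exact: Au|exact: Av].
Qed.

Lemma unit_frac n k : (0 < n)%N -> (k <= n)%N -> uI (k%:R / n%:R).
Proof.
move=> n0 kn; rewrite /unit_itv /= divr_ge0 //= ler_pdivrMr ?ltr0n // mul1r ler_nat //.
Qed.

Lemma tele_sample_refine al (e : R) n m : contw uI al -> (0 < n)%N -> (0 < m)%N ->
  (forall z, uI z -> split_on (al @` (ball z e `&` uI))) -> n%:R^-1 < e ->
  tele c (sample al (n * m)) (n * m) = tele c (sample al n) n.
Proof.
move=> cal n0 m0 he ne.
have n0' : (n%:R : R) != 0 by rewrite pnatr_eq0 -lt0n.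
have m0' : (m%:R : R) != 0 by rewrite pnatr_eq0 -lt0n.
rewrite tele_refine => [|k kn].
  by apply: tele_ext => k _; rewrite /sample !natrM -mulf_div mulfV // mulr1.
have uk : uI (k%:R / n%:R) by apply: unit_frac => //; exact: ltnW.
have [t ht] := he _ uk.
have inb j : (j <= m)%N -> (al @` (ball ((k%:R : R) / n%:R) e `&` uI)) (sample al (n * m) (k * m + j)).
  move=> jm; exists ((k * m + j)%:R / (n * m)%:R) => //; split; last first.
    apply: unit_frac; first by rewrite muln_gt0 n0.
    by rewrite (leq_trans (leq_add (leqnn _) jm)) // -mulSnr leq_mul2r kn orbT.
  rewrite -ball_normE /=.
  have -> : (k%:R : R) / n%:R - (k * m + j)%:R / (n * m)%:R = - (j%:R / m%:R / n%:R).
    by rewrite natrD !natrM; field; rewrite n0' m0'.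
  rewrite normrN ger0_norm ?divr_ge0 //; apply: le_lt_trans ne.
  by rewrite ler_pdivrMr ?ltr0n // mulVf // ler_pdivrMr ?ltr0n // mul1r ler_nat.
rewrite (@tele_split _ _ _ _ _ t); last by move=> i j im jm; apply: ht; exact: inb.
by rewrite addn0 mulSnr.
Qed.

(** The products over n equal steps become constant for large n, so holonomy needs no limit. *)
Definition hol_is (al : R -> S) (h : K) : Prop :=
  exists N, forall n, (N <= n)%N -> (0 < n)%N -> tele c (sample al n) n = h.

Lemma small_inv (e : R) : 0 < e -> exists N, forall n, (N <= n)%N -> (0 < n)%N -> (n%:R : R)^-1 < e.
Proof.
move=> e0; exists (Num.truncn e^-1).+1 => n hn n0.
rewrite invf_plt ?posrE ?ltr0n //; apply: lt_le_trans (truncnS_gt _) _.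
by rewrite ler_nat.
Qed.

Lemma hol_exists al : contw uI al -> exists h, hol_is al h.
Proof.
move=> cal; have [e e0 he] := split_mesh compact_uI cal.
have [N hN] := small_inv e0.
exists (tele c (sample al N.+1) N.+1), N.+1 => n nN n0.
(* Subdivisions into n and into N + 1 steps are compared through their common refinement. *)
rewrite -(tele_sample_refine cal n0 (ltn0Sn N) he); last by apply: hN => //; exact: ltnW.
rewrite mulnC (tele_sample_refine cal (ltn0Sn N) n0 he) //.
by apply: hN.
Qed.

Lemma hol_unique al h h' : hol_is al h -> hol_is al h' -> h = h'.
Proof.
case=> N hN [N' hN']; rewrite -(hN (N + N').+1) ?(hN' (N + N').+1) //.
  by rewrite leqW // leq_addl.
by rewrite leqW // leq_addr.
Qed.

Lemma hol_cat al be h h' : al 1 = be 0 -> hol_is al h -> hol_is be h' ->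
  contw uI (loop_cat al be) -> hol_is (loop_cat al be) (h * h')%g.
Proof.
move=> ab [N hN] [N' hN'] cc; have [h2 [M hM]] := hol_exists cc.
exists M => n nM n0; rewrite hM //.
(* An even number 2 m of steps makes the midpoint a sample point. *)
pose m := (N + N' + M).+1.
have m0 : (m%:R : R) != 0 by rewrite pnatr_eq0.
have Nm : (N <= m)%N by rewrite /m -addnA leqW // leq_addr.
have N'm : (N' <= m)%N by rewrite /m addnAC leqW // leq_addl.
have Mm : (M <= m + m)%N by rewrite (leq_trans _ (leq_addr _ _)) // /m leqW // leq_addl.
have m0' : (0 < m)%N by [].
clearbody m; rewrite -(hM (m + m)%N) // ?addn_gt0 ?m0' //.
rewrite tele_add -(hN m) // -(hN' m) //.
have mm : ((m + m)%:R : R) = m%:R * 2 by rewrite natrD; ring.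
congr (_ * _)%g; apply: tele_ext => k km; rewrite /sample /loop_cat.
  have e : (k%:R : R) / (m + m)%:R = k%:R / m%:R / 2.
    by rewrite mm invfM mulrA.
  have k1 := unit_frac m0' km; rewrite e ifT; last first.
    by rewrite ler_pdivrMr // mulVf //; case/andP: k1.
  by congr al; field.
have e : ((m + k)%:R : R) / (m + m)%:R = 2^-1 + k%:R / m%:R / 2.
  by rewrite mm natrD invfM mulrA !mulrDl mulfV // mul1r.
have [k0|k0] := posnP k.
  by rewrite e k0 !mul0r addr0 lexx mulfV // -ab.
rewrite e ifF; first by congr be; field.
by apply/negbTE; rewrite -ltNge ltrDl !divr_gt0 // ltr0n.
Qed.

(** On a fine grid every cell lies in a trivializing set, so transport round it is trivial; rows
    then have equal products, the end columns being constant. *)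
Lemma hol_phom al be h : al 0 = al 1 -> phom al be -> contw uI al -> contw uI be -> hol_is al h ->
  hol_is be h.
Proof.
move=> a01 [H [cH h1 h2]] ca cb [N hN]; have [h' [N' hN']] := hol_exists cb.
suff -> : h = h' by exists N'.
have [e e0 he] := split_mesh compact_sq cH.
have [M hM] := small_inv e0.
pose n := (N + N' + M).+1; have n0 : (0 < n)%N by [].
have Nn : (N <= n)%N by rewrite /n -addnA leqW // leq_addr.
have N'n : (N' <= n)%N by rewrite /n addnAC leqW // leq_addl.
have ne : (n%:R : R)^-1 < e by apply: hM => //; rewrite leqW // leq_addl.
have nn0 : (n%:R : R) != 0 by rewrite pnatr_eq0.
clearbody n; rewrite -(hN n) // -(hN' n) //.
pose z j k : R * R := (j%:R / n%:R, k%:R / n%:R).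
pose row j k := H (z j k).
have zs j k : (j <= n)%N -> (k <= n)%N -> sq (z j k) by move=> jn kn; split; exact: unit_frac.
have -> : tele c (sample al n) n = tele c (row 0%N) n.
  by apply: tele_ext => k kn; rewrite /row /z mul0r (h1 _ (unit_frac n0 kn)).1.
have -> : tele c (sample be n) n = tele c (row n) n.
  apply: tele_ext => k kn; rewrite /row /z mulfV //.
  by rewrite (h1 _ (unit_frac n0 kn)).2.
have meshb : forall a b a' b', (a <= a' <= a.+1)%N -> (b <= b' <= b.+1)%N -> ball (z a b) e (z a' b').
  have d a b : (a <= b <= a.+1)%N -> ball ((a%:R : R) / n%:R) e (b%:R / n%:R).
    move=> /andP[ab ba]; rewrite -ball_normE /= -mulrBl normrM normfV (@ger0_norm _ n%:R) //.
    apply: le_lt_trans ne; rewrite ler_piMl ?invr_ge0 //.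
    rewrite distrC -natrB // ger0_norm // -(ler_nat R) in ba *.
    by rewrite (_ : 1 = 1%:R) // ler_nat leq_subLR addn1 -(ler_nat R).
  by move=> a b a' b' jj kk; split=> /=; exact: d.
have rows j : (j < n)%N -> tele c (row j) n = tele c (row j.+1) n.
  move=> jn.
  have ends : c (row j n) (row j.+1 n) = 1%g /\ c (row j 0%N) (row j.+1 0%N) = 1%g.
    have H1 i : (i <= n)%N -> row i n = al 1.
      by move=> i_n; rewrite /row /z mulfV // (h2 _ (unit_frac n0 i_n)).2.
    have H0 i : (i <= n)%N -> row i 0%N = al 0.
      by move=> i_n; rewrite /row /z mul0r (h2 _ (unit_frac n0 i_n)).1.
    by rewrite !H1 ?H0 ?c_refl // ltnW.
  have := @tele_ladder _ _ c (row j) (row j.+1) n.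
  rewrite ends.1 ends.2 mulg1 mul1g; apply=> k kn.
  have [t ht] := he (z j k) (zs j k (ltnW jn) (ltnW kn)).
  have im j' k' : (j <= j' <= j.+1)%N -> (k <= k' <= k.+1)%N ->
      (H @` (ball (z j k) e `&` sq)) (row j' k').
    move=> jj kk; exists (z j' k') => //; split; first exact: meshb.
    by apply: zs; [case/andP: jj => _ h3; exact: leq_trans h3 jn|
                   case/andP: kk => _ h3; exact: leq_trans h3 kn].
  have i1 := im j k; have i2 := im j k.+1; have i3 := im j.+1 k; have i4 := im j.+1 k.+1.
  rewrite !leqnn !leqnSn /= in i1 i2 i3 i4.
  move: (i1 isT isT) (i2 isT isT) (i3 isT isT) (i4 isT isT) => {}i1 {}i2 {}i3 {}i4.
  by rewrite !ht // !mulgA !mulgVK.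
have : forall j, (j <= n)%N -> tele c (row 0%N) n = tele c (row j) n.
  by elim=> // j IH jn; rewrite IH 1?ltnW // rows.
by apply.
Qed.

End Holonomy.

(** * Developing a surface *)

Section Developing.
Variables (R : realType) (S : topologicalType) (s0 : S) (G : groupType).
Variable cls : (R -> S) -> G.
Hypothesis cls_onto : forall g, exists2 al, is_loop s0 al & cls al = g.
Hypothesis cls_hom : forall f h, is_loop s0 f -> is_loop s0 h ->
  (cls f = cls h <-> loop_homotopic s0 f h).
Hypothesis cls_cat : forall f h, is_loop s0 f -> is_loop s0 h ->
  cls (loop_cat f h) = (cls f * cls h)%g.
Variables (Q : set (R * R)) (f : R * R -> S) (rep : S -> R * R).
Hypothesis convQ : convex2 Q.
Hypothesis cf : contw Q f.
Hypothesis repQ : forall x, Q (rep x).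
Hypothesis repK : forall x, f (rep x) = x.
Local Notation uI := (@unit_itv R).
Local Notation sq := (@unit_square R).
Hypothesis contr : forall (p : S) (A : R * R -> R * R -> Prop),
  (forall w, Q w -> f w = p -> \forall z \near (w, w), Q z.1 -> Q z.2 -> A z.1 z.2) ->
  exists (n : R * R -> R * R) (U : set S),
  [/\ nbhs p U,
      forall x, U x -> [/\ Q (n (rep x)), f (n (rep x)) = p & A (rep x) (n (rep x))] &
      contw [set z : S * R | U z.1 /\ uI z.2]
        (fun z => f (seg (rep z.1) (n (rep z.1)) z.2))].

Local Notation K := (bijection (hplane R)).
Variable C : K -> G -> Prop.
Hypothesis CM : forall k a k' a', C k a -> C k' a' -> C (k * k')%g (a * a')%g.
Hypothesis C1 : C 1%g 1%g.
Hypothesis CV : forall k a, C k a -> C k^-1%g a^-1%g.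
Hypothesis Ciso : forall k a, C k a -> forall p q, hdist (k p) (k q) = hdist p q.
Hypothesis Cdisp : forall k a, C k a -> k <> 1%g -> forall p, 30 <= hdist p (k p).

Local Notation lc := (lift_class s0 cls f rep).
Local Notation pc := (pc s0 cls f rep).
Variable F : R * R -> hplane R.
Hypothesis F_near : forall w, Q w ->
  \forall z \near (w, w), Q z.1 -> Q z.2 -> hdist (F z.1) (F z.2) < 1.
Hypothesis F_fibre : forall u v, Q u -> Q v -> f u = f v ->
  exists2 k : K, F u = k (F v) & C k (lc u * (lc v)^-1)%g.

(* The transport from x to y: the nontrivial elements displace every point by 30,
   hence at most one of them qualifies. *)
Definition conn (x y : S) : K :=
  xget 1%g [set k : K | (exists a, C k a) /\ hdist (F (rep x)) (k (F (rep y))) < 3].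

Lemma connE x y k a : C k a -> hdist (F (rep x)) (k (F (rep y))) < 3 -> conn x y = k.
Proof.
move=> Ck kd.
have [[b Cb] bd] : (exists b, C (conn x y) b) /\ hdist (F (rep x)) (conn x y (F (rep y))) < 3.
  apply: (@xgetPex _ 1%g [set k : K | (exists a, C k a) /\ hdist (F (rep x)) (k (F (rep y))) < 3]).
  by exists k; split=> //; exists a.
have Cq := CM (CV Ck) Cb.
have [e|ne] := pselect ((k^-1 * conn x y)%g = 1%g).
  by apply: (mulgI k^-1%g); rewrite e mulVg.
suff : (0 : R) < 0 by rewrite ltxx.
(* Two different candidates would give an element moving this point by less than 6. *)
have := Cdisp Cq ne (F (rep y)); rewrite -(Ciso Ck) bijME bijKV.
have := hdist_triangle (F (rep x)) (k (F (rep y))) (conn x y (F (rep y))).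
rewrite (hdistC (k (F (rep y))) (F (rep x))); clear ne Cq; move: kd bd.
by move: (hdist _ _) (hdist _ _) (hdist _ _) => *; lra.
Qed.

(** Links transports to classes: [F_fibre] supplies the element for lifts u and v of one point, and
    it moves the chosen lifts to within 2 < 3. *)
Lemma conn_fibre x y u v : Q u -> Q v -> f u = f v -> hdist (F (rep x)) (F u) < 1 ->
  hdist (F (rep y)) (F v) < 1 -> C (conn x y) (lc u * (lc v)^-1)%g.
Proof.
move=> Qu Qv e xu yv; have [k ek Ck] := F_fibre Qu Qv e.
rewrite (connE Ck) //.
have := hdist_triangle (F u) (F (rep x)) (k (F (rep y))).
rewrite {2}ek (Ciso Ck) (hdistC (F v)); clear ek e; move: xu yv.
by move: (hdist _ _) (hdist _ _) (hdist _ _) => *; lra.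
Qed.

Let contr_near (p : S) := @contr p (fun u v => hdist (F u) (F v) < 1) (fun w Qw _ => F_near Qw).

(** The trivialization t x carries the F-image of the chosen lift of p to that of the lift of p to
    which [rep x] retracts. *)
Lemma conn_local (p : S) : exists (U : set S) (t : S -> K), nbhs p U /\
  forall x y, U x -> U y -> conn x y = (t x * (t y)^-1)%g.
Proof.
have [n [U [hU h _]]] := contr_near p.
have [t ht] : exists t : S -> K, forall x, U x -> F (n (rep x)) = t x (F (rep p)) /\ exists a, C (t x) a.
  have /choice[t ht] : forall x, exists k : K, U x -> F (n (rep x)) = k (F (rep p)) /\ exists a, C k a.
    move=> x; have [Ux|nU] := pselect (U x); last by exists 1%g.
    have [Qn fn _] := h x Ux; have [|k ek Ck] := F_fibre Qn (repQ p); first by rewrite repK.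
    by exists k => _; split=> //; exists (lc (n (rep x)) * (lc (rep p))^-1)%g.
  by exists t.
exists U, t; split=> // x y Ux Uy.
have [ex [a Ca]] := ht x Ux; have [ey [b Cb]] := ht y Uy.
have [_ _ dx] := h x Ux; have [_ _ dy] := h y Uy.
apply: connE; first exact: (CM Ca (CV Cb)).
have := hdist_triangle (F (n (rep x))) (F (rep x)) ((t x * (t y)^-1)%g (F (rep y))).
rewrite {2}ex bijME (Ciso Ca) -(Ciso Cb (F (rep p))) bijKV -ey (hdistC _ (F (rep y))).
by move: dx dy; move: (hdist _ _) (hdist _ _) (hdist _ _) => *; lra.
Qed.

Definition sub_path (al : R -> S) (a b t : R) : S := al ((1 - t) * a + t * b).

Lemma sub_path_uI a b t : uI a -> uI b -> uI t -> uI ((1 - t) * a + t * b).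
Proof.
rewrite /unit_itv /= => ha hb ht; apply/andP; split; first by nra.
have h1 : t * b <= t * 1 by apply: ler_wpM2l; lra.
have h2 : (1 - t) * a <= (1 - t) * 1 by apply: ler_wpM2l; lra.
lra.
Qed.

Lemma contw_sub_path al a b : contw uI al -> uI a -> uI b -> contw uI (sub_path al a b).
Proof.
move=> ca ua ub; apply: (@contw_comp _ _ _ _ uI (fun t : R => (1 - t) * a + t * b)) => //.
  by cont_lin.
by move=> t ut; exact: sub_path_uI.
Qed.

Lemma pc_sub_path al a b d : contw uI al -> uI a -> uI b -> uI d ->
  pc (sub_path al a d) = (pc (sub_path al a b) * pc (sub_path al b d))%g.
Proof.
move=> ca ua ub ud.
have c1 := contw_sub_path ca ua ub; have c2 := contw_sub_path ca ub ud.
have e : sub_path al a b 1 = sub_path al b d 0 by rewrite /sub_path; congr al; ring.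
rewrite -(pc_cat cls_hom cls_cat convQ cf repQ repK c1 c2 e).
apply: (pc_phom cls_hom convQ cf repQ repK).
- exact: contw_sub_path.
- exact: contw_cat.
pose l a b (t : R) : R := (1 - t) * a + t * b.
have cl a' b' : contw uI (l a' b') by rewrite /l; cont_lin.
have -> : loop_cat (sub_path al a b) (sub_path al b d) = al \o loop_cat (l a b) (l b d).
  by apply: funext => t; rewrite /loop_cat /sub_path /=; case: ifP.
apply: (@phom_reparam _ _ al (l a d)) => //.
- by apply: contw_cat => //; rewrite /l; ring.
- by move=> t; exact: sub_path_uI.
- move=> t; rewrite /loop_cat /unit_itv /= => ut; case: ifP => h.
    by apply: sub_path_uI => //; rewrite /unit_itv /=; move: h; lra.
  by apply: sub_path_uI => //; rewrite /unit_itv /=; move/negbT: h; rewrite -ltNge; lra.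
- by rewrite cat0 /l; ring.
- by rewrite cat1 /l; ring.
Qed.

(* A short path is contracted to one point of the surface; the track of its ends
   lifts to the rectangle, which computes both its class and its transport. *)
Lemma conn_pc_local al : contw uI al ->
  exists2 e : R, 0 < e & forall a b, uI a -> uI b -> `|a - b| < e ->
    C (conn (al a) (al b)) (pc (sub_path al a b)).
Proof.
move=> ca.
pose P (A : set R) := forall a b, A a -> A b -> (forall t, uI t -> A ((1 - t) * a + t * b)) ->
  C (conn (al a) (al b)) (pc (sub_path al a b)).
have [||e e0 he] := @lebesgue_number R R uI P (@compact_uI R).
- by move=> A B AB PB a b Aa Ab h; apply: PB; [exact: AB|exact: AB|move=> t ut; apply/AB/h].
- move=> t0 ut0; have [n [U [hU h cU]]] := contr_near (al t0).
  exists [set t | uI t -> U (al t)]; first exact: ca.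
  move=> a b [Ua ua] [Ub ub] hab; have {}Ua := Ua ua; have {}Ub := Ub ub.
  have [Qa fa da] := h _ Ua; have [Qb fb db] := h _ Ub.
  have -> : pc (sub_path al a b) = (lc (n (rep (al a))) * (lc (n (rep (al b))))^-1)%g.
    pose H := (fun z : S * R => f (seg (rep z.1) (n (rep z.1)) z.2)) \o
      (fun z : R * R => (sub_path al a b z.1, z.2)).
    have cH : contw sq H.
      apply: (contw_comp (B := [set z : S * R | U z.1 /\ uI z.2])) => //; last first.
        move=> [s t] [/= us ut]; split=> //; have [h1 h2] := hab s us; exact: h1.
      apply: contw_pair; last exact: contw_snd.
      apply: (contw_comp (B := uI)); [exact: contw_fst|by move=> z []|exact: contw_sub_path].
    have htop : pc (fun t => H (t, 1)) = pc (fun=> al t0).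
      apply: (pc_phom cls_hom convQ cf repQ repK).
      - apply: (@contw_comp _ _ _ _ sq (fun t : R => (t, (1 : R)))) => //; first by cont_lin.
        by move=> t ut; split=> //; exact: uI1.
      - exact: contw_cst.
      apply/phom_sym/phom_eq; first exact: contw_cst.
      move=> t ut; rewrite /H /= seg1; have [h1 h2] := hab t ut.
      by have [_ ->] := h _ (h1 h2).
    have := pc_square cls_hom cls_cat convQ cf repQ repK cH; rewrite htop.
    have -> : (fun t => H (t, 0)) = sub_path al a b.
      by apply: funext => t; rewrite /H /= seg0 repK.
    have s1 : sub_path al a b 1 = al b by rewrite /sub_path; congr al; ring.
    have s0' : sub_path al a b 0 = al a by rewrite /sub_path; congr al; ring.
    have -> : (fun t => H (1, t)) = f \o seg (rep (al b)) (n (rep (al b))).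
      by apply: funext => t; rewrite /H /= s1.
    have -> : (fun t => H (0, t)) = f \o seg (rep (al a)) (n (rep (al a))).
      by apply: funext => t; rewrite /H /= s0'.
    rewrite !(pc_Qpath cls_hom cls_cat convQ cf repQ repK); try exact: Qpath_seg.
    rewrite !seg0 !seg1 !(lift_class_rep cls_hom cls_cat convQ cf repQ repK) invg1 !mul1g.
    by rewrite (pc_const cls_hom cls_cat convQ cf repQ repK) mulg1 => <-; rewrite mulgK.
  by apply: conn_fibre => //; rewrite fa fb.
exists e => // a b ua ub ab; apply: (he a ua).
- by split=> //; exact: ballxx.
- by split=> //; rewrite -ball_normE.
move=> t ut; split; last exact: sub_path_uI.
rewrite -ball_normE /=.
have -> : a - ((1 - t) * a + t * b) = t * (a - b) by ring.
rewrite normrM ger0_norm; last by case/andP: ut.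
by apply: le_lt_trans ab; rewrite ler_piMl //; case/andP: ut.
Qed.

Lemma hol_C al h : is_loop s0 al -> hol_is conn al h -> C h (cls al).
Proof.
move=> lal; have := lal; rewrite is_loopP => -[ca a0 a1] [N hN].
have [e e0 he] := conn_pc_local ca.
have [M hM] := small_inv e0.
pose n := (N + M).+1; have n0 : (0 < n)%N by [].
have Nn : (N <= n)%N by rewrite /n leqW // leq_addr.
have Mn : (M <= n)%N by rewrite /n leqW // leq_addl.
clearbody n; rewrite -(hN n) // -(pc_loop cls_hom repK lal).
have nn0 : (n%:R : R) != 0 by rewrite pnatr_eq0 -lt0n.
have H k : (k <= n)%N -> C (tele conn (sample al n) k) (pc (sub_path al 0 (k%:R / n%:R))).
  elim: k => [_|k IH kn].
    rewrite /= mul0r; have -> : sub_path al 0 0 = fun=> al 0.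
      by apply: funext => t; rewrite /sub_path !mulr0 addr0.
    by rewrite (pc_const cls_hom cls_cat convQ cf repQ repK).
  rewrite /= (@pc_sub_path _ _ (k%:R / n%:R)) //; [|exact: uI0|exact: unit_frac n0 (ltnW kn)|exact: unit_frac].
  apply: CM; first exact: IH (ltnW kn).
  apply: he; [exact: unit_frac n0 (ltnW kn)|exact: unit_frac|].
  rewrite -mulrBl -natr1 opprD addrA subrr add0r mulN1r normrN ger0_norm ?invr_ge0 //.
  exact: hM.
have := H n (leqnn n); rewrite mulfV //.
by have -> : sub_path al 0 1 = al by apply: funext => t; rewrite /sub_path; congr al; ring.
Qed.

(** The image of g is the holonomy of a chosen loop of class g; multiplicativity is homotopy
    invariance of holonomy. *)
Theorem developing_hom : exists2 rho : G -> K,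
  forall g h, rho (g * h)%g = (rho g * rho h)%g & forall g, C (rho g) g.
Proof.
have /choice[lp hlp] : forall g, exists al, is_loop s0 al /\ cls al = g.
  by move=> g; have [al h e] := cls_onto g; exists al.
have cl g : [/\ contw uI (lp g), lp g 0 = s0 & lp g 1 = s0] by rewrite -is_loopP; case: (hlp g).
have /choice[rho hrho] : forall g, exists h, hol_is conn (lp g) h.
  by move=> g; have [cg _ _] := cl g; have := hol_exists conn_local cg.
exists rho => [g h|g]; last by rewrite -{2}(hlp g).2; exact: hol_C (hlp g).1 (hrho g).
have [cg g0 g1] := cl g; have [ch h0 h1] := cl h; have [cgh gh0 gh1] := cl (g * h)%g.
have gh : lp g 1 = lp h 0 by rewrite g1 h0.
have cc := contw_cat cg ch gh.
have lc : is_loop s0 (loop_cat (lp g) (lp h)) by rewrite is_loopP; split; rewrite ?cat0 ?cat1.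
have lgh := (hlp (g * h)%g).1.
have : cls (loop_cat (lp g) (lp h)) = cls (lp (g * h)%g).
  by rewrite cls_cat; [rewrite !(hlp _).2|exact: (hlp g).1|exact: (hlp h).1].
move=> /(cls_hom lc lgh).1 [H [cH hH1 hH2]].
apply: (hol_unique (hrho (g * h)%g)).
apply: (hol_phom conn_local _ _ cc cgh (hol_cat conn_local gh (hrho g) (hrho h) cc)).
  by rewrite cat0 cat1 g0 h1.
exists H; split.
- move/contwP: cH; apply: contw_sub => -[s t] [/= us ut]; split=> /=; rewrite in_itv //=.
- by move=> t ut; apply: hH1; rewrite in_itv.
- by move=> s us; rewrite cat0 cat1 g0 h1; apply: hH2; rewrite in_itv.
Qed.

End Developing.

(** * Corners of the polygon *)

Section Turn.
Variables (H : groupType) (a b : nat -> H).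
Local Open Scope group_scope.

(** The relator of the 4g-gon read up to its i-th block; commutators accumulate on the left, hence
    the reversed list in [turn_cprod]. *)
Fixpoint turn (i : nat) : H :=
  if i is i'.+1 then commp ((b i')^-1, a i') * turn i' else 1.

Lemma turn_cprod i : turn i = cprod (rev (mkseq (fun j => ((b j)^-1, a j)) i)).
Proof. by elim: i => //= i ->; rewrite mkseqS rev_rcons. Qed.

(* The transport from the vertex 0 of the polygon to its k-th vertex. *)
Definition corner (k : nat) : H :=
  let i := (k %/ 4)%N in
  match (k %% 4)%N with
  | 0%N => turn i
  | 1%N => a i * b i * (a i)^-1 * turn i
  | 2%N => b i * (a i)^-1 * turn i
  | _ => (a i)^-1 * turn i
  end.

Lemma div4 i j : (j < 4)%N -> ((4 * i + j) %/ 4 = i)%N.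
Proof. by move=> j4; rewrite mulnC divnMDl // divn_small // addn0. Qed.

Lemma mod4 i j : (j < 4)%N -> ((4 * i + j) %% 4 = j)%N.
Proof. by move=> j4; rewrite mulnC modnMDl modn_small. Qed.

Lemma corner0 i : corner (4 * i) = turn i.
Proof. by rewrite -[(4 * i)%N]addn0 /corner mod4 // div4. Qed.

Lemma corner1 i : corner (4 * i + 1) = a i * b i * (a i)^-1 * turn i.
Proof. by rewrite /corner mod4 // div4. Qed.

Lemma corner2 i : corner (4 * i + 2) = b i * (a i)^-1 * turn i.
Proof. by rewrite /corner mod4 // div4. Qed.

Lemma corner3 i : corner (4 * i + 3) = (a i)^-1 * turn i.
Proof. by rewrite /corner mod4 // div4. Qed.

Lemma corner4 i : corner (4 * i + 4) = (b i)^-1 * a i * b i * (a i)^-1 * turn i.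
Proof. by rewrite -mulnSr corner0 /= /commp /= invgK. Qed.

End Turn.

(** * Continuity in the hyperbolic plane *)

Section Coordinates.
Variable R : realType.

Definition hcoord (p : hplane R) : R * R := (hre p, him p).

Lemma cvg_hcosh (T : Type) (F : set_system T) (p : T -> hplane R) (p0 : hplane R) :
  Filter F -> (fun u => hcosh (p u) p0) @ F --> (1 : R) -> (fun u => hcoord (p u)) @ F --> hcoord p0.
Proof.
move=> FF h; have y0 := him_gt0 p0.
have key (e : R) : 0 < e -> \forall u \near F, `|hre p0 - hre (p u)| < e /\ `|him p0 - him (p u)| < e.
  move=> e0; pose d := Num.min 1 (e ^+ 2 / (8 * him p0 ^+ 2)).
  have d0 : 0 < d by rewrite lt_min ltr01 divr_gt0 ?exprn_gt0 ?mulr_gt0 ?exprn_gt0.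
  have : \forall u \near F, hcosh (p u) p0 < 1 + d by apply: (cvgr_lt _ h); rewrite ltrDl.
  apply: filterS => u; rewrite /hcosh -subr_gt0; have y1 := him_gt0 (p u).
  set N := _ ^+ 2 + _ ^+ 2; set M := 2 * _ * _ => hN.
  have M0 : 0 < M by rewrite !mulr_gt0.
  have d1 : d <= 1 by rewrite ge_min lexx.
  have d2 : d * (8 * him p0 ^+ 2) <= e ^+ 2.
    by rewrite -ler_pdivlMr ?mulr_gt0 ?exprn_gt0 // ge_min lexx orbT.
  have NM : N < d * M by rewrite -ltr_pdivrMr //; move: hN; lra.
  have Nx := sqr_ge0 (hre (p u) - hre p0); have Ny := sqr_ge0 (him (p u) - him p0).
  have yb : him (p u) <= 4 * him p0.
    have : him (p u) * him (p u) <= him (p u) * (4 * him p0).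
      have dM : d * M <= 1 * M by apply: ler_wpM2r => //; exact: ltW.
      move: NM dM Nx Ny; rewrite /N /M; move: y0 y1; rewrite !expr2; clear; nra.
    by rewrite ler_pM2l.
  have Ne : N < e ^+ 2.
    apply: lt_le_trans NM _; apply: le_trans d2; apply: ler_wpM2l; first exact: ltW.
    have : him (p u) * him p0 <= 4 * him p0 * him p0 by apply: ler_wpM2r => //; exact: ltW.
    by rewrite /M expr2; lra.
  have sm (z : R) : z ^+ 2 < e ^+ 2 -> `|z| < e.
    by rewrite -(real_normK (num_real z)) ltr_pXn2r // ?nnegrE ?normr_ge0 // ltW.
  by split; rewrite distrC; apply: sm; move: Ne; rewrite /N; lra.
rewrite /hcoord; apply: (@cvg_pair _ _ _ F (nbhs (hre p0)) (nbhs (him p0))).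
  by apply/cvgrPdist_lt => e e0; apply: filterS (key e e0) => u [].
by apply/cvgrPdist_lt => e e0; apply: filterS (key e e0) => u [].
Qed.

Lemma hcosh_cvg (T : Type) (F : set_system T) (p q : T -> hplane R) (p0 : hplane R) :
  Filter F -> (fun u => hcoord (p u)) @ F --> hcoord p0 ->
  (fun u => hcoord (q u)) @ F --> hcoord p0 -> (fun u => hcosh (p u) (q u)) @ F --> (1 : R).
Proof.
move=> FF h h'; have y0 := him_gt0 p0.
have co (r : T -> hplane R) : (fun u => hcoord (r u)) @ F --> hcoord p0 ->
    ((fun u => hre (r u)) @ F --> hre p0) /\ ((fun u => him (r u)) @ F --> him p0).
  move=> hr; split.
    exact: (cvg_comp _ _ hr (@cvg_fst _ _ (nbhs (hre p0)) (nbhs (him p0)) _)).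
  exact: (cvg_comp _ _ hr (@cvg_snd _ _ (nbhs (hre p0)) (nbhs (him p0)) _)).
have [cx cy] := co _ h; have [cx' cy'] := co _ h'.
have e : 1 = 1 + ((hre p0 - hre p0) ^+ 2 + (him p0 - him p0) ^+ 2) / (2 * him p0 * him p0).
  by rewrite !subrr expr0n /= addr0 mul0r addr0.
rewrite [X in _ --> X]e.
apply: cvgD; first exact: cvg_cst.
apply: cvgM.
  by apply: cvgD; rewrite !expr2; apply: cvgM; apply: cvgB.
apply: cvgV; first by rewrite gt_eqF // !mulr_gt0.
by apply: cvgM => //; apply: cvgM => //; exact: cvg_cst.
Qed.

(** At distance at least 1, twice the cosh exceeds e >= 9/4 > 2 * 11/10. *)
Lemma hdist_lt1 (p q : hplane R) : hcosh p q < 11 / 10 -> hdist p q < 1.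
Proof.
move=> h; have := hdist_coshE p q; have := expR_gt0 (- hdist p q).
have e1 : (9 / 4 : R) <= expR 1.
  have : 3 / 2 <= expR (2^-1 : R) by have := expR_ge1Dx (2^-1 : R); lra.
  have e2 : expR 1 = expR 2^-1 * expR 2^-1 :> R by rewrite -expRD; congr expR; lra.
  rewrite e2; move: (expR _) => x hx; have := mulr_ge0 (_ : 0 <= x - 3 / 2) (_ : 0 <= x - 3 / 2).
  by rewrite subr_ge0 => /(_ hx hx); move: hx; lra.
move=> n0 ce; rewrite ltNge; apply/negP => d1; suff : (0 : R) < 0 by rewrite ltxx.
have : expR 1 <= expR (hdist p q) by rewrite ler_expR.
move: ce h e1 n0; move: (expR _) (expR _) (expR _) (hcosh _ _) => *; clear d1; lra.
Qed.

Lemma contw_isometry (T : topologicalType) (A : set T) (p : T -> hplane R)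
    (k : hplane R -> hplane R) : (forall x y, hdist (k x) (k y) = hdist x y) ->
  contw A (fun u => hcoord (p u)) -> contw A (fun u => hcoord (k (p u))).
Proof.
move=> ik cp u Au; apply: cvg_hcosh.
have e v : hcosh (k (p v)) (k (p u)) = hcosh (p v) (p u).
  have := hdist_coshE (k (p v)) (k (p u)); rewrite ik hdist_coshE.
  by move: (hcosh _ _) (hcosh _ _) => c d; lra.
have -> : (fun v => hcosh (k (p v)) (k (p u))) = fun v => hcosh (p v) (p u).
  by apply: funext => v; exact: e.
by apply: hcosh_cvg; [exact: cp|exact: cvg_cst].
Qed.

(** Keeps the imaginary part in [hseg] positive for every real parameter. *)
Definition clamp (s : R) : R := Num.max 0 (Num.min 1 s).

Lemma clampE s : 0 <= s <= 1 -> clamp s = s.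
Proof. by move=> /andP[s0 s1]; rewrite /clamp min_r // max_r. Qed.

Lemma clamp01 s : 0 <= clamp s <= 1.
Proof. by rewrite /clamp le_max lexx ge_max ler01 ge_min lexx. Qed.

Lemma hseg_him (p q : hplane R) s : 0 < (1 - clamp s) * him p + clamp s * him q.
Proof.
have := clamp01 s; have := him_gt0 p; have := him_gt0 q.
move: (him p) (him q) (clamp s) => y z t z0 y0 ht; have [->|t1] := eqVneq t 1; first by lra.
apply: ltr_pwDl; first by rewrite mulr_gt0 // subr_gt0 lt_neqAle t1; case/andP: ht.
by case/andP: ht => t0 _; rewrite mulr_ge0 // ltW.
Qed.

Definition hseg (p q : hplane R) (s : R) : hplane R :=
  @HPlane R ((1 - clamp s) * hre p + clamp s * hre q) _ (hseg_him p q s).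

Lemma hseg0 p q : hseg p q 0 = p.
Proof. by apply: hplane_eq; rewrite /= clampE ?lexx ?ler01 //; ring. Qed.

Lemma hseg1 p q : hseg p q 1 = q.
Proof. by apply: hplane_eq; rewrite /= clampE ?lexx ?ler01 //; ring. Qed.

Lemma contw_hseg (T : topologicalType) (A : set T) (p : hplane R) (q : T -> hplane R) (s : T -> R) :
  contw A (fun u => hcoord (q u)) -> contw A s -> contw A (fun u => hcoord (hseg p (q u) (s u))).
Proof.
move=> cq cs; have cc : contw A (fun u => clamp (s u)).
  rewrite /clamp; apply: contw_max; first exact: contw_cst.
  by apply: contw_min => //; exact: contw_cst.
have cx : contw A (fun u => hre (q u)) by exact: (contw_comp_fst cq).
have cy : contw A (fun u => him (q u)) by exact: (contw_comp_snd cq).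
have h (c : R) (g : T -> R) : contw A g -> contw A (fun u => (1 - clamp (s u)) * c + clamp (s u) * g u).
  move=> cg; apply: contwD; apply: contwM => //; try exact: contw_cst.
  by apply: contwB => //; exact: contw_cst.
by rewrite /hcoord /=; apply: contw_pair; apply: h.
Qed.

End Coordinates.

(** * An equivariant map of the polygon *)

Section CoarseMap.
Variables (R : realType) (g : nat).
Local Notation K := (bijection (hplane R)).
Variables a b : nat -> K.
Hypothesis iso_a : forall i x y, hdist (a i x) (a i y) = hdist x y.
Hypothesis iso_b : forall i x y, hdist (b i x) (b i y) = hdist x y.
Hypothesis g_gt0 : (0 < g)%N.
Hypothesis turn_g : turn a b g = 1%g.

Let p0 : hplane R := HPlane 0 ltr01.
Let vtx k : hplane R := corner a b k p0.

Let iso_aV i x y : hdist ((a i)^-1%g x) ((a i)^-1%g y) = hdist x y.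
Proof. by rewrite -(iso_a i) !bijKV. Qed.
Let iso_bV i x y : hdist ((b i)^-1%g x) ((b i)^-1%g y) = hdist x y.
Proof. by rewrite -(iso_b i) !bijKV. Qed.

(* The sides numbered 4i + 2 and 4i + 3 are images of earlier sides, which are
   Euclidean segments of the half-plane. *)
Definition piece (k : nat) (s : R) : hplane R :=
  let i := (k %/ 4)%N in
  match (k %% 4)%N with
  | 0%N => hseg (vtx (4 * i)) (vtx (4 * i + 1)) s
  | 1%N => hseg (vtx (4 * i + 1)) (vtx (4 * i + 2)) s
  | 2%N => (a i)^-1%g (hseg (vtx (4 * i)) (vtx (4 * i + 1)) (1 - s))
  | _ => (b i)^-1%g (hseg (vtx (4 * i + 1)) (vtx (4 * i + 2)) (1 - s))
  end.

Lemma piece_ab i s : piece (4 * i) s = a i (piece (4 * i + 2) (1 - s)) /\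
  piece (4 * i + 1) s = b i (piece (4 * i + 3) (1 - s)).
Proof.
rewrite /piece modnMr mulKn // !mod4 // !div4 // !bijKV.
by have -> : 1 - (1 - s) = s by ring.
Qed.

Lemma contw_piece k (A : set R) : contw A (fun s => hcoord (piece k s)).
Proof.
have c1 : contw A (fun s : R => 1 - s) by cont_lin.
rewrite /piece; case: (k %% 4)%N => [|[|[|_]]].
- by apply: contw_hseg; [exact: contw_cst|exact: contw_id].
- by apply: contw_hseg; [exact: contw_cst|exact: contw_id].
- by apply: (contw_isometry (@iso_aV _)); apply: contw_hseg => //; exact: contw_cst.
- by apply: (contw_isometry (@iso_bV _)); apply: contw_hseg => //; exact: contw_cst.
Qed.

Lemma piece_ends k : piece k 0 = vtx k /\ piece k 1 = vtx k.+1.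
Proof.
have -> : k = (4 * (k %/ 4) + k %% 4)%N by rewrite mulnC -divn_eq.
have := ltn_pmod k (isT : (0 < 4)%N); move: (k %/ 4)%N (k %% 4)%N => i [|[|[|[|//]]]] _.
- by rewrite addn0 -[(4 * i).+1]addn1 /piece modnMr mulKn // hseg0 hseg1.
- by rewrite -addnS /piece mod4 // div4 // hseg0 hseg1.
- rewrite -addnS /piece mod4 // div4 // subr0 subrr hseg0 hseg1.
  rewrite /vtx corner0 corner1 corner2 corner3 -!bijME; split=> //.
  by congr (bfun _ _); rewrite !mulgA mulVg mul1g.
rewrite -addnS /piece mod4 // div4 // subr0 subrr hseg0 hseg1.
rewrite /vtx corner1 corner2 corner3 corner4 -!bijME; split; last by congr (bfun _ _); rewrite !mulgA.
by congr (bfun _ _); rewrite !mulgA mulVg mul1g.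
Qed.

Fixpoint bdry (k : nat) (t : R) : hplane R :=
  if k is k'.+1 then (if t <= k'%:R then bdry k' t else piece k' (t - k'%:R)) else vtx 0.

Lemma bdryE k m t : (k < m)%N -> k%:R <= t <= k.+1%:R -> bdry m t = piece k (t - k%:R).
Proof.
elim: m k t => // m IH k t; rewrite ltnS leq_eqVlt => /orP[/eqP ->|km] /andP[t0 t1] /=; last first.
  rewrite ifT; first by apply: IH => //; rewrite t0.
  by apply: le_trans t1 _; rewrite ler_nat.
have [t2|//] := leP t m%:R.
have -> : t = m%:R by apply/eqP; rewrite eq_le t2.
rewrite subrr (piece_ends m).1; case: m IH {t0 t1 t2} => // m IH.
by rewrite (IH m) // ?lexx ?ler_nat ?leqnSn // -natr1 addrAC subrr add0r (piece_ends m).2.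
Qed.

Lemma contw_bdry m : contw [set t : R | 0 <= t <= m%:R] (fun t => hcoord (bdry m t)).
Proof.
elim: m => [|m IH].
  by apply: (@contw_eq _ _ _ (fun _ : R => hcoord (vtx 0))) => //; exact: contw_cst.
apply: (@contw_glue R _ _ _ _ (fun t : R => t) m%:R); first by move=> t; exact: cvg_id.
  apply: (@contw_eq _ _ _ (fun t => hcoord (bdry m t))).
    by move=> t [_ /= ->].
  by apply: contw_sub IH => t [/= /andP[t0 _] tm]; rewrite t0.
apply: (@contw_eq _ _ _ ((fun s => hcoord (piece m s)) \o (fun t => t - m%:R))).
  move=> t [/= /andP[t0 t1] tm]; rewrite -[LHS]/(hcoord (piece m (t - m%:R))).
  have hb : m%:R <= t <= m.+1%:R by apply/andP.
  by have /= -> := bdryE (ltnSn m) hb.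
apply: (@contw_comp _ _ _ _ setT (fun t : R => t - m%:R)) => //; first by cont_lin.
exact: contw_piece.
Qed.

(** The development asks only for local closeness and compatibility with the identifications, so a
    Euclidean cone in the half-plane over the boundary map suffices. *)
Definition cone (u : R * R) : hplane R := hseg p0 (bdry (4 * g) u.2) u.1.

Lemma cone_near w : Qset g w ->
  \forall z \near (w, w), Qset g z.1 -> Qset g z.2 -> hdist (cone z.1) (cone z.2) < 1.
Proof.
move=> Qw.
have cc : contw (@Qset R g) (fun u => hcoord (cone u)).
  apply: contw_hseg; last exact: contw_fst.
  apply: (@contw_comp _ _ _ _ [set t : R | 0 <= t <= (4 * g)%:R] snd (fun t => hcoord (bdry (4 * g) t))).
  - exact: contw_snd.
  - by move=> u [].
  - exact: contw_bdry.
pose A := [set z : (R * R) * (R * R) | Qset g z.1 /\ Qset g z.2].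
have c1 : contw A (fun z => hcoord (cone z.1)).
  exact: (@contw_comp _ _ _ A (@Qset R g) fst (fun u => hcoord (cone u)) (@contw_fst _ _ _) (fun z h => h.1) cc).
have c2 : contw A (fun z => hcoord (cone z.2)).
  exact: (@contw_comp _ _ _ A (@Qset R g) snd (fun u => hcoord (cone u)) (@contw_snd _ _ _) (fun z h => h.2) cc).
have Aw : A (w, w) by [].
have FF : Filter (within A (nbhs (w, w))) by exact: within_filter.
have := hcosh_cvg FF (c1 _ Aw) (c2 _ Aw).
move=> /cvgr_lt /(_ (11 / 10)) H.
have : \forall z \near within A (nbhs (w, w)), hcosh (cone z.1) (cone z.2) < 11 / 10 by apply: H; lra.
rewrite /within /=; apply: (@filterS _ (nbhs (w, w))) => z h Q1 Q2.
by apply: hdist_lt1; exact: h.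
Qed.

Lemma cone_centre t t' : cone (0, t) = cone (0, t').
Proof. by rewrite /cone /= !hseg0. Qed.

Lemma cone_cut r : cone (r, 0) = cone (r, (4 * g)%:R).
Proof.
have g4 : (0 < 4 * g)%N by rewrite muln_gt0.
rewrite /cone /=; congr (hseg _ _ _).
rewrite (@bdryE 0) ?ler01 ?lexx // subrr (piece_ends 0).1.
rewrite (@bdryE (4 * g).-1) ?prednK ?lexx ?andbT ?ler_nat ?leq_pred //.
have -> : (4 * g)%:R - (4 * g).-1%:R = 1 :> R.
  by rewrite -{1}(prednK g4) -natr1 addrAC subrr add0r.
by rewrite (piece_ends _).2 prednK // /vtx corner0 turn_g (corner0 a b 0).
Qed.

Lemma cone_a i s : (i < g)%N -> 0 <= s <= 1 ->
  cone (1, (4 * i)%:R + s) = a i (cone (1, (4 * i + 3)%:R - s)).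
Proof.
move=> ig hs; rewrite /cone /= !hseg1.
have e3 : (4 * i + 3)%:R = (4 * i + 2)%:R + 1 :> R by rewrite addnS natr1.
have l j : (j < 4)%N -> (4 * i + j < 4 * g)%N.
  by move=> j4; rewrite (@leq_trans (4 * i.+1)%N) ?leq_mul2l // mulnS addnC ltn_add2r.
rewrite (@bdryE (4 * i)); [|by have := l 0%N; rewrite addn0; apply|by rewrite -natr1; lra].
rewrite (@bdryE (4 * i + 2)); [|exact: l|by rewrite -natr1 e3; lra].
rewrite (piece_ab _ _).1; congr (a i (piece _ _)); rewrite e3; ring.
Qed.

Lemma cone_b i s : (i < g)%N -> 0 <= s <= 1 ->
  cone (1, (4 * i + 1)%:R + s) = b i (cone (1, (4 * i + 4)%:R - s)).
Proof.
move=> ig hs; rewrite /cone /= !hseg1.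
have e3 : (4 * i + 4)%:R = (4 * i + 3)%:R + 1 :> R by rewrite addnS natr1.
have l j : (j < 4)%N -> (4 * i + j < 4 * g)%N.
  by move=> j4; rewrite (@leq_trans (4 * i.+1)%N) ?leq_mul2l // mulnS addnC ltn_add2r.
rewrite (@bdryE (4 * i + 1)); [|exact: l|by rewrite -natr1; lra].
rewrite (@bdryE (4 * i + 3)); [|exact: l|by rewrite -natr1 e3; lra].
rewrite (piece_ab _ _).2; congr (b i (piece _ _)); rewrite e3; ring.
Qed.

End CoarseMap.

(** * The surface group *)

(** Uses 4 <= e^2 and 2 (30 * 2^12 + 2) <= 10^6. *)
Lemma genus_bound (R : realType) (genus : nat) : expR (10 ^+ 6) <= genus%:R :> R ->
  exists2 n, genus = n.+2 & (4 ^ (30 * 2 ^ 12).+1 <= n)%N.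
Proof.
set N := (30 * 2 ^ 12).+1%N => h.
have NR : (N.+1%:R : R) * 2 <= 10 ^+ 6.
  have -> : (N.+1%:R : R) = 30 * 2 ^+ 12 + 2 by rewrite -natr1 /N -natr1 natrM natrX; ring.
  lra.
have e2 : (4 : R) <= expR 2.
  have -> : (2 : R) = 1 + 1 by lra.
  rewrite expRD; have := expR_ge1Dx (1 : R); move: (expR _) => x hx.
  have := mulr_ge0 (_ : 0 <= x - 2) (_ : 0 <= x - 2).
  have x2 : 0 <= x - 2 by lra.
  by move=> /(_ x2 x2); lra.
have h2 : (4 ^ N.+1 <= genus)%N.
  rewrite -(ler_nat R); apply: le_trans h; rewrite natrX.
  apply: (@le_trans _ _ (expR 2 ^+ N.+1)); first by apply: lerXn2r; rewrite ?nnegrE ?expR_ge0.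
  by rewrite -expRM_natr ler_expR mulrC.
clearbody N; clear NR e2 h.
have h3 : (4 ^ N + 2 <= genus)%N.
  apply: leq_trans h2; rewrite expnS (mulnDl 1 3) mul1n leq_add2l.
  by rewrite (@leq_trans (3 * 1)) // leq_mul2l expn_gt0.
case: genus h3 {h2} => [|[|n]]; rewrite ?addn2 ?ltnS //.
by exists n.
Qed.

(** * The relation among the side classes *)

Section SideClasses.
Variables (R : realType) (S : topologicalType) (s0 : S) (G : groupType).
Variable cls : (R -> S) -> G.
Hypothesis cls_hom : forall f h, is_loop s0 f -> is_loop s0 h ->
  (cls f = cls h <-> loop_homotopic s0 f h).
Hypothesis cls_cat : forall f h, is_loop s0 f -> is_loop s0 h ->
  cls (loop_cat f h) = (cls f * cls h)%g.
Variables (g : nat) (f : R * R -> S) (rep : S -> R * R).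
Hypothesis g_gt0 : (0 < g)%N.
Local Notation Q := (@Qset R g).
Local Notation N4 := ((4 * g)%:R : R).
Hypothesis cf : contw Q f.
Hypothesis repQ : forall x, Q (rep x).
Hypothesis repK : forall x, f (rep x) = x.
Hypothesis f_centre : forall t t' : R, f (0, t) = f (0, t').
Hypothesis f_cut : forall r : R, f (r, 0) = f (r, N4).
Hypothesis f_side : forall k m (s : R), side_pair g k m -> 0 <= s <= 1 ->
  f (1, k%:R + s) = f (1, m%:R - s).
Local Notation lc := (lift_class s0 cls f rep).
Local Notation uI := (@unit_itv R).

(** Two lifts of one path give it the same class, which [pc_Qpath] expresses through the ends of
    either lift. *)
Lemma lift_class_paths (p q : R -> R * R) : Qpath Q p -> Qpath Q q ->
  (forall t, uI t -> f (p t) = f (q t)) ->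
  (lc (p 1%R) * (lc (q 1%R))^-1 = lc (p 0%R) * (lc (q 0%R))^-1)%g.
Proof.
move=> Qp Qq pq.
have h := pc_Qpath cls_hom cls_cat (@convex_Qset R g) cf repQ repK.
have e : ((lc (p 0%R))^-1 * lc (p 1%R) = (lc (q 0%R))^-1 * lc (q 1%R))%g.
  rewrite -(h _ Qp) -(h _ Qq); apply: (pc_phom cls_hom (@convex_Qset R g) cf repQ repK).
  - exact: (contw_Qpath cf Qp).
  - exact: (contw_Qpath cf Qq).
  - by apply: phom_eq => //; exact: (contw_Qpath cf Qp).
apply: (mulgI (lc (p 0%R))^-1%g); rewrite mulKg mulgA e -mulgA mulgV mulg1 //.
Qed.

Lemma lift_class_centre t t' : 0 <= t <= N4 -> 0 <= t' <= N4 -> lc (0, t) = lc (0, t').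
Proof.
move=> ht ht'; have Qt : Q (0, t) by split=> //=; lra.
have Qt' : Q (0, t') by split=> //=; lra.
have := @lift_class_paths (seg (0, t) (0, t')) (fun=> (0, t)).
rewrite seg0 seg1 mulgV => H; apply/esym/(mulIg (lc (0, t))^-1%g); rewrite mulgV; apply: H.
- exact: (Qpath_seg (@convex_Qset R g) Qt Qt').
- by split=> [|s _]; [exact: contw_cst|exact: Qt].
- by move=> s _; rewrite /seg /= !mulr0 addr0; exact: f_centre.
Qed.

Lemma lift_class_cut r : 0 <= r <= 1 -> lc (r, 0) = lc (r, N4).
Proof.
move=> hr; have N0 := ltW (N4_gt0 R g_gt0).
have Q0 s t : 0 <= s <= 1 -> 0 <= t <= N4 -> Q (s, t) by [].
have t0 : 0 <= (0 : R) <= N4 by rewrite lexx.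
have t1 : 0 <= N4 <= N4 by rewrite lexx andbT.
have r0 : 0 <= (0 : R) <= 1 by rewrite lexx ler01.
have := @lift_class_paths (seg (0, 0) (r, 0)) (seg (0, N4) (r, N4)).
rewrite !seg0 !seg1 (lift_class_centre t0 t1) mulgV => H.
apply: (mulIg (lc (r, N4))^-1%g); rewrite mulgV; apply: H.
- by apply: (Qpath_seg (@convex_Qset R g)); exact: Q0.
- by apply: (Qpath_seg (@convex_Qset R g)); exact: Q0.
- move=> s _; rewrite /seg /= !mulr0 addr0 -mulrDl subrK mul1r; exact: f_cut.
Qed.

Lemma lift_class_side k m s : side_pair g k m -> 0 <= s <= 1 ->
  (lc (1%R, k%:R + s)%R * (lc (1%R, m%:R - s)%R)^-1 =
   lc (1%R, k%:R) * (lc (1%R, m%:R))^-1)%g.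
Proof.
move=> km hs.
have ss t : uI t -> 0 <= t * s <= 1.
  rewrite /unit_itv /= => ht; apply/andP; split; first by apply: mulr_ge0; lra.
  have : t * s <= t * 1 by apply: ler_wpM2l; lra.
  lra.
have := @lift_class_paths (fun t => (1, k%:R + t * s)) (fun t => (1, m%:R - t * s)).
rewrite !mul1r !mul0r addr0 subr0; apply.
- split; first by cont_lin.
  by move=> t ut; exact: (Qset_side_pair km (ss t ut)).1.
- split; first by cont_lin.
  by move=> t ut; exact: (Qset_side_pair km (ss t ut)).2.
- by move=> t ut; apply: f_side => //; exact: ss.
Qed.

Definition side_a (i : nat) : G := (lc (1%R, (4 * i)%:R) * (lc (1%R, (4 * i + 3)%:R))^-1)%g.
Definition side_b (i : nat) : G := (lc (1%R, (4 * i + 1)%:R) * (lc (1%R, (4 * i + 4)%:R))^-1)%g.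

(** The four side relations of a block lead from corner 0 to corners 3, 2, 1 and 4 in this order.
    The polygon relation thus comes from lifts, without a presentation. *)
Lemma lift_class_corner i : (i <= g)%N ->
  lc (1, (4 * i)%:R) = (turn side_a side_b i * lc (1%R, 0%R))%g.
Proof.
elim: i => [_|i IH ig]; first by rewrite muln0 mul1g.
have hs : 0 <= (1 : R) <= 1 by rewrite lexx ler01.
have ka : side_pair g (4 * i) (4 * i + 3) by exists i => //; left.
have kb : side_pair g (4 * i + 1) (4 * i + 4) by exists i => //; right.
have := lift_class_side ka hs; have := lift_class_side kb hs.
have -> : (4 * i + 4)%:R - 1 = (4 * i + 3)%:R :> R by rewrite !addnS -natr1 addrK.
have -> : (4 * i + 3)%:R - 1 = (4 * i + 2)%:R :> R by rewrite !addnS -natr1 addrK.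
rewrite -/(side_a i) -/(side_b i).
have -> : (4 * i + 1)%:R + 1 = (4 * i + 2)%:R :> R by rewrite natr1 -addnS.
have -> : (4 * i)%:R + 1 = (4 * i + 1)%:R :> R by rewrite natr1 addn1.
have := erefl (side_a i); have := erefl (side_b i); rewrite {2}/side_a {2}/side_b.
rewrite /= /commp /= invgK -mulgA -(IH (ltnW ig)) mulnSr.
move: (side_a i) (side_b i) => a b.
move: (lc (1, (4 * i)%:R)) (lc (1, (4 * i + 1)%:R)) (lc (1, (4 * i + 2)%:R)).
move: (lc (1, (4 * i + 3)%:R)) (lc (1, (4 * i + 4)%:R)) => e3 e4 e0 e1 e2 hb ha hb' ha'.
have -> : e4 = (b^-1 * e1)%g by rewrite hb invgM invgK mulgVK.
have -> : e1 = (a * e2)%g by rewrite -ha' mulgVK.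
have -> : e2 = (b * e3)%g by rewrite -hb' mulgVK.
have -> : e3 = (a^-1 * e0)%g by rewrite ha invgM invgK mulgVK.
by rewrite !mulgA.
Qed.

Lemma turn_side : turn side_a side_b g = 1%g.
Proof.
have hs : 0 <= (1 : R) <= 1 by rewrite lexx ler01.
apply: (mulIg (lc (1, 0))); rewrite mul1g -lift_class_corner //.
by rewrite -lift_class_cut.
Qed.

End SideClasses.

Theorem displacing_hom (R : realType) (n : nat) (S : topologicalType) (s0 : S) (G : groupType) :
  (4 ^ (30 * 2 ^ 12).+1 <= n)%N -> closed_surface R n.+2 S -> is_fundamental_group R s0 G ->
  exists rho : G -> bijection (hplane R),
  [/\ forall g h, rho (g * h)%g = (rho g * rho h)%g,
      forall g p q, hdist (rho g p) (rho g q) = hdist p q &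
      forall g p, g != 1%g -> 30 <= hdist p (rho g p)].
Proof.
move=> big; have {big}real := fun l => @isometry_realization R n G l big.
move=> [hS [f0 [cf0 f0_onto f0_fibre]]] [cls [cls_onto cls_hom cls_cat]].
pose g := n.+2; have g_gt0 : (0 < g)%N by [].
pose f := f0 \o @polar R g.
have cf : contw (@Qset R g) f.
  apply: (@contw_comp _ _ _ _ (@unit_disk R)).
  - exact: contw_polar.
  - by move=> u; exact: polar_disk.
  - exact/contwP.
have /choice[rep hrep] : forall x, exists u, @Qset R g u /\ f u = x.
  move=> x; have [z /set_mem zD fz] := f0_onto x.
  by have [u Qu uz] := polar_onto g_gt0 zD; exists u; rewrite /f /= uz.
have repQ x : @Qset R g (rep x) by case: (hrep x).
have repK x : f (rep x) = x by case: (hrep x).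
have f_centre (t t' : R) : f (0, t) = f (0, t') by exact: fibre_centre.
have f_cut (r : R) : f (r, 0) = f (r, (4 * g)%:R) by exact: fibre_cut.
have f_side k m (s : R) : side_pair g k m -> 0 <= s <= 1 -> f (1, k%:R + s) = f (1, m%:R - s).
  exact: fibre_side.
have f_ind := @fibre_ind R g g_gt0 S f0 f0_fibre; rewrite -/f in f_ind.
have contr := local_contraction g_gt0 hS cf f_centre f_cut f_side f_ind repQ repK.
pose lc := lift_class s0 cls f rep.
pose a := side_a s0 cls f rep; pose b := side_b s0 cls f rep.
have lc_centre : forall t t' : R, 0 <= t <= (4 * g)%:R -> 0 <= t' <= (4 * g)%:R -> lc (0, t) = lc (0, t').
  by move=> t t' ht ht'; have := lift_class_centre cls_hom cls_cat cf repQ repK f_centre ht ht'.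
have lc_cut (r : R) : 0 <= r <= 1 -> lc (r, 0) = lc (r, (4 * g)%:R).
  by move=> hr; have := lift_class_cut cls_hom cls_cat g_gt0 cf repQ repK f_centre f_cut hr.
have lc_side k m (s : R) : side_pair g k m -> 0 <= s <= 1 ->
    (lc (1%R, k%:R + s)%R * (lc (1%R, m%:R - s)%R)^-1 = lc (1%R, k%:R) * (lc (1%R, m%:R))^-1)%g.
  by move=> km hs; have := lift_class_side cls_hom cls_cat cf repQ repK f_side km hs.
have turn_ab : turn a b g = 1%g.
  exact: (turn_side cls_hom cls_cat g_gt0 cf repQ repK f_centre f_cut f_side).
pose l := rev (mkseq (fun j => ((b j)^-1%g, a j)) g).
have sl : size l = g by rewrite size_rev size_mkseq.
have [|L [C [[pL sL] [C1 CM CV] CL Ciso Cdisp]]] := real l sl; first by rewrite -turn_cprod.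
pose A i := (nth (1, 1)%g (rev L) i).2; pose B i := ((nth (1, 1)%g (rev L) i).1)^-1%g.
have turn_AB : turn A B g = 1%g.
  rewrite turn_cprod -pL; congr cprod; rewrite -[RHS]revK; congr rev.
  apply: (@eq_from_nth _ (1, 1)%g); first by rewrite size_mkseq size_rev sL.
  move=> i; rewrite size_mkseq => ig; rewrite nth_mkseq // /A /B invgK.
  by rewrite -surjective_pairing.
have CAB i : (i < g)%N -> C (A i) (a i) /\ C (B i) (b i).
  move=> ig; have lt : (g - i.+1 < n.+2)%N by rewrite ltn_subrL.
  have := CL _ lt.
  have -> : nth (1, 1)%g l (g - i.+1) = ((b i)^-1%g, a i).
    by rewrite nth_rev size_mkseq ?ltn_subrL // subnSK // subKn ?nth_mkseq // ltnW.
  have -> : nth (1, 1)%g L (g - i.+1) = nth (1, 1)%g (rev L) i by rewrite nth_rev sL.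
  by move=> [h1 h2]; split=> //; have := CV _ _ h1; rewrite /= invgK.
(* Beyond g the default of [nth] is 1, which is related to 1, so every [A i] is an isometry. *)
have CA0 i : exists c, C (A i) c.
  have [ig|ig] := ltnP i g; first by exists (a i); case: (CAB i ig).
  by exists 1%g; rewrite /A nth_default // size_rev sL.
have CB0 i : exists c, C (B i) c.
  have [ig|ig] := ltnP i g; first by exists (b i); case: (CAB i ig).
  by exists 1%g; rewrite /B nth_default ?size_rev ?sL // invg1.
have isoA i x y : hdist (A i x) (A i y) = hdist x y by have [c h] := CA0 i; exact: Ciso h _ _.
have isoB i x y : hdist (B i x) (B i y) = hdist x y by have [c h] := CB0 i; exact: Ciso h _ _.
pose F := cone g A B.
have F_near : forall w, @Qset R g w ->
    \forall z \near (w, w), @Qset R g z.1 -> @Qset R g z.2 -> hdist (F z.1) (F z.2) < 1.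
  by move=> w Qw; exact: cone_near.
have F_fibre : forall u v, @Qset R g u -> @Qset R g v -> f u = f v ->
    exists2 k : bijection (hplane R), F u = k (F v) & C k (lc u * (lc v)^-1)%g.
  apply: f_ind.
  - by move=> u _; exists 1%g => //; rewrite mulgV.
  - move=> u v _ _ [k e Ck]; exists k^-1%g; first by rewrite e bijVK.
    by have := CV _ _ Ck; rewrite invgM invgK.
  - move=> u v w _ _ _ [k e Ck] [k' e' Ck']; exists (k * k')%g; first by rewrite e e'.
    by have := CM _ _ _ _ Ck Ck'; rewrite mulgA mulgVK.
  - move=> t t' ht ht'; exists 1%g; first exact: cone_centre.
    by rewrite (lc_centre t t') // mulgV.
  - move=> r hr; exists 1%g; first exact: cone_cut.
    by rewrite lc_cut // mulgV.
  - move=> k m s km hs; have [i ig [[ek em]|[ek em]]] := km.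
    + exists (A i); last by rewrite lc_side // ek em; exact: (CAB i ig).1.
      by rewrite ek em; exact: cone_a.
    + exists (B i); last by rewrite lc_side // ek em; exact: (CAB i ig).2.
      by rewrite ek em; exact: cone_b.
have Cd k c : C k c -> k <> 1%g -> forall p, 30 <= hdist p (k p) by move=> h; exact: (Cdisp _ _ h).2.
have [rho rhoM Crho] := developing_hom cls_onto cls_hom cls_cat (@convex_Qset R g) cf repQ repK contr
  CM C1 CV Ciso Cd F_near F_fibre.
exists rho; split=> // [x p q|x p x1]; first exact: Ciso (Crho x) p q.
apply: (Cd _ _ (Crho x)) => e; move/eqP: x1; apply.
exact: (Cdisp _ _ (Crho x)).1.
Qed.

Theorem theorem1 (R : realType) (genus : nat) (S : topologicalType) (s0 : S)
    (Gamma : groupType) :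
  expR (10 ^+ 6) <= genus%:R :> R ->
  closed_surface R genus S ->
  is_fundamental_group R s0 Gamma ->
  exists2 act : Gamma -> hplane R -> hplane R, covering_action act &
    forall (p : hplane R) (x y a b : group_ring Gamma),
      y <> 0 ->
      ~ (a = 0 /\ b = 0) ->
      a * x + b * y = 0 ->
      exists q r : group_ring Gamma,
        x = q * y + r /\ (diameter act p r < diameter act p y \/ r = 0).
Proof.
move=> /genus_bound [n -> big] hS hG.
have {big hS hG} [rho [rhoM rhoI rhoD]] := displacing_hom big hS hG.
have rho1 : rho 1%g = 1%g by apply: (mulgI (rho 1%g)); rewrite -rhoM !mulg1.
pose act g p : hplane R := rho g p.
have act1 p : act 1%g p = p by rewrite /act rho1.
have actM g h p : act (g * h)%g p = act g (act h p) by rewrite /act rhoM.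
exists act; last by move=> p x y a b; exact: (division act1 actM rhoI rhoD).
(* The radius 15 is half the displacement. *)
split=> // p; exists 15 => // g q r g1 pq pr e.
suff : (0 : R) < 0 by rewrite ltxx.
have := rhoD g q g1; rewrite -[rho g q]/(act g q) e.
have := hdist_triangle p q r; rewrite (hdistC q p).
by move: pq pr; move: (hdist _ _) (hdist _ _) (hdist _ _) => *; lra.
Qed.
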